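(* Let $\rho,a_1,a_2,\theta\in\mathbb{R}$ with $|\rho|<1$ and $\theta>\max\{\tfrac14,\tfrac{1+|\rho|}{6}\}$ (the value $\theta=\tfrac12$ is allowed). Let $c>0$ and $\lambda>0$ be fixed real numbers and let $N_0\ge 0$ be a fixed integer. For each integer $N\ge 1$ put $\Delta t=1/N$, $h=\Delta t/\lambda$, $h_1=h$, $h_2=ch$, and let $(U_{N,j,k})_{j,k\in\mathbb{Z}}$ be the numerical solution at time $t=1$ produced on the grid $(x_j,y_k)=(jh_1,kh_2)$ by the Modified Craig--Sneyd scheme with parameter $\theta$, with the first $N_0$ time steps replaced by $2N_0$ half-steps of the implicit Euler scheme, as defined in the context. Let $u$ be the exact solution of the model problem $u_t=u_{xx}+2\rho u_{xy}+u_{yy}+a_1u_x+a_2u_y$ with $u(x,y,0)=\delta(x)\delta(y)$, given explicitly in the context. Then, as $h\to 0$ (that is, $N\to\infty$ with $c$ and $\lambda$ held fixed), the total error in the maximum norm satisfies $$\sup_{j,k\in\mathbb{Z}}\left|U_{N,j,k}-u(x_j,y_k,1)\right|=\mathcal{O}\left(h^{\min\{2,\,2N_0-2\}}\right).$$ That is, there exist a constant $K>0$ and an integer $N_*\ge \max\{1,N_0\}$, depending only on $\rho,a_1,a_2,\theta,c,\lambda,N_0$, such that for all $N\ge N_*$ and all $j,k\in\mathbb{Z}$ one has $|U_{N,j,k}-u(x_j,y_k,1)|\le K h^{\min\{2,2N_0-2\}}$.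
   Context: Exact solution. For $t>0$, $$u(x,y,t)=\frac{1}{4\pi t\sqrt{1-\rho^2}}\exp\left(-\frac{1}{4t}\frac{1}{1-\rho^2}\left[(x+a_1t)^2+(y+a_2t)^2-2\rho(x+a_1t)(y+a_2t)\right]\right),$$ which is the solution on $\mathbb{R}^2\times(0,1]$ of $u_t=u_{xx}+2\rho u_{xy}+u_{yy}+a_1u_x+a_2u_y$ with initial data $\delta(x)\delta(y)$, where $\delta$ is the Dirac delta. Equivalently, its Fourier transform in $(x,y)$ is $\exp(-(\kappa^2+2\rho\kappa\eta+\eta^2-\mathbf{i}a_1\kappa-\mathbf{i}a_2\eta)t)$, with $\mathbf{i}$ the imaginary unit. Spatial discretization. For a grid function $V=(V_{j,k})_{j,k\in\mathbb{Z}}$ define $(\delta_{2x}V)_{j,k}=V_{j+1,k}-V_{j-1,k}$, $(\delta_x^2V)_{j,k}=V_{j-1,k}-2V_{j,k}+V_{j+1,k}$, and analogously $\delta_{2y},\delta_y^2$ acting on the index $k$. Set $$A_0=\frac{\rho}{2h_1h_2}\delta_{2x}\delta_{2y},\qquad A_1=\frac{1}{h_1^2}\delta_x^2+\frac{a_1}{2h_1}\delta_{2x},\qquad A_2=\frac{1}{h_2^2}\delta_y^2+\frac{a_2}{2h_2}\delta_{2y},\qquad A=A_0+A_1+A_2,$$ and $Z=\Delta t\,A$, $Z_i=\Delta t\,A_i$ for $i=0,1,2$; $I$ is the identity operator. All grid functions are in $\ell^2(\mathbb{Z}^2)$, and implicit equations are solved in $\ell^2(\mathbb{Z}^2)$ (equivalently,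 via the discrete Fourier transform). In the definition of $A_0$ the product of the difference operators is the factor as written, so that $(\delta_{2x}\delta_{2y}V)_{j,k}=V_{j+1,k+1}+V_{j-1,k-1}-V_{j+1,k-1}-V_{j-1,k+1}$. Initial data: $U_{0,j,k}=\frac{1}{h_1h_2}$ if $j=k=0$, and $U_{0,j,k}=0$ otherwise. Time stepping (assume $N\ge N_0$). For $n=1,\dots,N_0$ (Rannacher start-up, two implicit Euler half-steps): $$(I-\tfrac12Z)U_{n-1/2}=U_{n-1},\qquad (I-\tfrac12Z)U_n=U_{n-1/2}.$$ For $n=N_0+1,\dots,N$ (Modified Craig--Sneyd step with parameter $\theta$): $$Y_0=(I+Z)U_{n-1},$$ $$(I-\theta Z_i)Y_i=Y_{i-1}-\theta Z_iU_{n-1}\quad(i=1,2),$$ $$\widehat Y_0=Y_0+\theta Z_0Y_2-\theta Z_0U_{n-1},$$ $$\widetilde Y_0=\widehat Y_0+(\tfrac12-\theta)ZY_2-(\tfrac12-\theta)ZU_{n-1},$$ $$(I-\theta Z_i)\widetilde Y_i=\widetilde Y_{i-1}-\theta Z_iU_{n-1}\quad(i=1,2),$$ $$U_n=\widetilde Y_2.$$ The value of $U_n$ at grid index $(j,k)$ is denoted $U_{n,j,k}$. *)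

(* Defs.v *)
From HB Require Import structures.
From mathcomp Require Import all_boot all_order all_algebra.
From mathcomp Require Import all_classical all_reals all_analysis.

Set Implicit Arguments.
Unset Strict Implicit.
Unset Printing Implicit Defensive.

Import Order.TTheory GRing.Theory Num.Theory.
Import numFieldNormedType.Exports.

Local Open Scope classical_set_scope.
Local Open Scope ring_scope.

Definition exact_solution (R : realType) (rho a1 a2 x y t : R) : R :=
  (4 * pi * t * Num.sqrt (1 - rho ^+ 2))^-1 *
  expR (- ((4 * t)^-1 * (1 - rho ^+ 2)^-1 *
    ((x + a1 * t) ^+ 2 + (y + a2 * t) ^+ 2 -
     2 * rho * (x + a1 * t) * (y + a2 * t)))).

(* The scheme has real coefficients and real initial data, so real-valued grid
   functions suffice. *)
Notation grid R := (int -> int -> R).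

Definition in_l2 (R : realType) (V : grid R) : Prop :=
  summable [set: int * int] (fun p => ((V p.1 p.2) ^+ 2)%:E).

Section Operators.
Context {R : realType}.
Implicit Type V : grid R.

Definition delta2x V : grid R := fun j k => V (j + 1) k - V (j - 1) k.
Definition delta2y V : grid R := fun j k => V j (k + 1) - V j (k - 1).
Definition deltaxx V : grid R :=
  fun j k => V (j - 1) k - 2 * V j k + V (j + 1) k.
Definition deltayy V : grid R :=
  fun j k => V j (k - 1) - 2 * V j k + V j (k + 1).

Definition A0 (rho h1 h2 : R) V : grid R :=
  fun j k => rho / (2 * h1 * h2) * delta2x (delta2y V) j k.
Definition A1 (a1 h1 : R) V : grid R :=
  fun j k => (h1 ^+ 2)^-1 * deltaxx V j k + a1 / (2 * h1) * delta2x V j k.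
Definition A2 (a2 h2 : R) V : grid R :=
  fun j k => (h2 ^+ 2)^-1 * deltayy V j k + a2 / (2 * h2) * delta2y V j k.

Definition initial_data (h1 h2 : R) : grid R :=
  fun j k => if (j == 0) && (k == 0) then (h1 * h2)^-1 else 0.

(* The solution W in l^2(Z^2) of (I - s B) W = F.  The value 0 is returned when
   there is no such W; if there were several, an arbitrary one is returned. *)
Definition implicit_solve (s : R) (B : grid R -> grid R) (F : grid R)
    : grid R :=
  xget 0 [set W : grid R | in_l2 W /\ W - s *: B W = F].

(* Two implicit Euler half-steps. *)
Definition rannacher_step (Z : grid R -> grid R) V : grid R :=
  implicit_solve 2^-1 Z (implicit_solve 2^-1 Z V).

Definition mcs_step (theta : R) (Z0 Z1 Z2 Z : grid R -> grid R) V : grid R :=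
  let Y0 := V + Z V in
  let Y1 := implicit_solve theta Z1 (Y0 - theta *: Z1 V) in
  let Y2 := implicit_solve theta Z2 (Y1 - theta *: Z2 V) in
  let Yh0 := Y0 + theta *: Z0 Y2 - theta *: Z0 V in
  let Yt0 := Yh0 + (2^-1 - theta) *: Z Y2 - (2^-1 - theta) *: Z V in
  let Yt1 := implicit_solve theta Z1 (Yt0 - theta *: Z1 V) in
  let Yt2 := implicit_solve theta Z2 (Yt1 - theta *: Z2 V) in
  Yt2.

Fixpoint numerical_solution (rho a1 a2 theta dt h1 h2 : R) (N0 n : nat)
    : grid R :=
  match n with
  | 0%N => initial_data h1 h2
  | m.+1 =>
    let Z0 := fun V : grid R => dt *: A0 rho h1 h2 V in
    let Z1 := fun V : grid R => dt *: A1 a1 h1 V in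
    let Z2 := fun V : grid R => dt *: A2 a2 h2 V in
    let Z := fun V : grid R =>
      dt *: (A0 rho h1 h2 V + A1 a1 h1 V + A2 a2 h2 V) in
    let U := numerical_solution rho a1 a2 theta dt h1 h2 N0 m in
    if (m < N0)%N then rannacher_step Z U else mcs_step theta Z0 Z1 Z2 Z U
  end.

End Operators.

(* Main.v *)
Require Import Defs.
From HB Require Import structures.
From mathcomp Require Import all_boot all_order all_algebra.
From mathcomp Require Import all_classical all_reals all_analysis.
From mathcomp Require Import measurable_realfun ring lra zify.
Set Implicit Arguments.
Unset Strict Implicit.
Unset Printing Implicit Defensive.
Import Order.TTheory GRing.Theory Num.Theory.
Import numFieldNormedType.Exports.
From mathcomp Require Import complex.
Import ComplexField.Normc.
Local Open Scope classical_set_scope.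
Local Open Scope complex_scope.
Local Open Scope ring_scope.

(** The numerical and the exact solution are both inverse Fourier integrals, and
    the error in the maximum norm is bounded by the integral of the difference of
    the two transforms ([fourier_error]).

    On the grid, [ifou h1 h2 F] is (4 pi^2)^-1 times the integral, over the box
    |h1 k| <= pi, |h2 e| <= pi, of Re (F exp (i phase)).  The discrete Dirac mass
    has symbol F = 1.  A difference operator multiplies F by a trigonometric
    polynomial.  An implicit equation (I - s Z) W = V divides F by 1 - s z; here
    the solution has to be identified among square summable functions, where it is
    unique by a discrete energy argument ([stencil_unique]), and inverse Fourier
    integrals are square summable by Bessel's inequality ([ifou_l2]).  After N
    steps the symbol is therefore M^(N - N0) E^(2 N0), with M the amplification
    factor of a Modified Craig--Sneyd step and E that of an implicit Euler
    half-step, rational functions of the symbols of A0, A1, A2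
    ([numerical_solutionE]).  The exact
    solution is the Fourier integral over the plane of a Gaussian
    ([exact_solutionE]).

    The core is the bound |M|^2 <= 1 - c g with the dissipation
    g = x / (1 + theta x)^2 + y / (1 + theta y)^2, where - x and - y are the
    symbols of the two diffusion operators, times dt ([mcs_factor_stable]).  Without
    convection M is real and the bound is an algebraic inequality; it is there
    that theta > 1/4 and 6 theta > 1 + |rho| enter ([mcs_diff_stable]).
    Convection changes Re M by O(dt g) and Im M by O(sqrt (dt g)), which is
    absorbed for small time steps.

    Put q = k^2 + e^2.  For dt q <= 1 one has g >= c dt q, and one step of the
    scheme differs from the exact propagator by O((dt (1 + q))^3), each start-up
    step by O((dt (1 + q))^2) ([low_consistency]); as both factors are at most
    exp (- c dt q) in modulus, telescoping over N = 1 / dt steps gives an error dt^2 times a Gaussian in q ([pointwise_low]).  In the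
    rest of the box w = x + y is bounded below, |M|^2 <= 1 - c / w and
    |E| <= C / w, so that the numerical transform is at most
    C w^(- 2 N0) exp (- c N / w) = O(dt^(2 N0)) ([pointwise_high]); since the box
    has area of order h^-2, this contributes h^(2 N0 - 2).  The exact transform is
    below dt^2 times a Gaussian wherever dt q >= 1 ([gauss_high]), in particular
    outside the box. *)

Lemma lerX2 (R : realDomainType) (x y : R) : 0 <= x -> x <= y -> x ^+ 2 <= y ^+ 2.
Proof. by move=> x0 xy; rewrite lerXn2r// nnegrE// (le_trans x0). Qed.

(** * Modulus, real and imaginary parts *)

Section ComplexNorm.
Context {R : rcfType}.
Implicit Types z w : R[i].

Lemma sqr_normcE z : normc z ^+ 2 = Re z ^+ 2 + Im z ^+ 2.
Proof. by case: z => a b /=; rewrite sqr_sqrtr// addr_ge0 ?sqr_ge0. Qed.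

Lemma normc_ge0 z : 0 <= normc z.
Proof. by case: z => a b /=; exact: sqrtr_ge0. Qed.

Lemma normcR (x : R) : normc (x%:C)%C = `|x|.
Proof. by rewrite /= expr0n/= addr0 sqrtr_sqr. Qed.

Lemma normcX z n : normc (z ^+ n) = normc z ^+ n.
Proof.
elim: n => [|n IH]; first by rewrite !expr0 normc1.
by rewrite !exprS normcM IH.
Qed.

Lemma Re_le_normc z : `|Re z| <= normc z.
Proof.
rewrite -(@ler_pXn2r _ 2)// ?nnegrE ?normc_ge0//.
by rewrite sqr_normcE real_normK ?num_real// lerDl sqr_ge0.
Qed.

Lemma Im_le_normc z : `|Im z| <= normc z.
Proof.
rewrite -(@ler_pXn2r _ 2)// ?nnegrE ?normc_ge0//.
by rewrite sqr_normcE real_normK ?num_real// lerDr sqr_ge0.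
Qed.

Lemma normc_le z : normc z <= `|Re z| + `|Im z|.
Proof.
rewrite -(@ler_pXn2r _ 2)// ?nnegrE ?normc_ge0// ?addr_ge0//.
rewrite sqr_normcE sqrrD !real_normK ?num_real//.
rewrite -addrA [X in _ <= _ + X]addrC addrA lerDl.
by rewrite mulrn_wge0// mulr_ge0.
Qed.

Lemma ReD z w : Re (z + w) = Re z + Re w. Proof. by case: z w => ? ? []. Qed.
Lemma ImD z w : Im (z + w) = Im z + Im w. Proof. by case: z w => ? ? []. Qed.
Lemma ReN z : Re (- z) = - Re z. Proof. by case: z. Qed.
Lemma ImN z : Im (- z) = - Im z. Proof. by case: z. Qed.
Lemma ReM z w : Re (z * w) = Re z * Re w - Im z * Im w.
Proof. by case: z w => ? ? []. Qed.
Lemma ImM z w : Im (z * w) = Re z * Im w + Im z * Re w.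
Proof. by case: z w => ? ? []. Qed.
Lemma ReV z : Re z^-1 = Re z / (Re z ^+ 2 + Im z ^+ 2).
Proof. by case: z. Qed.
Lemma ImV z : Im z^-1 = - (Im z / (Re z ^+ 2 + Im z ^+ 2)).
Proof. by case: z. Qed.

Lemma ReRM (x : R) z : Re (x%:C%C * z) = x * Re z.
Proof. by case: z => a b /=; rewrite mul0r subr0. Qed.
Lemma ImRM (x : R) z : Im (x%:C%C * z) = x * Im z.
Proof. by case: z => a b /=; rewrite mul0r addr0. Qed.

End ComplexNorm.

(** * Stability of the amplification factor without convection *)

Section RealStability.
Context {R : realType}.

(** The dissipation of one step, where - a^2 and - b^2 are the symbols of the
    two diffusion operators.  The term in a behaves like a^2 for small a and like
    a^-2 for large a, and likewise for b. *)
Definition dissip (theta a b : R) : R :=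
  a ^+ 2 / (1 + theta * a ^+ 2) ^+ 2 + b ^+ 2 / (1 + theta * b ^+ 2) ^+ 2.

(** The amplification factor of a step without convection; s is the symbol of
    the mixed derivative. *)
Definition mcs_diff (theta a b s : R) : R :=
  let P := (1 + theta * a ^+ 2) * (1 + theta * b ^+ 2) in
  let u := (s - a ^+ 2 - b ^+ 2) / P in
  let v := (- a ^+ 2 - b ^+ 2) / P in
  1 + u + u ^+ 2 / 2 - theta * u * v.

Lemma dissip_lew (theta a b : R) (th4 : 1 / 4 < theta) :
  dissip theta a b <= 2 * ((a ^+ 2 + b ^+ 2) /
    ((1 + theta * a ^+ 2) * (1 + theta * b ^+ 2))).
Proof.
rewrite /dissip; set x := a ^+ 2; set y := b ^+ 2.
have x0 : 0 <= x by exact: sqr_ge0.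
have y0 : 0 <= y by exact: sqr_ge0.
have tx : 0 <= theta * x by apply: mulr_ge0 => //; lra.
have ty : 0 <= theta * y by apply: mulr_ge0 => //; lra.
have txy : 0 <= theta * x * y by apply: mulr_ge0.
have half (p q : R) : 0 <= p -> 0 <= q -> 0 <= theta * p -> 0 <= theta * q ->
    p / (1 + theta * p) ^+ 2 <= (p + q) / ((1 + theta * p) * (1 + theta * q)).
  move=> p0 q0 tp tq.
  have Pp : 0 < 1 + theta * p by lra.
  have Pq : 0 < 1 + theta * q by lra.
  rewrite ler_pdivrMr ?exprn_gt0// mulrAC ler_pdivlMr ?mulr_gt0//.
  rewrite expr2 !mulrA [X in X <= _]mulrAC ler_pM2r//.
  have pq : 0 <= p * (theta * p) by exact: mulr_ge0.
  have := mulr_ge0 q0 tp; nra.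
rewrite mulr_natl mulr2n lerD//; first exact: half.
by rewrite [x + y]addrC [(1 + theta * x) * _]mulrC; exact: half.
Qed.

Lemma dissip_lexy (theta a b : R) (th4 : 1 / 4 < theta) :
  theta * dissip theta a b <= 2 * ((1 + theta ^+ 2 * a ^+ 2 * b ^+ 2) /
    ((1 + theta * a ^+ 2) * (1 + theta * b ^+ 2))).
Proof.
rewrite /dissip; set x := a ^+ 2; set y := b ^+ 2.
have x0 : 0 <= x by exact: sqr_ge0.
have y0 : 0 <= y by exact: sqr_ge0.
have tx : 0 <= theta * x by apply: mulr_ge0 => //; lra.
have ty : 0 <= theta * y by apply: mulr_ge0 => //; lra.
have half (p q : R) : 0 <= p -> 0 <= q -> 0 <= theta * p -> 0 <= theta * q ->
    theta * (p / (1 + theta * p) ^+ 2) <=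
    (1 + theta ^+ 2 * p * q) / ((1 + theta * p) * (1 + theta * q)).
  move=> p0 q0 tp tq.
  have Pp : 0 < 1 + theta * p by lra.
  have Pq : 0 < 1 + theta * q by lra.
  rewrite mulrA ler_pdivrMr ?exprn_gt0// mulrAC ler_pdivlMr ?mulr_gt0//.
  rewrite expr2 !mulrA [X in X <= _]mulrAC ler_pM2r//.
  have -> : theta ^+ 2 * p * q = (theta * p) * (theta * q) by ring.
  have := mulr_ge0 (mulr_ge0 tp tp) tq.
  set P := theta * p in tp Pp *; set Q := theta * q in tq Pq * => h.
  have PQ := mulr_ge0 tp tq.
  nra.
rewrite mulrDr mulr_natl mulr2n lerD//; first exact: half.
by rewrite [theta ^+ 2 * x * y]mulrAC [(1 + theta * x) * _]mulrC; exact: half.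
Qed.

(** With D = a^2 + b^2 - s, w = a^2 + b^2, t = |a b| and
    P = (1 + theta a^2) (1 + theta b^2) = 1 + theta w + theta^2 t^2, the factor R
    satisfies 1 - R = (D / P) (P + theta w - D / 2) / P and
    2 P^2 (1 + R) = (D - P - theta w)^2 + (P - theta w) (3 P + theta w).
    In the first identity D / 2 <= w / 2 + r t and 2 t <= w, so that the last
    factor stays above a positive constant as soon as 4 theta > 1, from the
    coefficient of w, and 6 theta > 1 + r, from the coefficient of t.  The second
    identity gives 1 + R >= (3 / 2) (P - theta w) / P. *)
Lemma mcs_diff_stable (r theta : R) (r0 : 0 <= r) (r1 : r < 1)
  (th4 : 1 / 4 < theta) (th6 : 1 + r < 6 * theta) : exists2 c : R, 0 < c & forall a b k : R,
  `|k| <= r ->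
  c * dissip theta a b <= 1 - mcs_diff theta a b (2 * k * a * b) /\
  c * dissip theta a b <= 1 + mcs_diff theta a b (2 * k * a * b).
Proof.
(* each bound on c0 keeps one of the coefficients of 1, t and w in
   P + theta w - D / 2 - c0 P nonnegative *)
pose c0 := Num.min (1/2) (Num.min ((6 * theta - 1 - r) / (4 * theta))
    ((2 * theta - 1 / 2) / theta)).
have t0 : 0 < theta by lra.
have c00 : 0 < c0.
  by rewrite !lt_min; apply/and3P; split; [lra| |]; apply: divr_gt0; lra.
have c01 : c0 <= 1/2 by rewrite ge_min lexx.
have c02 : c0 * (4 * theta) <= 6 * theta - 1 - r.
  by rewrite -ler_pdivlMr; [rewrite !ge_min lexx orbT|lra].
have c03 : c0 * theta <= 2 * theta - 1 / 2.
  by rewrite -ler_pdivlMr; [rewrite !ge_min lexx !orbT|lra].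
exists (Num.min (c0 * (1 - r) / 2) (3 / 4 * theta)).
  by rewrite lt_min; apply/andP; split; [apply: divr_gt0; [apply: mulr_gt0|]|]; lra.
move=> a b k kr.
have g0 : 0 <= dissip theta a b.
  by rewrite addr_ge0// divr_ge0 ?sqr_ge0.
have := dissip_lew a b th4; have := dissip_lexy a b th4.
rewrite /mcs_diff.
set g := dissip theta a b in g0 *.
set x := a ^+ 2; set y := b ^+ 2.
have x0 : 0 <= x by exact: sqr_ge0.
have y0 : 0 <= y by exact: sqr_ge0.
set X := 1 + theta * x; set Y := 1 + theta * y.
have X0 : 0 < X by rewrite /X ltr_pwDl// mulr_ge0// ltW.
have Y0 : 0 < Y by rewrite /Y ltr_pwDl// mulr_ge0// ltW.
have P0 : 0 < X * Y by exact: mulr_gt0.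
pose t := `|a * b|.
have t_ge0 : 0 <= t by exact: normr_ge0.
have tt : t ^+ 2 = x * y by rewrite real_normK ?num_real// exprMn.
have tw : 2 * t <= x + y.
  have : 0 <= (`|a| - `|b|) ^+ 2 by exact: sqr_ge0.
  rewrite sqrrB !real_normK ?num_real// -normrM -/x -/y -/t; lra.
set s := 2 * k * a * b.
have sb : `|s| <= 2 * r * t.
  by rewrite /s -!mulrA normrM ger0_norm// ler_wpM2l// normrM ler_wpM2r.
have [s1 s2] : s <= 2 * r * t /\ - (2 * r * t) <= s.
  by move: sb; rewrite ler_norml => /andP[].
have rt0 : 0 <= r * t by exact: mulr_ge0.
have rt : r * (2 * t) <= r * (x + y) by rewrite ler_wpM2l.
set D := x + y - s.
have D1 : (1 - r) * (x + y) <= D by rewrite /D; lra.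
have w0 : 0 <= x + y by exact: addr_ge0.
have D2 : D <= x + y + 2 * r * t by rewrite /D; lra.
have D0 : 0 <= D by apply: le_trans D1; rewrite mulr_ge0//; lra.
have -> : s - x - y = - D by rewrite /D; ring.
have -> : - x - y = - (x + y) by ring.
have PE : X * Y = 1 + theta * (x + y) + theta ^+ 2 * t ^+ 2.
  by rewrite tt /X /Y; ring.
have -> : theta ^+ 2 * x * y = theta ^+ 2 * t ^+ 2 by rewrite tt; ring.
set P := X * Y in P0 PE *; set w := x + y in w0 tw rt D1 D2 PE *.
clearbody D g s t w P.
move=> gxy gw.
have th2t2 : (theta * t) ^+ 2 = theta ^+ 2 * t ^+ 2 by rewrite exprMn.
split.
- apply: (@le_trans _ _ (c0 * (D / P))).
    apply: (@le_trans _ _ (c0 * (1 - r) / 2 * g)).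
      by rewrite ler_wpM2r// ge_min lexx.
    apply: (@le_trans _ _ (c0 * (1 - r) / 2 * (2 * (w / P)))).
      by rewrite ler_wpM2l// mulr_ge0// ?mulr_ge0//; lra.
    have -> : c0 * (1 - r) / 2 * (2 * (w / P)) = c0 * ((1 - r) * w / P).
      by field; rewrite gt_eqF.
    by rewrite ler_wpM2l ?(ltW c00)// ler_pM2r// invr_gt0.
  have Q : c0 * P <= P + theta * w - D / 2.
    have Dw : D / 2 <= w / 2 + r * t by lra.
    have : 0 <= (1 - theta * t) ^+ 2 by exact: sqr_ge0.
    rewrite sqrrB expr1n mul1r th2t2 => sq.
    have sq' : 2 * (theta * t) <= 1 + theta ^+ 2 * t ^+ 2 by lra.
    have : 0 <= (1 - c0) * (1 + theta ^+ 2 * t ^+ 2 - 2 * (theta * t)).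
      by rewrite mulr_ge0//; lra.
    have : 0 <= (2 * theta - 1 / 2 - c0 * theta) * (w - 2 * t).
      by rewrite mulr_ge0//; lra.
    have : 0 <= (6 * theta - 1 - r - c0 * (4 * theta)) * t.
      by rewrite mulr_ge0//; lra.
    by rewrite PE; nra.
  have -> : 1 - (1 + - D / P + (- D / P) ^+ 2 / 2
      - theta * (- D / P) * (- w / P)) = (D / P) * ((P + theta * w - D / 2) / P).
    by field; rewrite gt_eqF.
  rewrite [leLHS]mulrC ler_wpM2l// ?divr_ge0// ?(ltW P0)//.
  by rewrite ler_pdivlMr.
- apply: (@le_trans _ _ (3 / 2 * ((1 + theta ^+ 2 * t ^+ 2) / P))).
    apply: (@le_trans _ _ (3 / 4 * theta * g)).
      by rewrite ler_wpM2r// ge_min lexx orbT.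
    lra.
  have -> : 1 + (1 + - D / P + (- D / P) ^+ 2 / 2 -
     theta * (- D / P) * (- w / P)) =
     ((D - (P + theta * w)) ^+ 2 + (P - theta * w) * (3 * P + theta * w)) / (2 * P ^+ 2).
    by field; rewrite gt_eqF.
  rewrite mulrA ler_pdivrMr// [leRHS]mulrAC ler_pdivlMr ?mulr_gt0 ?exprn_gt0//.
  have h1 : 0 <= (D - (P + theta * w)) ^+ 2 by exact: sqr_ge0.
  have -> : P - theta * w = 1 + theta ^+ 2 * t ^+ 2 by rewrite PE; ring.
  set q := 1 + _.
  have q0 : 0 <= q by rewrite /q addr_ge0// mulr_ge0 ?sqr_ge0.
  have tw0 : 0 <= theta * w by rewrite mulr_ge0// ltW.
  have -> : 3 / 2 * q * (2 * P ^+ 2) = q * (3 * P) * P by field.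
  rewrite ler_wpM2r ?(ltW P0)//.
  have : 0 <= q * (theta * w) by rewrite mulr_ge0.
  by lra.
Qed.

End RealStability.

(** * Stability of the amplification factor with convection *)

Section NearReal.
Context {R : realType} (T : Type) (D : T -> Prop) (e : T -> R).
Hypothesis e01 : forall t, D t -> 0 <= e t <= 1.

(** The complex function f is a perturbation of the real function fr in a way
    that costs O(e) in the squared modulus: the real part moves by O(e), and the
    imaginary part is only O(sqrt e). *)
Definition near_real (f : T -> R[i]) (fr : T -> R) :=
  exists2 K, 0 <= K & forall t, D t ->
    [/\ `|fr t| <= K, `|Re (f t) - fr t| <= K * e t & Im (f t) ^+ 2 <= K * e t].

Lemma near_realR (fr : T -> R) (K : R) : 0 <= K ->
  (forall t, D t -> `|fr t| <= K) -> near_real (fun t => (fr t)%:C) fr.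
Proof.
move=> K0 fK; exists K => // t Dt; have /andP[e0 _] := e01 Dt.
by split; [exact: fK|rewrite /= subrr normr0 mulr_ge0|rewrite /= expr0n/= mulr_ge0].
Qed.

Lemma near_real_cst (k : R) : near_real (fun=> k%:C) (fun=> k).
Proof. exact: (@near_realR (fun=> k) `|k|). Qed.

Lemma near_realD f fr g gr : near_real f fr -> near_real g gr ->
  near_real (fun t => f t + g t) (fun t => fr t + gr t).
Proof.
move=> [K K0 fK] [L L0 gL]; exists (2 * K + 2 * L); first by lra.
move=> t Dt; have /andP[e0 e1] := e01 Dt.
have [f1 f2 f3] := fK t Dt; have [g1 g2 g3] := gL t Dt.
have Ke : 0 <= K * e t by exact: mulr_ge0.
have Le : 0 <= L * e t by exact: mulr_ge0.
split.
- by apply: (le_trans (ler_normD _ _)); lra.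
- rewrite ReD opprD addrACA; apply: (le_trans (ler_normD _ _)); lra.
- rewrite ImD; have := sqr_ge0 (Im (f t) - Im (g t)); nra.
Qed.

(** The product of two imaginary parts of size sqrt e is O(e), and each of
    them is multiplied by a bounded factor in the imaginary part of the product. *)
Lemma near_realM f fr g gr : near_real f fr -> near_real g gr ->
  near_real (fun t => f t * g t) (fun t => fr t * gr t).
Proof.
move=> [K0 K00 fK] [L0 L00 gL].
pose K := K0 + 1; pose L := L0 + 1.
have K1 : 1 <= K by rewrite /K; lra.
have L1 : 1 <= L by rewrite /L; lra.
have KL1 : 1 <= K * L by rewrite -[1]mulr1 ler_pM.
exists (16 * (K * L) ^+ 2); first by rewrite mulr_ge0 ?sqr_ge0.
move=> t Dt; have /andP[e0 e1] := e01 Dt.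
have [f1 f2 f3] : [/\ `|fr t| <= K, `|Re (f t) - fr t| <= K * e t &
    Im (f t) ^+ 2 <= K * e t].
  by have [f1 f2 f3] := fK t Dt; split; rewrite /K ?mulrDl ?mul1r; lra.
have [g1 g2 g3] : [/\ `|gr t| <= L, `|Re (g t) - gr t| <= L * e t &
    Im (g t) ^+ 2 <= L * e t].
  by have [g1 g2 g3] := gL t Dt; split; rewrite /L ?mulrDl ?mul1r; lra.
have KL2 : K * L <= (K * L) ^+ 2 by rewrite expr2 ler_peMl//; lra.
have Rf : `|Re (f t)| <= 2 * K.
  have -> : Re (f t) = (Re (f t) - fr t) + fr t by rewrite subrK.
  apply: (le_trans (ler_normD _ _)).
  have : K * e t <= K * 1 by rewrite ler_wpM2l//; lra.
  lra.
have Rg : `|Re (g t)| <= 2 * L.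
  have -> : Re (g t) = (Re (g t) - gr t) + gr t by rewrite subrK.
  apply: (le_trans (ler_normD _ _)).
  have : L * e t <= L * 1 by rewrite ler_wpM2l//; lra.
  lra.
have E0 : 0 <= (K * L) ^+ 2 * e t by rewrite mulr_ge0 ?sqr_ge0.
have E1 : K * L * e t <= (K * L) ^+ 2 * e t by rewrite ler_wpM2r.
split.
- rewrite normrM; apply: (@le_trans _ _ (K * L)); first by rewrite ler_pM.
  by lra.
- rewrite ReM.
  have -> : Re (f t) * Re (g t) - Im (f t) * Im (g t) - fr t * gr t =
    (Re (f t) - fr t) * Re (g t) + fr t * (Re (g t) - gr t)
    - Im (f t) * Im (g t) by ring.
  have h1 : `|(Re (f t) - fr t) * Re (g t)| <= (K * e t) * (2 * L).
    by rewrite normrM ler_pM.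
  have h2 : `|fr t * (Re (g t) - gr t)| <= K * (L * e t).
    by rewrite normrM ler_pM.
  have h3 : `|Im (f t) * Im (g t)| <= K * L * e t.
    rewrite -(@ler_pXn2r _ 2)// ?nnegrE//; last first.
      by rewrite mulr_ge0//; lra.
    rewrite real_normK ?num_real// exprMn.
    apply: (@le_trans _ _ ((K * e t) * (L * e t))).
      by rewrite ler_pM ?sqr_ge0.
    have -> : (K * L * e t) ^+ 2 = (K * L) * (K * e t * (L * e t)) by ring.
    by rewrite ler_peMl// !mulr_ge0//; lra.
  apply: (le_trans (ler_normB _ _)).
  by apply: (le_trans (lerD (ler_normD _ _) h3)); lra.
- rewrite ImM.
  have s1 : (Re (f t) * Im (g t)) ^+ 2 <= (4 * K ^+ 2) * (L * e t).
    rewrite exprMn ler_pM ?sqr_ge0//.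
    rewrite -real_normK ?num_real//.
    have -> : 4 * K ^+ 2 = (2 * K) ^+ 2 by ring.
    by rewrite lerXn2r ?nnegrE//; lra.
  have s2 : (Im (f t) * Re (g t)) ^+ 2 <= (K * e t) * (4 * L ^+ 2).
    rewrite exprMn ler_pM ?sqr_ge0//.
    rewrite -[X in X <= _]real_normK ?num_real//.
    have -> : 4 * L ^+ 2 = (2 * L) ^+ 2 by ring.
    by rewrite lerXn2r ?nnegrE//; lra.
  have := sqr_ge0 (Re (f t) * Im (g t) - Im (f t) * Re (g t)).
  have a1 : K ^+ 2 * L * e t <= (K * L) ^+ 2 * e t.
    rewrite ler_wpM2r// exprMn ler_wpM2l ?sqr_ge0// expr2 ler_peMl//; lra.
  have a2 : K * L ^+ 2 * e t <= (K * L) ^+ 2 * e t.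
    rewrite ler_wpM2r// exprMn ler_wpM2r ?sqr_ge0// expr2 ler_peMl//; lra.
  move: s1 s2; set p := Re _ * Im _; set q := Im _ * Re _ => s1 s2.
  have -> : (p - q) ^+ 2 = 2 * p ^+ 2 + 2 * q ^+ 2 - (p + q) ^+ 2 by ring.
  by lra.
Qed.

Lemma eq_near_real f fr g gr :
  (forall t, D t -> f t = g t) -> (forall t, D t -> fr t = gr t) ->
  near_real f fr -> near_real g gr.
Proof.
move=> fg frgr [K K0 H]; exists K => // t Dt.
by rewrite -fg// -frgr//; exact: H.
Qed.

End NearReal.

(** One step multiplies the Fourier transform by this factor when z0, z1, z2
    are the symbols of the mixed term and of the two directions. *)
Definition mcs_factor (R : realType) (theta : R) (z0 z1 z2 : R[i]) : R[i] :=
  let p := (1 - theta%:C * z1) * (1 - theta%:C * z2) in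
  let u := (z0 + z1 + z2) / p in
  let v := (z1 + z2) / p in
  1 + u + u ^+ 2 / 2 - theta%:C * u * v.

Section ComplexStability.
Context {R : realType}.

Let T := (R * (R * R) * (R * R * R))%type.

(** The symbol of convection in one direction is m a with m^2 <= d, where - a^2
    is the symbol of diffusion and d is of the order of the time step.  Hence the
    elementary quotients 1 / (1 - theta z), a / (1 - theta z) and
    z / (1 - theta z) are near their values without convection, with
    e = d * dissip, and so is the amplification factor, a polynomial in them and in
    k.  The error O(d * dissip) in the squared modulus is absorbed by the
    dissipation of the factor without convection once d is small. *)
Lemma mcs_factor_stable (r theta : R) (r0 : 0 <= r) (r1 : r < 1)
    (th4 : 1 / 4 < theta) (th6 : 1 + r < 6 * theta) :
  exists c d0 : R, [/\ 0 < c, 0 < d0 &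
    forall d a b k m1 m2 : R, 0 <= d <= d0 -> `|k| <= r ->
      m1 ^+ 2 <= d -> m2 ^+ 2 <= d ->
      normc (mcs_factor theta (2 * k * a * b)%:C
        (- a ^+ 2 +i* (m1 * a)) (- b ^+ 2 +i* (m2 * b))) ^+ 2 <=
      1 - c * dissip theta a b].
Proof.
have [c c0 Hc] := mcs_diff_stable r0 r1 th4 th6.
have t0 : 0 < theta by lra.
pose D (t : T) := let: (d, (a, b), (k, m1, m2)) := t in
  [/\ 0 <= d <= 1 / 2, `|k| <= r, m1 ^+ 2 <= d & m2 ^+ 2 <= d].
pose e (t : T) := let: (d, (a, b), _) := t in d * dissip theta a b.
have dis1 (a : R) : 0 <= a ^+ 2 / (1 + theta * a ^+ 2) ^+ 2 <= 1.
  rewrite divr_ge0 ?sqr_ge0//= ler_pdivrMr; last first.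
    by rewrite exprn_gt0// ltr_pwDl// mulr_ge0 ?sqr_ge0// ltW.
  have := sqr_ge0 a; have := sqr_ge0 (1 - theta * a ^+ 2); nra.
have e01 t : D t -> 0 <= e t <= 1.
  move: t => [[d [a b]] [[k m1] m2]] [/andP[d0 d1] _ _ _] /=; rewrite /dissip.
  have /andP[p1 q1] := dis1 a; have /andP[p2 q2] := dis1 b.
  rewrite mulr_ge0//= ?addr_ge0//.
  by apply: (@le_trans _ _ (1 / 2 * 2)); [rewrite ler_pM ?addr_ge0//; lra|lra].
(* the inverse of one implicit factor, and its product with the square root
   of the symbol, are near real *)
have base (a_ m_ : T -> R) :
  (forall t, D t -> exists2 d, 0 <= d & m_ t ^+ 2 <= d /\
     d * (a_ t ^+ 2 / (1 + theta * a_ t ^+ 2) ^+ 2) <= e t) ->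
  near_real D e (fun t => (1 - theta%:C * (- a_ t ^+ 2 +i* (m_ t * a_ t)))^-1)
    (fun t => (1 + theta * a_ t ^+ 2)^-1) /\
  near_real D e (fun t => (a_ t)%:C / (1 - theta%:C * (- a_ t ^+ 2 +i* (m_ t * a_ t))))
    (fun t => a_ t / (1 + theta * a_ t ^+ 2)).
  move=> H.
  have key t : D t -> let a := a_ t in let m := m_ t in let X := 1 + theta * a ^+ 2 in
     let z := (1 - theta%:C * (- a ^+ 2 +i* (m * a)))^-1 in
     [/\ 1 <= X, `|a| <= X, `|Re z - X^-1| <= theta ^+ 2 * e t / X,
         `|Im z| <= `|theta * m * a| / X ^+ 2 & (theta * m * a) ^+ 2 / X ^+ 2 <= theta ^+ 2 * e t].
    move=> Dt a m X z; have [d d0 [md de]] := H t Dt.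
    have /andP[e0 e1] := e01 t Dt.
    rewrite -/a -/m -/X in md de.
    have X1 : 1 <= X by rewrite /X lerDl mulr_ge0 ?sqr_ge0// ltW.
    have X0 : 0 < X by lra.
    have aX : `|a| <= X.
      rewrite /X -[a ^+ 2]real_normK ?num_real//; set n := `|a|.
      have := sqr_ge0 (n - 2); have := sqr_ge0 n; nra.
    have w : (theta * m * a) ^+ 2 / X ^+ 2 <= theta ^+ 2 * e t.
      have -> : (theta * m * a) ^+ 2 / X ^+ 2 = theta ^+ 2 * (m ^+ 2 * (a ^+ 2 / X ^+ 2)).
        by field; rewrite gt_eqF.
      rewrite ler_wpM2l ?sqr_ge0//; apply: le_trans de.
      by rewrite ler_wpM2r// divr_ge0 ?sqr_ge0.
    set n := theta * m * a in w *.
    have reE : Re (1 - theta%:C * (- a ^+ 2 +i* (m * a))) = X.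
      by rewrite ReD ReN ReM /= /X; ring.
    have imE : Im (1 - theta%:C * (- a ^+ 2 +i* (m * a))) = - n.
      by rewrite ImD ImN ImM /= /n; ring.
    have n0 : 0 <= n ^+ 2 by exact: sqr_ge0.
    have Xn : 0 < X ^+ 2 + n ^+ 2 by rewrite ltr_pwDl// exprn_gt0.
    split => //.
    + rewrite /z ReV reE imE sqrrN distrC.
      have -> : X^-1 - X / (X ^+ 2 + n ^+ 2) = n ^+ 2 / (X ^+ 2 + n ^+ 2) / X.
        by field; rewrite !gt_eqF.
      rewrite ger0_norm; last by rewrite !divr_ge0// ltW.
      rewrite ler_pM2r ?invr_gt0//; apply: le_trans w.
      by rewrite ler_wpM2l// lef_pV2 ?posrE ?exprn_gt0// lerDl.
    + rewrite /z ImV reE imE sqrrN mulNr opprK normrM (ger0_norm (_ : 0 <= (X ^+ 2 + n ^+ 2)^-1)); last first.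
        by rewrite invr_ge0 ltW.
      by rewrite ler_wpM2l// lef_pV2 ?posrE ?exprn_gt0// lerDl.
  split.
  - exists (1 + theta ^+ 2); first by rewrite addr_ge0 ?sqr_ge0.
    move=> t Dt; have /andP[e0 e1] := e01 t Dt.
    have [X1 aX h1 h2 h3] := key t Dt.
    set X := 1 + _ in X1 aX h1 h2 h3 *.
    have X0 : 0 < X by lra.
    have te : 0 <= theta ^+ 2 * e t by rewrite mulr_ge0 ?sqr_ge0.
    split.
    + rewrite ger0_norm ?invr_ge0 ?(ltW X0)//.
      by apply: (@le_trans _ _ 1); rewrite ?invf_le1// lerDl sqr_ge0.
    + apply: (le_trans h1); rewrite mulrDl mul1r; apply: (@le_trans _ _ (theta ^+ 2 * e t)).
        by rewrite ler_piMr// invf_le1.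
      by rewrite lerDr.
    + rewrite -real_normK ?num_real//; apply: (@le_trans _ _ ((`|theta * m_ t * a_ t| / X ^+ 2) ^+ 2)).
        by rewrite lerXn2r ?nnegrE ?divr_ge0 ?sqr_ge0.
      rewrite exprMn real_normK ?num_real//.
      rewrite mulrDl mul1r; apply: (@le_trans _ _ (theta ^+ 2 * e t)); last by rewrite lerDr.
      apply: le_trans h3; rewrite ler_wpM2l ?sqr_ge0// exprVn.
      rewrite lef_pV2 ?posrE ?exprn_gt0//.
      by rewrite -exprM ler_weXn2l.
  - exists (1 + theta ^+ 2); first by rewrite addr_ge0 ?sqr_ge0.
    move=> t Dt; have /andP[e0 e1] := e01 t Dt.
    have [X1 aX h1 h2 h3] := key t Dt.
    set X := 1 + _ in X1 aX h1 h2 h3 *.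
    have X0 : 0 < X by lra.
    have te : 0 <= theta ^+ 2 * e t by rewrite mulr_ge0 ?sqr_ge0.
    split.
    + rewrite normrM (ger0_norm (_ : 0 <= X^-1)) ?invr_ge0 ?(ltW X0)//.
      by apply: (@le_trans _ _ 1); rewrite ?ler_pdivrMr ?mul1r// lerDl sqr_ge0.
    + rewrite ReRM -mulrBr normrM.
      apply: (@le_trans _ _ (X * (theta ^+ 2 * e t / X))); first by rewrite ler_pM.
      by rewrite mulrC divfK ?gt_eqF// mulrDl mul1r lerDr.
    + rewrite ImRM.
      rewrite -real_normK ?num_real// normrM.
      apply: (@le_trans _ _ ((X * (`|theta * m_ t * a_ t| / X ^+ 2)) ^+ 2)).
        by apply: lerX2; [exact: mulr_ge0|rewrite ler_pM].
      have -> : X * (`|theta * m_ t * a_ t| / X ^+ 2) = `|theta * m_ t * a_ t| / X.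
        by field; rewrite gt_eqF.
      rewrite exprMn exprVn real_normK ?num_real//.
      by rewrite mulrDl mul1r (le_trans h3)// lerDr.
pose a_ (t : T) := t.1.2.1; pose b_ (t : T) := t.1.2.2.
pose k_ (t : T) := t.2.1.1; pose m1_ (t : T) := t.2.1.2; pose m2_ (t : T) := t.2.2.
have [|qa aqa] := base a_ m1_.
  move=> [[d [a b]] [[k m1] m2]] [/andP[d0 d1] _ md _] /=; exists d => //; split => //.
  rewrite ler_wpM2l// lerDl.
  by have /andP[] := dis1 b.
have [|qb bqb] := base b_ m2_.
  move=> [[d [a b]] [[k m1] m2]] [/andP[d0 d1] _ _ md] /=; exists d => //; split => //.
  rewrite ler_wpM2l// lerDr.
  by have /andP[] := dis1 a.
(* z / (1 - theta z) = (1 / (1 - theta z) - 1) / theta *)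
have qz (al mu : T -> R) :
  near_real D e (fun t => (1 - theta%:C * (- al t ^+ 2 +i* (mu t * al t)))^-1)
    (fun t => (1 + theta * al t ^+ 2)^-1) ->
  near_real D e (fun t => (- al t ^+ 2 +i* (mu t * al t)) /
       (1 - theta%:C * (- al t ^+ 2 +i* (mu t * al t))))
    (fun t => - al t ^+ 2 / (1 + theta * al t ^+ 2)).
  move=> H; apply: (eq_near_real _ _ (near_realM e01 (near_real_cst e01 theta^-1)
     (near_realD e01 H (near_real_cst e01 (- 1))))) => t Dt.
  - set z := (_ +i* _)%C.
    have p0 : 1 - theta%:C * z != 0.
      apply/eqP => /(congr1 (@complex.Re _)); rewrite ReD ReN ReRM /= => /eqP.
      by rewrite mulrN opprK gt_eqF// ltr_pwDl// mulr_ge0 ?sqr_ge0// ltW.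
    have tc : (theta^-1)%:C * theta%:C = 1 :> R[i].
      by rewrite -rmorphM mulVf ?gt_eqF.
    have tc' : (theta^-1)%:C = (theta%:C)^-1 :> R[i] by rewrite fmorphV.
    rewrite tc' rmorphN rmorph1; field.
    by rewrite p0 fmorph_eq0 gt_eqF.
  - have X0 : 0 < 1 + theta * al t ^+ 2.
      by rewrite ltr_pwDl// mulr_ge0 ?sqr_ge0// ltW.
    by field; rewrite !gt_eqF.
have za := qz _ _ qa; have zb := qz _ _ qb.
have zk : near_real D e (fun t => (2 * k_ t)%:C) (fun t => 2 * k_ t).
  apply: (@near_realR _ _ _ _ e01 _ (2 * r)); first by rewrite mulr_ge0.
  move=> [[d [a b]] [[k m1] m2]] [_ kr _ _] /=.
  by rewrite normrM ger0_norm// ler_wpM2l.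
pose z0 t : R[i] := (2 * k_ t * a_ t * b_ t)%:C.
pose z1 t : R[i] := - a_ t ^+ 2 +i* (m1_ t * a_ t).
pose z2 t : R[i] := - b_ t ^+ 2 +i* (m2_ t * b_ t).
pose p1 t : R[i] := 1 - theta%:C * z1 t.
pose p2 t : R[i] := 1 - theta%:C * z2 t.
pose X t := 1 + theta * a_ t ^+ 2.
pose Y t := 1 + theta * b_ t ^+ 2.
have X0 t : X t != 0 by rewrite gt_eqF// /X ltr_pwDl// mulr_ge0 ?sqr_ge0// ltW.
have Y0 t : Y t != 0 by rewrite gt_eqF// /Y ltr_pwDl// mulr_ge0 ?sqr_ge0// ltW.
have nv : near_real D e (fun t => (z1 t + z2 t) / (p1 t * p2 t))
   (fun t => (- a_ t ^+ 2 - b_ t ^+ 2) / (X t * Y t)).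
  apply: (eq_near_real _ _ (near_realD e01 (near_realM e01 za qb)
    (near_realM e01 zb qa))) => t Dt.
  - rewrite /= -/(z1 t) -/(z2 t) -/(p1 t) -/(p2 t).
    by rewrite invfM mulrDl; congr (_ + _); rewrite -!mulrA //; congr (_ * _); rewrite mulrC.
  - by rewrite -/(X t) -/(Y t); field; rewrite X0 Y0.
have nu : near_real D e (fun t => (z0 t + z1 t + z2 t) / (p1 t * p2 t))
   (fun t => (2 * k_ t * a_ t * b_ t - a_ t ^+ 2 - b_ t ^+ 2) / (X t * Y t)).
  apply: (eq_near_real _ _ (near_realD e01 (near_realM e01 zk
    (near_realM e01 aqa bqb)) nv)) => t Dt.
  - rewrite /= -/(z1 t) -/(z2 t) -/(p1 t) -/(p2 t) /z0 !rmorphM /= invfM.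
    by rewrite -[z1 t + z2 t]/(z1 t + z2 t); ring.
  - by rewrite -/(X t) -/(Y t); field; rewrite X0 Y0.
have nM : near_real D e (fun t => mcs_factor theta (z0 t) (z1 t) (z2 t))
   (fun t => mcs_diff theta (a_ t) (b_ t) (2 * k_ t * a_ t * b_ t)).
  have n1 := near_real_cst e01 1; have nt := near_real_cst e01 (- theta).
  have nh := near_real_cst e01 (1 / 2).
  apply: (eq_near_real _ _ (near_realD e01 (near_realD e01 (near_realD e01 n1 nu)
    (near_realM e01 (near_realM e01 nu nu) nh))
    (near_realM e01 nt (near_realM e01 nu nv)))) => t Dt.
  - rewrite /mcs_factor -/(p1 t) -/(p2 t) rmorphN fmorph_div rmorph_nat !rmorph1.
    set u := ((z0 t + z1 t + z2 t) / _); set v := ((z1 t + z2 t) / _).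
    by field.
  - rewrite /mcs_diff -/(X t) -/(Y t).
    set u := ((2 * k_ t * a_ t * b_ t - a_ t ^+ 2 - b_ t ^+ 2) / _); set v := ((- a_ t ^+ 2 - b_ t ^+ 2) / _).
    by field.
have [K K0 HK] := nM.
pose L := 2 * K ^+ 2 + K ^+ 2 + K.
have L0 : 0 <= L by rewrite /L; have := sqr_ge0 K; lra.
exists (c / 2), (Num.min (1 / 2) (c / 2 / (L + 1))).
split; first by rewrite divr_gt0.
  by rewrite lt_min; apply/andP; split; [lra|rewrite !divr_gt0//; lra].
move=> d a b k m1 m2 /andP[d0]; rewrite le_min => /andP[d1 d2] kr m1d m2d.
have Dt : D (d, (a, b), (k, m1, m2)) by split => //; rewrite d0.
have [g1 g2] := Hc a b k kr.
rewrite sqr_normcE.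
set M := mcs_factor _ _ _ _; set Rr := mcs_diff _ _ _ _ in g1 g2 *.
set g := dissip theta a b in g1 g2 *.
have /andP[e0 e1] : 0 <= d * g <= 1 := e01 _ Dt.
have [f1 f2 f3] : [/\ `|Rr| <= K, `|Re M - Rr| <= K * (d * g) &
  Im M ^+ 2 <= K * (d * g)] := HK _ Dt.
have g0 : 0 <= g by rewrite addr_ge0// divr_ge0 ?sqr_ge0.
have dL : d * (L + 1) <= c / 2 by rewrite -ler_pdivlMr//; lra.
have dLg : d * (L + 1) * g <= c / 2 * g by rewrite ler_wpM2r.
set E := d * g in f2 f3 e0 e1.
have KE : 0 <= K * E by exact: mulr_ge0.
have R2 : Rr ^+ 2 <= 1 - c * g.
  have Rn : `|Rr| <= 1 - c * g by rewrite ler_norml; apply/andP; split; lra.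
  have cg0 : 0 <= c * g by rewrite mulr_ge0// ltW.
  rewrite -real_normK ?num_real//.
  have := normr_ge0 Rr; set n := `|Rr| in Rn *; nra.
have M2 : Re M ^+ 2 <= Rr ^+ 2 + (2 * K ^+ 2 + K ^+ 2) * E.
  have -> : Re M ^+ 2 = Rr ^+ 2 + 2 * (Rr * (Re M - Rr)) + (Re M - Rr) ^+ 2 by ring.
  have p1' : Rr * (Re M - Rr) <= K * (K * E).
    by apply: (le_trans (ler_norm _)); rewrite normrM ler_pM.
  have p2' : (Re M - Rr) ^+ 2 <= K ^+ 2 * E.
    rewrite -real_normK ?num_real//; apply: (@le_trans _ _ ((K * E) ^+ 2)).
      exact: lerX2.
    by rewrite exprMn ler_wpM2l ?sqr_ge0// expr2 ler_piMr.
  lra.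
have : L * E + E = d * (L + 1) * g by rewrite /E; ring.
rewrite /L in dLg *; lra.
Qed.

End ComplexStability.

(** * Taylor estimates for the trigonometric and exponential functions *)

Section DeriveRules.
Context {R : realType}.
Implicit Types (f g : R -> R) (x a b c : R).

Lemma der_eq f x a b : is_derive x 1 f a -> a = b -> is_derive x 1 f b.
Proof. by move=> ? <-. Qed.
Lemma der_cst c x : is_derive x 1 (fun _ : R => c) 0.
Proof. exact: is_derive_cst. Qed.
Lemma der_id x : is_derive x 1 (fun t : R => t) 1.
Proof. exact: is_derive_id. Qed.
Lemma der_add f g x a b : is_derive x 1 f a -> is_derive x 1 g b ->
  is_derive x 1 (fun t => f t + g t) (a + b).
Proof. by move=> ? ?; exact: is_deriveD. Qed.
Lemma der_opp f x a : is_derive x 1 f a -> is_derive x 1 (fun t => - f t) (- a).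
Proof. by move=> ?; exact: is_deriveN. Qed.
Lemma der_mul f g x a b : is_derive x 1 f a -> is_derive x 1 g b ->
  is_derive x 1 (fun t => f t * g t) (f x * b + g x * a).
Proof. by move=> ? ?; exact: is_deriveM. Qed.
Lemma der_exp f n x a : is_derive x 1 f a ->
  is_derive x 1 (fun t => f t ^+ n) (n%:R * f x ^+ n.-1 * a).
Proof.
move=> fa; have -> : (fun t => f t ^+ n) = f ^+ n by apply/funext => t; rewrite fctE.
exact: is_deriveX.
Qed.
Lemma der_comp f g x a b : is_derive x 1 f a -> is_derive (f x) 1 g b ->
  is_derive x 1 (fun t => g (f t)) (b * a).
Proof. by move=> ? ?; exact: is_derive1_comp. Qed.
Lemma der_sin f x a : is_derive x 1 f a ->
  is_derive x 1 (fun t => sin (f t)) (cos (f x) * a).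
Proof. by move=> ?; apply: (@der_comp f sin). Qed.
Lemma der_cos f x a : is_derive x 1 f a ->
  is_derive x 1 (fun t => cos (f t)) (- sin (f x) * a).
Proof. by move=> ?; apply: (@der_comp f cos). Qed.
Lemma der_expR f x a : is_derive x 1 f a ->
  is_derive x 1 (fun t => expR (f t)) (expR (f x) * a).
Proof. by move=> ?; apply: (@der_comp f expR). Qed.

End DeriveRules.

(** Stated for lambda-abstractions, the differentiation rules chain by
    unification; what remains is to identify the derivative found. *)
Ltac derive_auto := eapply der_eq; [
  repeat first [ eapply der_cst | eapply der_id | eapply der_add | eapply der_opp
  | eapply der_mul | eapply der_exp | eapply der_sin | eapply der_cos
  | eapply der_expR ] | rewrite /= ].

Section Taylor.
Context {R : realType}.
Implicit Types t x : R.

(** The Taylor inequalities below follow from one another by integration,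
    starting from cos <= 1 and 1 + t <= exp t. *)
Lemma ge0_derive (f df : R -> R) : (forall x, is_derive x 1 f (df x)) ->
  (forall x, 0 <= x -> 0 <= df x) -> 0 <= f 0 -> forall x, 0 <= x -> 0 <= f x.
Proof.
move=> fdf df0 f0 x; rewrite le_eqVlt => /predU1P[<-//|x0].
have cf : {within `[0, x], continuous f}.
  apply: derivable_within_continuous => y _.
  by have [] := fdf y.
have [y] := MVT x0 (fun y _ => fdf y) cf.
rewrite in_itv/= => /andP[y0 _]; rewrite subr0 => fE.
have : 0 <= df y * x by rewrite mulr_ge0 ?df0// ltW.
by rewrite -fE; lra.
Qed.

Lemma sin_le t : 0 <= t -> sin t <= t.
Proof.
move=> t0; rewrite -subr_ge0; move: t t0.
have D x : is_derive x 1 (fun t => t - sin t)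
    (1 - cos x) by derive_auto; ring.
refine (ge0_derive D _ _).
- by move=> x _; rewrite subr_ge0 cos_le1.
- by rewrite /= sin0 subrr.
Qed.

Lemma cos_ge t : 0 <= t -> 1 - t ^+ 2 / 2 <= cos t.
Proof.
move=> t0; rewrite -subr_ge0; move: t t0.
have D x : is_derive x 1 (fun t => cos t - (1 - t ^+ 2 / 2))
    (x - sin x) by derive_auto; field.
refine (ge0_derive D _ _).
- by move=> x x0; rewrite subr_ge0 sin_le.
- by rewrite /= cos0; lra.
Qed.

Lemma sin_ge t : 0 <= t -> t - t ^+ 3 / 6 <= sin t.
Proof.
move=> t0; rewrite -subr_ge0; move: t t0.
have D x : is_derive x 1 (fun t => sin t - (t - t ^+ 3 / 6))
    (cos x - (1 - x ^+ 2 / 2)) by derive_auto; field.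
refine (ge0_derive D _ _).
- by move=> x x0; rewrite subr_ge0 cos_ge.
- by rewrite /= sin0; lra.
Qed.

Lemma expRN_le t : 0 <= t -> expR (- t) <= 1 - t + t ^+ 2 / 2.
Proof.
move=> t0; rewrite -subr_ge0; move: t t0.
have D x : is_derive x 1 (fun t => 1 - t + t ^+ 2 / 2 - expR (- t))
    (expR (- x) - (1 - x)) by derive_auto; field.
refine (ge0_derive D _ _).
- by move=> x x0; rewrite subr_ge0; apply: (le_trans _ (expR_ge1Dx _)).
- by rewrite /= oppr0 expR0; lra.
Qed.

Lemma expRN_ge t : 0 <= t -> 1 - t + t ^+ 2 / 2 - t ^+ 3 / 6 <= expR (- t).
Proof.
move=> t0; rewrite -subr_ge0; move: t t0.
have D x : is_derive x 1 (fun t => expR (- t) - (1 - t + t ^+ 2 / 2 - t ^+ 3 / 6))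
    (1 - x + x ^+ 2 / 2 - expR (- x)) by derive_auto; field.
refine (ge0_derive D _ _).
- by move=> x x0; rewrite subr_ge0 expRN_le.
- by rewrite /= oppr0 expR0; lra.
Qed.

Lemma sin_norm_le t : `|sin t| <= `|t|.
Proof.
wlog t0 : t / 0 <= t.
  move=> H; have [/H//|t0] := lerP 0 t.
  by rewrite -normrN -sinN -[`|t|]normrN; apply: H; rewrite oppr_ge0 ltW.
rewrite (ger0_norm t0) ler_norml sin_le// andbT.
have [t1|t1] := lerP t 1; last by rewrite (le_trans _ (sin_geN1 t))// lerN2 ltW.
apply: le_trans (sin_ge t0); rewrite -subr_ge0.
have : 0 <= t * (1 - t) by rewrite mulr_ge0// subr_ge0.
have : 0 <= t * t * (1 - t) by rewrite !mulr_ge0// subr_ge0.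
rewrite !exprS expr0; lra.
Qed.

Lemma sin_taylor t : `|sin t - t| <= `|t| ^+ 3.
Proof.
wlog t0 : t / 0 <= t.
  move=> H; have [/H//|t0] := lerP 0 t.
  have := H (- t); rewrite sinN oppr_ge0 normrN -opprD normrN.
  by apply; exact: ltW.
have t3 : 0 <= t ^+ 3 by rewrite exprn_ge0.
rewrite (ger0_norm t0) ler_norml; apply/andP; split.
  by have := sin_ge t0; lra.
by have := sin_le t0; lra.
Qed.

(** The sharp exponent would be 4; third order with constant 1 is what the
    order calculus below uses. *)
Lemma cos_taylor t : `|cos t - (1 - t ^+ 2 / 2)| <= `|t| ^+ 3.
Proof.
wlog t0 : t / 0 <= t.
  move=> H; have [/H//|t0] := lerP 0 t.
  have := H (- t); rewrite cosN sqrrN oppr_ge0 normrN.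
  by apply; exact: ltW.
have t3 : 0 <= t ^+ 3 by rewrite exprn_ge0.
rewrite (ger0_norm t0) ger0_norm; last by rewrite subr_ge0 cos_ge.
(* the difference increases more slowly than t^3 *)
rewrite -subr_ge0; move: t t0 t3 => t t0 _; move: t t0.
have D x : is_derive x 1 (fun t => t ^+ 3 - (cos t - (1 - t ^+ 2 / 2)))
    (3 * x ^+ 2 - (x - sin x)) by derive_auto; field.
refine (ge0_derive D _ _).
- move=> x x0; have [x1|x1] := lerP x 1.
    have := sin_ge x0; have : x ^+ 3 <= x ^+ 2.
      by rewrite exprS ler_piMl ?sqr_ge0.
    by have := sqr_ge0 x; lra.
  have := sin_norm_le x; rewrite (gtr0_norm (lt_trans ltr01 x1)) ler_norml.
  by move=> /andP[h _]; have : 0 <= x * (x - 1); [rewrite mulr_ge0 ?subr_ge0// ltW|nra].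
- by rewrite /= cos0; lra.
Qed.

Lemma expR_taylor t : t <= 0 -> `|expR t - (1 + t + t ^+ 2 / 2)| <= `|t| ^+ 3.
Proof.
move=> t0; have nt : 0 <= - t by rewrite oppr_ge0.
rewrite (ler0_norm t0).
have := expRN_ge nt; have := expRN_le nt; rewrite opprK sqrrN.
have : 0 <= (- t) ^+ 3 by rewrite exprn_ge0.
by move=> h1 h2 h3; rewrite ler_norml; apply/andP; split; lra.
Qed.

Lemma pi_le4 : pi <= 4 :> R.
Proof. by have [/andP[_]] := @pihalf_02_cos_pihalf R; lra. Qed.

(** From sin t >= t - t^3 / 6 and t <= pi / 2 <= 2; the constant 1 / 3 is a
    weak form of the constant 2 / pi of Jordan. *)
Lemma sin_jordan t : `|t| <= pi / 2 -> `|t| / 3 <= `|sin t|.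
Proof.
wlog t0 : t / 0 <= t.
  move=> H; have [/H//|t0] := lerP 0 t.
  have := H (- t); rewrite sinN oppr_ge0 !normrN.
  by apply; exact: ltW.
have := pi_le4; rewrite (ger0_norm t0) => pi4 tpi.
have t2 : t <= 2 by lra.
apply: le_trans (ler_norm _); apply: le_trans (sin_ge t0).
have : 0 <= t * (4 - t ^+ 2).
  by rewrite mulr_ge0// subr_ge0; have := lerX2 t0 t2; rewrite -natrX.
rewrite !exprS expr0; lra.
Qed.

End Taylor.

(** * Complex exponential and orders of magnitude *)

Definition ci {R : realType} : R[i] := 0 +i* 1.

Lemma ci2 {R : realType} : ci ^+ 2 = -1 :> R[i].
Proof. by rewrite expr2 /ci; simpc; rewrite /= complexr0 rmorphN1. Qed.

(** exp (a + i b). *)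
Definition cexp (R : realType) (a b : R) : R[i] :=
  (expR a)%:C * ((cos b)%:C + ci * (sin b)%:C).

Lemma cexpX (R : realType) (a b : R) n : cexp a b ^+ n = cexp (n%:R * a) (n%:R * b).
Proof.
elim: n => [|n IH].
  by rewrite expr0 /cexp !mul0r expR0 cos0 sin0 mulr0 addr0 mul1r.
rewrite exprS IH /cexp -natr1 !mulrDl !mul1r expRD cosD sinD.
rewrite !(rmorphM, rmorphD, rmorphN).
set i := ci; have i2 : i ^+ 2 = -1 by exact: ci2.
by ring: i2.
Qed.

Lemma normc_cexp (R : realType) (a b : R) : normc (cexp a b) = expR a.
Proof.
rewrite normcM normcR ger0_norm ?expR_ge0//.
suff -> : normc ((cos b)%:C + ci * (sin b)%:C) = 1 by rewrite mulr1.
apply/eqP; rewrite -(@eqrXn2 _ 2)// ?normc_ge0// sqr_normcE ReD ImD /=.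
by rewrite !(mul0r, mul1r, addr0, add0r, subr0) cos2Dsin2 expr1n.
Qed.

Section OrderClass.
Context {R : realType} (T : Type) (D : T -> Prop) (m : T -> R).
Hypothesis m02 : forall t, D t -> 0 <= m t <= 2.

(** The order calculus: f is O(m^n) on D.  Since m is bounded, orders may be
    lowered ([Om_weak]), and all consistency estimates below become sums and
    products of functions of known order. *)
Definition Om n (f : T -> R[i]) :=
  exists2 C, 0 <= C & forall t, D t -> normc (f t) <= C * m t ^+ n.

Lemma Om_eq n f g : (forall t, D t -> f t = g t) -> Om n f -> Om n g.
Proof. by move=> fg [C C0 H]; exists C => // t Dt; rewrite -fg//; exact: H. Qed.

Lemma Om_le n f (g : T -> R) : Om n (fun t => (g t)%:C) ->
  (forall t, D t -> normc (f t) <= g t) -> Om n f.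
Proof.
move=> [C C0 H] fg; exists C => // t Dt; apply: (le_trans (fg t Dt)).
by apply: le_trans (H t Dt); rewrite normcR ler_norm.
Qed.

Lemma Om_cst (k : R[i]) : Om 0 (fun=> k).
Proof. by exists (normc k) => [|t _]; rewrite ?normc_ge0// expr0 mulr1. Qed.

Lemma OmD n f g : Om n f -> Om n g -> Om n (fun t => f t + g t).
Proof.
move=> [C C0 H] [C' C'0 H']; exists (C + C'); first exact: addr_ge0.
move=> t Dt; apply: (le_trans (le_normcD _ _)).
by rewrite mulrDl lerD// ?H ?H'.
Qed.

Lemma OmM n k f g : Om n f -> Om k g -> Om (n + k) (fun t => f t * g t).
Proof.
move=> [C C0 H] [C' C'0 H']; exists (C * C'); first exact: mulr_ge0.
move=> t Dt; rewrite normcM exprD mulrACA.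
by rewrite ler_pM ?normc_ge0// ?H ?H'.
Qed.

Lemma OmN n f : Om n f -> Om n (fun t => - f t).
Proof. by move=> [C C0 H]; exists C => // t Dt; rewrite normcN; exact: H. Qed.

Lemma OmB n f g : Om n f -> Om n g -> Om n (fun t => f t - g t).
Proof. by move=> Hf Hg; apply: OmD => //; exact: OmN. Qed.

Lemma Om_weak n k f : (k <= n)%N -> Om n f -> Om k f.
Proof.
move=> kn [C C0 H]; exists (C * 2 ^+ (n - k)); first by rewrite mulr_ge0 ?exprn_ge0.
move=> t Dt; apply: (le_trans (H t Dt)); have /andP[m0 m2] := m02 Dt.
rewrite -{1}(subnK kn) exprD mulrA ler_wpM2r ?exprn_ge0//.
rewrite ler_wpM2l//; apply: lerXn2r => //; rewrite ?nnegrE//.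
Qed.

Lemma OmZ n (k : R[i]) f : Om n f -> Om n (fun t => k * f t).
Proof. by move=> H; have := OmM (Om_cst k) H. Qed.

Lemma OmX k f : Om 1 f -> Om k (fun t => f t ^+ k).
Proof.
move=> [C C0 H]; exists (C ^+ k); first by rewrite exprn_ge0.
move=> t Dt; rewrite normcX -exprMn; apply: lerXn2r; rewrite ?nnegrE ?normc_ge0//.
  by rewrite mulr_ge0// ?expr1; have /andP[] := m02 Dt.
by have := H t Dt; rewrite expr1.
Qed.

End OrderClass.

Section TaylorOrder.
Context {R : realType} (T : Type) (D : T -> Prop) (m : T -> R).
Hypothesis m02 : forall t, D t -> 0 <= m t <= 2.

(** The remainders of exp a, cos b and sin b are of third order, and the
    product of the three polynomials differs from the polynomial in a + i b by
    monomials of degree at least 3. *)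
Lemma cexp_taylor (a b : T -> R) : (forall t, D t -> a t <= 0) ->
  Om D m 1 (fun t => (a t)%:C) -> Om D m 1 (fun t => (b t)%:C) ->
  Om D m 3 (fun t => cexp (a t) (b t) -
    (1 + (a t +i* b t) + (a t +i* b t) ^+ 2 / 2)).
Proof.
move=> a0 Ha Hb.
pose A t : R[i] := (a t)%:C; pose B t : R[i] := (b t)%:C.
pose rA t : R[i] := (expR (a t) - (1 + a t + a t ^+ 2 / 2))%:C.
pose rC t : R[i] := (cos (b t) - (1 - b t ^+ 2 / 2))%:C.
pose rS t : R[i] := (sin (b t) - b t)%:C.
have cub (f : T -> R) : Om D m 1 (fun t => (f t)%:C) -> Om D m 3 (fun t => (`|f t| ^+ 3)%:C).
  move=> [C C0 H]; exists (C ^+ 3); first by rewrite exprn_ge0.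
  move=> t Dt; rewrite normcR normrX normr_id -exprMn; apply: lerXn2r; rewrite ?nnegrE//.
    by rewrite mulr_ge0//; have /andP[] := m02 Dt.
  by have := H t Dt; rewrite normcR expr1.
have hA : Om D m 3 rA.
  by apply: (Om_le (cub _ Ha)) => t Dt; rewrite normcR expR_taylor// a0.
have hC : Om D m 3 rC.
  by apply: (Om_le (cub _ Hb)) => t Dt; rewrite normcR cos_taylor.
have hS : Om D m 3 rS.
  by apply: (Om_le (cub _ Hb)) => t Dt; rewrite normcR sin_taylor.
have A0 : Om D m 0 A by exact: (Om_weak m02 _ Ha).
have B0 : Om D m 0 B by exact: (Om_weak m02 _ Hb).
have S0 : Om D m 0 (fun t => 1 + A t + A t ^+ 2 / 2).
  apply: OmD; first by apply: OmD => //; exact: Om_cst.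
  have := OmM (OmM A0 A0) (Om_cst D m 2^-1); apply: Om_eq => t _; by rewrite expr2.
have V0 : Om D m 0 (fun t => (cos (b t))%:C + ci * (sin (b t))%:C).
  exists 2 => // t _; rewrite expr0 mulr1; apply: (le_trans (le_normcD _ _)).
  rewrite normcM !normcR.
  have -> : normc ci = 1 :> R by rewrite /= expr0n/= add0r expr1n sqrtr1.
  by rewrite mul1r; have := cos_max (b t); have := sin_max (b t); lra.
have h1 := OmM (OmM Ha (OmM Hb Hb)) (Om_cst D m (- 2^-1)).
have h2 := OmM (OmM Ha (OmM Ha Hb)) (Om_cst D m (ci / 2)).
have h3 := OmM (OmM (OmM Ha (OmM Hb Hb)) A0) (Om_cst D m (- 4^-1)).
have h4 := OmM hA V0.
have h5 := OmM S0 (OmD hC (OmZ ci hS)).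
have := OmD (OmD (OmD (OmD h1 h2) h3) h4) h5.
apply: Om_eq => t Dt; rewrite /rA /rC /rS /cexp.
have -> : a t +i* b t = A t + ci * B t.
  by rewrite /A /B; rewrite /A /B /ci; simpc.
rewrite !(rmorphN, rmorphD, rmorphM, fmorphV, rmorphXn, rmorph_nat, rmorph1).
rewrite -/(A t) -/(B t).
set i := ci; have i2 : i ^+ 2 = -1 by exact: ci2.
set x := A t; set y := B t; set ex := (expR _)%:C; set co := (cos _)%:C.
set si := (sin _)%:C.
have -> : (x + i * y) ^+ 2 = x ^+ 2 + 2 * i * x * y - y ^+ 2.
  by ring: i2.
by field.
Qed.

End TaylorOrder.

(** * Symbols of the difference operators *)

Section Symbols.
Context {R : realType}.
Implicit Types rho dt a h k e : R.

(** Symbol of dt (delta^2 / h^2 + a delta_2 / (2 h)) at frequency k. *)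
Definition sym1 dt a h k : R[i] :=
  (dt * ((h ^+ 2)^-1 * (2 * cos (h * k) - 2))) +i* (dt * (a / h * sin (h * k))).

(** Symbol of dt rho delta_2x delta_2y / (2 h1 h2) at frequencies k and e. *)
Definition sym0 rho dt h1 h2 k e : R[i] :=
  (- (2 * rho * dt / (h1 * h2) * (sin (h1 * k) * sin (h2 * e))))%:C.

(** The square root of minus the symbol of the diffusion operator, with a
    sign that makes the symbols of convection and of the mixed derivative
    multiples of it ([sym1E], [sym0E]). *)
Definition root1 dt h k : R := 2 * Num.sqrt dt / h * sin (h * k / 2).

Lemma sin_half (x : R) : sin x = 2 * (sin (x / 2) * cos (x / 2)).
Proof. by rewrite {1}[x]splitr sinD; ring. Qed.

Lemma cos_half (x : R) : 2 * cos x - 2 = - (4 * sin (x / 2) ^+ 2).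
Proof. by rewrite {1}[x]splitr cosD -!expr2 cos2sin2; ring. Qed.

Lemma root1_sqr dt h k : 0 <= dt -> h != 0 ->
  root1 dt h k ^+ 2 = 4 * dt / h ^+ 2 * sin (h * k / 2) ^+ 2.
Proof.
move=> dt0 h0; rewrite /root1 exprMn; congr (_ * _).
by rewrite !exprMn sqr_sqrtr// exprVn; ring.
Qed.

Lemma sym1E dt a h k : 0 <= dt -> h != 0 ->
  sym1 dt a h k = (- root1 dt h k ^+ 2) +i*
     ((Num.sqrt dt * a * cos (h * k / 2)) * root1 dt h k).
Proof.
move=> dt0 h0; rewrite /sym1; congr (_ +i* _).
  by rewrite root1_sqr// cos_half; field.
rewrite /root1 [sin (h * k)]sin_half.
have {1}-> : dt = Num.sqrt dt ^+ 2 by rewrite sqr_sqrtr.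
by field.
Qed.

Lemma sym0E rho dt h1 h2 k e : 0 <= dt -> h1 != 0 -> h2 != 0 ->
  sym0 rho dt h1 h2 k e =
  (2 * (- (rho * cos (h1 * k / 2) * cos (h2 * e / 2))) *
   root1 dt h1 k * root1 dt h2 e)%:C.
Proof.
move=> dt0 h10 h20; rewrite /sym0; congr (_ %:C).
rewrite /root1 [sin (h1 * k)]sin_half [sin (h2 * e)]sin_half.
have {1}-> : dt = Num.sqrt dt ^+ 2 by rewrite sqr_sqrtr.
by field; rewrite h10 h20.
Qed.

Lemma root1_le dt h k : 0 <= dt -> 0 < h -> root1 dt h k ^+ 2 <= dt * k ^+ 2.
Proof.
move=> dt0 h0; rewrite root1_sqr ?gt_eqF//.
apply: (@le_trans _ _ (4 * dt / h ^+ 2 * (h * k / 2) ^+ 2)).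
  apply: ler_wpM2l; first by rewrite divr_ge0 ?sqr_ge0 ?mulr_ge0//.
  rewrite -[X in X <= _]real_normK ?num_real// -[leRHS]real_normK ?num_real//.
  by apply: lerX2 => //; exact: sin_norm_le.
by rewrite le_eqVlt; apply/orP; left; apply/eqP; field; rewrite gt_eqF.
Qed.

(** On the box |h k| <= pi the discrete diffusion is comparable to the
    continuous one. *)
Lemma root1_ge dt h k : 0 <= dt -> 0 < h -> `|h * k| <= pi ->
  dt * k ^+ 2 / 9 <= root1 dt h k ^+ 2.
Proof.
move=> dt0 h0 hk; rewrite root1_sqr ?gt_eqF//.
have hk2 : `|h * k / 2| <= pi / 2.
  by rewrite normrM [`|2^-1|]ger0_norm ?invr_ge0// ler_pM2r ?invr_gt0.
apply: (@le_trans _ _ (4 * dt / h ^+ 2 * (`|h * k / 2| / 3) ^+ 2)).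
  rewrite exprMn real_normK ?num_real//.
  by rewrite le_eqVlt; apply/orP; left; apply/eqP; field; rewrite gt_eqF.
apply: ler_wpM2l; first by rewrite divr_ge0 ?sqr_ge0 ?mulr_ge0//.
rewrite -[leRHS]real_normK ?num_real//; apply: lerX2; first by rewrite divr_ge0.
exact: sin_jordan.
Qed.

Lemma sym1_Re dt a h k : 0 <= dt -> 0 < h ->
  `|Re (sym1 dt a h k) + dt * k ^+ 2| <= dt * h ^+ 2 * k ^+ 4.
Proof.
move=> dt0 h0; rewrite sym1E ?gt_eqF//= root1_sqr ?gt_eqF//.
set t := h * k / 2.
have -> : - (4 * dt / h ^+ 2 * sin t ^+ 2) + dt * k ^+ 2 =
   - (4 * dt / h ^+ 2 * ((sin t - t) * (sin t + t))).
  by rewrite /t; field; rewrite gt_eqF.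
rewrite normrN normrM ger0_norm; last by rewrite divr_ge0 ?sqr_ge0 ?mulr_ge0//.
have st : `|(sin t - t) * (sin t + t)| <= `|t| ^+ 3 * (2 * `|t|).
  rewrite normrM ler_pM ?sin_taylor//.
  by apply: (le_trans (ler_normD _ _)); have := sin_norm_le t; lra.
apply: (@le_trans _ _ (4 * dt / h ^+ 2 * (`|t| ^+ 3 * (2 * `|t|)))).
  by rewrite ler_wpM2l// divr_ge0 ?sqr_ge0 ?mulr_ge0//.
have -> : `|t| ^+ 3 * (2 * `|t|) = 2 * (`|t| ^+ 2) ^+ 2 by ring.
rewrite real_normK ?num_real//.
have -> : 4 * dt / h ^+ 2 * (2 * (t ^+ 2) ^+ 2) = dt * h ^+ 2 * k ^+ 4 / 2.
  by rewrite /t; field; rewrite gt_eqF.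
have : 0 <= dt * h ^+ 2 * k ^+ 4.
  have -> : k ^+ 4 = (k ^+ 2) ^+ 2 by ring.
  by apply: mulr_ge0; rewrite ?sqr_ge0//; apply: mulr_ge0; rewrite ?sqr_ge0.
lra.
Qed.

Lemma sym1_Im dt a h k : 0 <= dt -> 0 < h ->
  `|Im (sym1 dt a h k) - dt * a * k| <= dt * `|a| * h ^+ 2 * `|k| ^+ 3.
Proof.
move=> dt0 h0 /=.
have -> : dt * (a / h * sin (h * k)) - dt * a * k =
  dt * a / h * (sin (h * k) - h * k) by field; rewrite gt_eqF.
rewrite !normrM (ger0_norm dt0) (ger0_norm (_ : 0 <= h^-1)) ?invr_ge0 ?(ltW h0)//.
apply: (@le_trans _ _ (dt * `|a| / h * `|h * k| ^+ 3)).
  by rewrite ler_wpM2l ?sin_taylor// divr_ge0 ?mulr_ge0// ltW.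
rewrite normrM (gtr0_norm h0).
by rewrite le_eqVlt; apply/orP; left; apply/eqP; field; rewrite gt_eqF.
Qed.

Lemma sym0_taylor rho dt h1 h2 k e : 0 <= dt -> 0 < h1 -> 0 < h2 ->
  normc (sym0 rho dt h1 h2 k e + (2 * rho * dt * (k * e))%:C) <=
  2 * `|rho| * dt * `|k * e| * ((h1 * k) ^+ 2 + (h2 * e) ^+ 2).
Proof.
move=> dt0 h10 h20; rewrite /sym0 -rmorphD normcR.
set s := h1 * k; set t := h2 * e.
have -> : - (2 * rho * dt / (h1 * h2) * (sin s * sin t)) + 2 * rho * dt * (k * e) =
  - (2 * rho * dt / (h1 * h2) * ((sin s - s) * sin t + s * (sin t - t))).
  by rewrite /s /t; field; rewrite !gt_eqF.
rewrite normrN !normrM (ger0_norm dt0) (gtr0_norm (_ : 0 < (h1 * h2)^-1)); last first.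
  by rewrite invr_gt0 mulr_gt0.
rewrite [`|2|]ger0_norm//.
have st : `|(sin s - s) * sin t + s * (sin t - t)| <=
    `|s| ^+ 3 * `|t| + `|s| * `|t| ^+ 3.
  apply: (le_trans (ler_normD _ _)); rewrite (normrM (sin s - s)) (normrM s).
  by apply: lerD; apply: ler_pM; rewrite ?sin_taylor ?sin_norm_le.
apply: (@le_trans _ _ (2 * `|rho| * dt / (h1 * h2) *
    (`|s| ^+ 3 * `|t| + `|s| * `|t| ^+ 3))).
  by rewrite ler_wpM2l// divr_ge0 ?mulr_ge0// ltW// mulr_gt0.
have -> : `|s| ^+ 3 * `|t| + `|s| * `|t| ^+ 3 =
   `|s| * `|t| * (`|s| ^+ 2 + `|t| ^+ 2) by ring.
rewrite !real_normK ?num_real// {1}/s {1}/t !normrM (gtr0_norm h10) (gtr0_norm h20).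
by rewrite le_eqVlt; apply/orP; left; apply/eqP; field; rewrite !gt_eqF.
Qed.

End Symbols.

(** * Consistency of one step at low frequencies *)

Section LowConsistency.
Context {R : realType}.

Lemma normcV_le1 (z : R[i]) : 1 <= Re z -> normc z^-1 <= 1.
Proof.
move=> z1; rewrite normcV invf_le1.
  by apply: (le_trans z1); apply: (le_trans (ler_norm _)); exact: Re_le_normc.
apply: (lt_le_trans ltr01); apply: (le_trans z1).
by apply: (le_trans (ler_norm _)); exact: Re_le_normc.
Qed.

Lemma Re_ge1_neq0 (z : R[i]) : 1 <= Re z -> z != 0.
Proof. by move=> z1; apply/eqP => z0; move: z1; rewrite z0 /= ler10. Qed.

Lemma Re_sym1_le0 (dt a h k : R) : 0 <= dt -> h != 0 -> Re (sym1 dt a h k) <= 0.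
Proof. by move=> dt0 h0; rewrite sym1E//= oppr_le0 sqr_ge0. Qed.

(** Symbol of Z = dt (A0 + A1 + A2). *)
Definition symz (rho a1 a2 dt h1 h2 k e : R) : R[i] :=
  sym0 rho dt h1 h2 k e + sym1 dt a1 h1 k + sym1 dt a2 h2 e.

(** The mixed term is at most 2 |rho| |a b| <= |rho| (a^2 + b^2), with a and b
    the two square roots. *)
Lemma Re_symz_le (rho a1 a2 dt h1 h2 k e : R) : `|rho| <= 1 ->
  0 <= dt -> h1 != 0 -> h2 != 0 ->
  Re (symz rho a1 a2 dt h1 h2 k e) <=
    - (1 - `|rho|) * (root1 dt h1 k ^+ 2 + root1 dt h2 e ^+ 2).
Proof.
move=> r1 dt0 h10 h20; rewrite /symz !ReD !sym1E// sym0E//=.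
set a := root1 _ _ _; set b := root1 _ _ _.
set p := rho * _ * _.
have pr : `|p| <= `|rho|.
  rewrite /p !normrM -mulrA ler_piMr// mulr_ile1// ?cos_max//.
have ab : `|p| * `|a * b| <= `|rho| * `|a * b| by rewrite ler_wpM2r.
have := sqr_ge0 (`|a| - `|b|).
have -> : (`|a| - `|b|) ^+ 2 = `|a| ^+ 2 + `|b| ^+ 2 - 2 * (`|a| * `|b|) by ring.
rewrite !real_normK ?num_real// -normrM => sq.
have : 2 * - p * a * b <= 2 * (`|p| * `|a * b|).
  rewrite -!mulrA ler_pM2l// -normrM; apply: le_trans (ler_norm _) _.
  by rewrite mulNr normrN.
have : `|rho| * (2 * `|a * b|) <= `|rho| * (a ^+ 2 + b ^+ 2).
  by rewrite ler_wpM2l//; lra.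
lra.
Qed.

Variables (rho a1 a2 theta H : R).

(** A choice of steps and frequencies, bundled because it is the variable of
    the order calculus. *)
Record pt := Pt { p_dt : R ; p_h1 : R ; p_h2 : R ; p_k : R ; p_e : R }.

(** The low frequencies: dt (k^2 + e^2) <= 1, with space steps at most
    proportional to the time step. *)
Definition low (t : pt) := [/\ 0 < p_dt t <= 1, 0 < p_h1 t <= H * p_dt t,
  0 < p_h2 t <= H * p_dt t & p_dt t * (p_k t ^+ 2 + p_e t ^+ 2) <= 1].

Definition lowm (t : pt) := p_dt t * (1 + p_k t ^+ 2 + p_e t ^+ 2).

Lemma lowm02 t : low t -> 0 <= lowm t <= 2.
Proof.
move=> [/andP[d0 d1] _ _ h]; rewrite /lowm.
rewrite mulr_ge0 ?(ltW d0) ?addr_ge0 ?sqr_ge0//=.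
by rewrite -addrA mulrDr mulr1; lra.
Qed.

Let Z0 t := sym0 rho (p_dt t) (p_h1 t) (p_h2 t) (p_k t) (p_e t).
Let Z1 t := sym1 (p_dt t) a1 (p_h1 t) (p_k t).
Let Z2 t := sym1 (p_dt t) a2 (p_h2 t) (p_e t).
Let ha t := - (p_dt t * (p_k t ^+ 2 + 2 * rho * p_k t * p_e t + p_e t ^+ 2)).
Let hb t := p_dt t * (a1 * p_k t + a2 * p_e t).

(** dt^3 Q^2 <= (dt Q)^3 since Q = 1 + k^2 + e^2 >= 1. *)
Lemma Om_Q2 (f : pt -> R[i]) (C : R) :
  (forall t, low t -> normc (f t) <= C * (p_dt t ^+ 3 * (1 + p_k t ^+ 2 + p_e t ^+ 2) ^+ 2)) ->
  Om low lowm 3 f.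
Proof.
move=> fC; exists (Num.max C 0); first by rewrite le_max lexx orbT.
move=> t lt; have [/andP[d0 d1] _ _ _] := lt.
apply: (le_trans (fC t lt)); rewrite /lowm.
set Q := 1 + _ + _.
have Q1 : 1 <= Q by rewrite /Q -addrA lerDl addr_ge0 ?sqr_ge0.
have Q0 : 0 <= Q by lra.
have dQ : 0 <= p_dt t ^+ 3 * Q ^+ 2 by rewrite mulr_ge0 ?exprn_ge0// ltW.
apply: (@le_trans _ _ (Num.max C 0 * (p_dt t ^+ 3 * Q ^+ 2))).
  by rewrite ler_wpM2r// le_max lexx.
rewrite ler_wpM2l ?le_max ?lexx ?orbT// exprMn ler_wpM2l ?exprn_ge0 ?(ltW d0)//.
by rewrite [leRHS]exprS ler_peMl ?exprn_ge0.
Qed.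

(** The space discretization errs by dt h^2 k^4 in the diffusion and by
    dt h^2 k^3 in the convection; with h = O(dt) these are O(dt^3 Q^2), which is of
    third order in dt Q. *)
Lemma Om_sym1 (a : R) (h k : pt -> R) :
  (forall t, low t -> 0 < h t <= H * p_dt t) ->
  (forall t, low t -> k t ^+ 2 <= p_k t ^+ 2 + p_e t ^+ 2) ->
  Om low lowm 3 (fun t => sym1 (p_dt t) a (h t) (k t) -
    (- (p_dt t * k t ^+ 2) +i* (p_dt t * a * k t))) /\
  Om low lowm 1 (fun t => - (p_dt t * k t ^+ 2) +i* (p_dt t * a * k t)).
Proof.
move=> hh kk; split.
  apply: (@Om_Q2 _ (H ^+ 2 * (1 + `|a|))) => t lt.
  have [/andP[d0 d1] _ _ _] := lt.
  have /andP[h0 h1] := hh t lt; have k2 := kk t lt.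
  set dt := p_dt t in d0 d1 h1 *; set Q := 1 + _ + _.
  apply: (le_trans (normc_le _)); rewrite ReD ImD ReN ImN /= opprK.
  have := sym1_Re a (k t) (ltW d0) h0; have := sym1_Im a (k t) (ltW d0) h0.
  have hH : h t ^+ 2 <= (H * dt) ^+ 2 by apply: lerX2 => //; exact: ltW.
  have Q1 : 1 <= Q by rewrite /Q -addrA lerDl addr_ge0 ?sqr_ge0.
  have kQ : k t ^+ 2 <= Q by rewrite /Q -addrA; lra.
  have k4 : k t ^+ 4 <= Q ^+ 2.
    have -> : k t ^+ 4 = (k t ^+ 2) ^+ 2 by ring. by apply: lerX2; rewrite ?sqr_ge0.
  have k3 : `|k t| ^+ 3 <= Q ^+ 2.
    have -> : `|k t| ^+ 3 = `|k t| * `|k t| ^+ 2 by ring.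
    rewrite real_normK ?num_real// expr2; apply: ler_pM; rewrite ?sqr_ge0//.
    rewrite -(@ler_pXn2r _ 2)// ?nnegrE//; last by lra.
    rewrite real_normK ?num_real//; apply: (le_trans kQ).
    by rewrite expr2 ler_peMl//; lra.
  rewrite /sym1/= => him hre; apply: (le_trans (lerD hre him)).
  have -> : H ^+ 2 * (1 + `|a|) * (dt ^+ 3 * Q ^+ 2) =
     dt * (H * dt) ^+ 2 * Q ^+ 2 + dt * `|a| * (H * dt) ^+ 2 * Q ^+ 2 by ring.
  have dt0 := ltW d0.
  have k40 : 0 <= k t ^+ 4.
    have -> : k t ^+ 4 = (k t ^+ 2) ^+ 2 by ring. exact: sqr_ge0.
  have dh0 (p q : R) : 0 <= p -> 0 <= p * q ^+ 2.
    by move=> p0; apply: mulr_ge0 => //; exact: sqr_ge0.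
  have da0 : 0 <= dt * `|a| by exact: mulr_ge0.
  apply: lerD; apply: ler_pM => //; rewrite ?dh0 ?exprn_ge0//; exact: ler_wpM2l.
exists (1 + `|a|); first by rewrite addr_ge0.
move=> t lt; have [/andP[d0 d1] _ _ _] := lt; have k2 := kk t lt.
apply: (le_trans (normc_le _)); rewrite /= expr1 /lowm.
have dk0 : 0 <= p_dt t * k t ^+ 2 by apply: mulr_ge0; rewrite ?sqr_ge0// ltW.
rewrite normrN (ger0_norm dk0) !normrM (ger0_norm (ltW d0)).
set Q := 1 + _ + _.
have Q1 : 1 <= Q by rewrite /Q -addrA lerDl addr_ge0 ?sqr_ge0.
have kQ : k t ^+ 2 <= Q by rewrite /Q -addrA; lra.
have k1 : `|k t| <= Q.
  rewrite -(@ler_pXn2r _ 2)// ?nnegrE//; last by lra.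
  rewrite real_normK ?num_real//; apply: (le_trans kQ).
  by rewrite expr2 ler_peMl//; lra.
have -> : (1 + `|a|) * (p_dt t * Q) = p_dt t * Q + p_dt t * `|a| * Q by ring.
by apply: lerD; rewrite ler_wpM2l ?mulr_ge0// ltW.
Qed.

Lemma Om_sym0 :
  Om low lowm 3 (fun t => Z0 t + (2 * rho * p_dt t * (p_k t * p_e t))%:C) /\
  Om low lowm 1 (fun t => (2 * rho * p_dt t * (p_k t * p_e t))%:C).
Proof.
have ke t : `|p_k t * p_e t| <= p_k t ^+ 2 + p_e t ^+ 2.
  rewrite normrM; have := sqr_ge0 (`|p_k t| - `|p_e t|).
  have -> : (`|p_k t| - `|p_e t|) ^+ 2 =
    `|p_k t| ^+ 2 + `|p_e t| ^+ 2 - 2 * (`|p_k t| * `|p_e t|) by ring.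
  rewrite !real_normK ?num_real//.
  have := mulr_ge0 (normr_ge0 (p_k t)) (normr_ge0 (p_e t)); lra.
split.
  apply: (@Om_Q2 _ (2 * `|rho| * H ^+ 2)) => t lt.
  have [/andP[d0 d1] /andP[h10 h11] /andP[h20 h21] _] := lt.
  set dt := p_dt t in d0 d1 h11 h21 *; set Q := 1 + _ + _.
  have := sym0_taylor rho (p_k t) (p_e t) (ltW d0) h10 h20.
  move/le_trans; apply.
  have Q1 : 1 <= Q by rewrite /Q -addrA lerDl addr_ge0 ?sqr_ge0.
  have keQ : `|p_k t * p_e t| <= Q by rewrite /Q -addrA; have := ke t; lra.
  have hh : (p_h1 t * p_k t) ^+ 2 + (p_h2 t * p_e t) ^+ 2 <= (H * dt) ^+ 2 * Q.
    apply: (@le_trans _ _ ((H * dt) ^+ 2 * p_k t ^+ 2 + (H * dt) ^+ 2 * p_e t ^+ 2)).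
      have -> : (p_h1 t * p_k t) ^+ 2 + (p_h2 t * p_e t) ^+ 2 =
        p_h1 t ^+ 2 * p_k t ^+ 2 + p_h2 t ^+ 2 * p_e t ^+ 2 by ring.
      by apply: lerD; rewrite ler_wpM2r ?sqr_ge0//; apply: lerX2 => //; exact: ltW.
    by rewrite -mulrDr ler_wpM2l ?sqr_ge0// /Q; lra.
  have -> : 2 * `|rho| * H ^+ 2 * (dt ^+ 3 * Q ^+ 2) =
     2 * `|rho| * dt * Q * ((H * dt) ^+ 2 * Q) by ring.
  apply: ler_pM => //.
  - by rewrite !mulr_ge0// ltW.
  - by rewrite addr_ge0 ?sqr_ge0.
  - by rewrite ler_wpM2l// !mulr_ge0// ltW.
exists (2 * `|rho|); first by rewrite mulr_ge0.
move=> t lt; have [/andP[d0 d1] _ _ _] := lt.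
rewrite normcR expr1 (normrM (2 * rho * p_dt t)) !normrM (ger0_norm (ltW d0)) (ger0_norm (_ : (0 : R) <= 2))//.
rewrite -!mulrA ler_pM2l// ler_wpM2l// ler_wpM2l ?(ltW d0)// -normrM.
by have := ke t; lra.
Qed.

(** Let z be the discrete symbol and hz the exact one, so that z - hz is of
    third order.  Then (M - (1 + z + z^2 / 2)) times the square of
    (1 - theta z1) (1 - theta z2) = 1 - w is z (- w^2 - theta^2 z1 z2)
    + z^2 w (2 - w) / 2, whose terms are all of degree at least 3, and
    exp hz - (1 + hz + hz^2 / 2) is of third order as well.  For two implicit Euler
    half-steps the same argument stops at second order. *)
Lemma low_consistency : `|rho| < 1 -> 0 <= theta ->
  exists2 C, 0 <= C & forall t, low t ->
    normc (mcs_factor theta (Z0 t) (Z1 t) (Z2 t) - cexp (ha t) (hb t))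
      <= C * lowm t ^+ 3 /\
    normc ((1 - (Z0 t + Z1 t + Z2 t) / 2)^-1 ^+ 2 - cexp (ha t) (hb t))
      <= C * lowm t ^+ 2.
Proof.
move=> r1 th0.
have m02 := lowm02.
pose z1 t : R[i] := - (p_dt t * p_k t ^+ 2) +i* (p_dt t * a1 * p_k t).
pose z2 t : R[i] := - (p_dt t * p_e t ^+ 2) +i* (p_dt t * a2 * p_e t).
pose z0 t : R[i] := (2 * rho * p_dt t * (p_k t * p_e t))%:C.
have [d1 o1] : Om low lowm 3 (fun t => Z1 t - z1 t) /\ Om low lowm 1 z1.
  apply: Om_sym1 => [t []//|t _]; by rewrite lerDl sqr_ge0.
have [d2 o2] : Om low lowm 3 (fun t => Z2 t - z2 t) /\ Om low lowm 1 z2.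
  apply: Om_sym1 => [t []//|t _]; by rewrite lerDr sqr_ge0.
have [d0 o0] : Om low lowm 3 (fun t => Z0 t + z0 t) /\ Om low lowm 1 z0.
  exact: Om_sym0.
have O1 : Om low lowm 1 Z1.
  apply: Om_eq (OmD (Om_weak m02 _ d1) o1) => // t _; by rewrite subrK.
have O2 : Om low lowm 1 Z2.
  apply: Om_eq (OmD (Om_weak m02 _ d2) o2) => // t _; by rewrite subrK.
have O0 : Om low lowm 1 Z0.
  apply: Om_eq (OmB (Om_weak m02 _ d0) o0) => // t _; by rewrite addrK.
pose hz t : R[i] := ha t +i* hb t.
pose z t := Z0 t + Z1 t + Z2 t.
have hzE t : hz t = z1 t + z2 t - z0 t.
  by rewrite /hz /z1 /z2 /z0 /ha /hb; simpc; congr (_ +i* _); ring.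
have Oz : Om low lowm 1 z by apply: OmD => //; exact: OmD.
have oz : Om low lowm 1 hz.
  by apply: Om_eq (OmB (OmD o1 o2) o0) => t _; rewrite hzE.
have dz : Om low lowm 3 (fun t => z t - hz t).
  by apply: Om_eq (OmD (OmD d0 d1) d2) => t _; rewrite hzE /z; ring.
(* z and hz have the same second order Taylor polynomial up to third order *)
have dz2 : Om low lowm 3 (fun t => (z t + z t ^+ 2 / 2) - (hz t + hz t ^+ 2 / 2)).
  have h := OmM (OmM dz (Om_weak m02 (leq0n 1) (OmD Oz oz))) (Om_cst low lowm 2^-1).
  by apply: Om_eq (OmD dz h) => t _ /=; field.
have a0 t : low t -> ha t <= 0.
  move=> [/andP[dt0 _] _ _ _]; rewrite /ha oppr_le0 mulr_ge0 ?(ltW dt0)//.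
  have := ltW r1; rewrite ler_norml => /andP[r1a r1b].
  have := sqr_ge0 (p_k t + p_e t); have := sqr_ge0 (p_k t - p_e t).
  set k := p_k t; set e := p_e t; nra.
have real_part (f : pt -> R) (F : pt -> R[i]) : Om low lowm 1 F ->
    (forall t, `|f t| <= normc (F t)) -> Om low lowm 1 (fun t => (f t)%:C).
  by move=> [C C0 HC] fF; exists C => // t lt; rewrite normcR (le_trans (fF t))// HC.
have Oa : Om low lowm 1 (fun t => (ha t)%:C).
  by apply: (real_part _ _ oz) => t; exact: (Re_le_normc (hz t)).
have Ob : Om low lowm 1 (fun t => (hb t)%:C).
  by apply: (real_part _ _ oz) => t; exact: (Im_le_normc (hz t)).
have hexp := cexp_taylor m02 a0 Oa Ob.
(* the denominators have real part at least 1 *)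
have Re1 t : low t -> 1 <= Re (1 - theta%:C * Z1 t).
  move=> [/andP[dt0 _] /andP[h10 _] _ _]; rewrite ReD ReN ReRM /= lerDl oppr_ge0.
  by rewrite mulr_ge0_le0// -/(complex.Re (Z1 t)) Re_sym1_le0 ?gt_eqF// ltW.
have Re2 t : low t -> 1 <= Re (1 - theta%:C * Z2 t).
  move=> [/andP[dt0 _] _ /andP[h20 _] _]; rewrite ReD ReN ReRM /= lerDl oppr_ge0.
  by rewrite mulr_ge0_le0// -/(complex.Re (Z2 t)) Re_sym1_le0 ?gt_eqF// ltW.
have Rez t : low t -> 1 <= Re (1 - z t / 2).
  move=> [/andP[dt0 _] /andP[h10 _] /andP[h20 _] _].
  have -> : z t / 2 = (2^-1)%:C * z t by rewrite mulrC fmorphV rmorph_nat.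
  rewrite ReD ReN ReRM lerDl oppr_ge0 mulr_ge0_le0//.
  apply: le_trans (Re_symz_le a1 a2 _ _ (ltW r1) (ltW dt0) _ _) _; rewrite ?gt_eqF//.
  rewrite mulNr oppr_le0; apply: mulr_ge0; first by rewrite subr_ge0 ltW.
  by rewrite addr_ge0 ?sqr_ge0.
have i1 : Om low lowm 0 (fun t => (1 - theta%:C * Z1 t)^-1).
  by exists 1 => // t lt; rewrite expr0 mulr1 normcV_le1// Re1.
have i2 : Om low lowm 0 (fun t => (1 - theta%:C * Z2 t)^-1).
  by exists 1 => // t lt; rewrite expr0 mulr1 normcV_le1// Re2.
have iz : Om low lowm 0 (fun t => (1 - z t / 2)^-1).
  by exists 1 => // t lt; rewrite expr0 mulr1 normcV_le1// Rez.
have M3 : Om low lowm 3 (fun t => mcs_factor theta (Z0 t) (Z1 t) (Z2 t) -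
    (1 + z t + z t ^+ 2 / 2)).
  have ip := OmM (OmM i1 i2) (OmM i1 i2).
  pose w t := theta%:C * (Z1 t + Z2 t) - theta%:C ^+ 2 * (Z1 t * Z2 t).
  have P2 : Om low lowm 2 (fun t => Z1 t * Z2 t) := OmM O1 O2.
  have w1 : Om low lowm 1 w.
    apply: OmB; first by apply: OmZ; exact: OmD.
    by apply: OmZ; exact: (Om_weak m02 _ P2).
  have c0 : Om low lowm 0 (fun t => 2 - w t).
    by apply: OmB; [exact: Om_cst|exact: (Om_weak m02 _ w1)].
  have A1 := OmM Oz (OmN (OmD (OmM w1 w1) (OmZ (theta%:C ^+ 2) P2))).
  have A2 := OmM (OmM (OmM Oz Oz) w1) (OmZ 2^-1 c0).
  apply: Om_eq (OmM ip (OmD A1 A2)) => t lt.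
  rewrite /mcs_factor -/(z t) /w.
  have n1 := Re_ge1_neq0 (Re1 t lt); have n2 := Re_ge1_neq0 (Re2 t lt).
  set Y1 := Z1 t in n1 *; set Y2 := Z2 t in n2 *.
  by field; rewrite n1 n2.
have E2 : Om low lowm 2 (fun t => (1 - z t / 2)^-1 ^+ 2 - (1 + z t)).
  have c0 : Om low lowm 0 (fun t => 3 / 4 - z t / 4).
    apply: OmB; first exact: Om_cst.
    apply: Om_eq (OmZ 4^-1 (Om_weak m02 (leq0n 1) Oz)) => t _; by rewrite mulrC.
  apply: Om_eq (OmM (OmM iz iz) (OmM (OmM Oz Oz) c0)) => t lt.
  have n := Re_ge1_neq0 (Rez t lt).
  have n' : 2 - z t != 0.
    apply: contra n => /eqP h; apply/eqP.
    have -> : 1 - z t / 2 = (2 - z t) / 2 by field.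
    by rewrite h mul0r.
  by field.
have [C C0 HC] : Om low lowm 3 (fun t => mcs_factor theta (Z0 t) (Z1 t) (Z2 t) - cexp (ha t) (hb t)).
  by apply: Om_eq (OmB (OmD M3 dz2) hexp) => t _; rewrite -/(hz t); ring.
have [C' C'0 HC'] : Om low lowm 2 (fun t => (1 - z t / 2)^-1 ^+ 2 - cexp (ha t) (hb t)).
  have q : Om low lowm 2 (fun t => hz t ^+ 2 / 2).
    apply: Om_eq (OmZ 2^-1 (OmX m02 2 oz)) => t _; by rewrite mulrC.
  have h := OmB (OmB E2 q) (Om_weak m02 (isT : (2 <= 3)%N) hexp).
  by apply: Om_eq (OmD h (Om_weak m02 (isT : (2 <= 3)%N) dz)) => t _; rewrite -/(hz t); ring.
exists (C + C'); first exact: addr_ge0.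
move=> t lt; have /andP[m0 _] := m02 t lt; split.
  by apply: (le_trans (HC t lt)); rewrite ler_wpM2r ?exprn_ge0// lerDl.
by apply: (le_trans (HC' t lt)); rewrite ler_wpM2r ?exprn_ge0// lerDr.
Qed.

End LowConsistency.

(** * Bounds on the powers of the amplification factors *)

Section Decay.
Context {R : realType}.

Lemma pow_expRN_bounded (j : nat) (c : R) : 0 < c ->
  exists2 C, 0 < C & forall s, 0 <= s -> s ^+ j * expR (- (c * s)) <= C.
Proof.
move=> c0; case: j => [|j].
  exists 1 => // s s0; rewrite expr0 mul1r -expR0 ler_expR oppr_le0.
  by rewrite mulr_ge0// ltW.
pose F : R := (j.+1)`!%:R.
have F0 : 0 < F by rewrite ltr0n fact_gt0.
exists (F / c ^+ j.+1); first by rewrite divr_gt0 ?exprn_gt0.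
move=> s s0; rewrite expRN ler_pdivrMr ?expR_gt0//.
have cs : 0 <= c * s by rewrite mulr_ge0// ltW.
have := expR_ge1Dxn j cs; rewrite -/F exprMn => h.
have {}h : c ^+ j.+1 * s ^+ j.+1 / F <= expR (c * s) by lra.
rewrite mulrAC ler_pdivlMr ?exprn_gt0//.
by move: h; rewrite ler_pdivrMr//; lra.
Qed.

(** Telescoping a^n - b^n, each of the n terms losing one power of r. *)
Lemma normc_subX (a b : R[i]) (r : R) n : normc a <= r -> normc b <= r ->
  normc (a ^+ n - b ^+ n) <= n%:R * normc (a - b) * r ^+ n.-1.
Proof.
move=> ar br; have r0 : 0 <= r by apply: le_trans ar; exact: normc_ge0.
case: n => [|n]; first by rewrite !expr0 subrr normc0 !mul0r.
elim: n => [|n IH]; first by rewrite !expr1 expr0 mulr1 mul1r.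
have -> : a ^+ n.+2 - b ^+ n.+2 = a * (a ^+ n.+1 - b ^+ n.+1) + (a - b) * b ^+ n.+1.
  by rewrite !(exprS _ n.+1); ring.
apply: (le_trans (le_normcD _ _)); rewrite !normcM normcX.
rewrite -[n.+2%:R]natr1 /= !mulrDl mul1r; apply: lerD.
  apply: (@le_trans _ _ (r * (n.+1%:R * normc (a - b) * r ^+ n))).
    by apply: ler_pM; rewrite ?normc_ge0.
  by rewrite (exprS r n) le_eqVlt; apply/orP; left; apply/eqP; ring.
by apply: ler_wpM2l; [exact: normc_ge0|apply: lerXn2r; rewrite ?nnegrE ?normc_ge0].
Qed.

Variables (rho a1 a2 theta : R).

(** Amplification factor of a Modified Craig--Sneyd step. *)
Definition mcsz dt h1 h2 k e : R[i] :=
  mcs_factor theta (sym0 rho dt h1 h2 k e) (sym1 dt a1 h1 k) (sym1 dt a2 h2 e).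

(** Amplification factor of an implicit Euler half-step. *)
Definition eulerz dt h1 h2 k e : R[i] := (1 - symz rho a1 a2 dt h1 h2 k e / 2)^-1.

Lemma mcsz_stable : `|rho| < 1 -> 1 / 4 < theta -> 1 + `|rho| < 6 * theta ->
  exists c d0, [/\ 0 < c, 0 < d0 & forall dt h1 h2 k e,
    0 < dt <= d0 -> 0 < h1 -> 0 < h2 ->
    normc (mcsz dt h1 h2 k e) ^+ 2 <=
      1 - c * dissip theta (root1 dt h1 k) (root1 dt h2 e)].
Proof.
move=> r1 th4 th6.
have [c [d0 [c0 d00 H]]] := mcs_factor_stable (normr_ge0 rho) r1 th4 th6.
pose A := a1 ^+ 2 + a2 ^+ 2 + 1.
have A0 : 0 < A by rewrite /A ltr_wpDl// addr_ge0 ?sqr_ge0.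
exists c, (d0 / A); split => //; first by rewrite divr_gt0.
move=> dt h1 h2 k e /andP[dt0 dt1] h10 h20.
have m2 (a t : R) : a ^+ 2 <= A -> (Num.sqrt dt * a * cos t) ^+ 2 <= dt * A.
  move=> aA; rewrite !exprMn sqr_sqrtr ?(ltW dt0)// -mulrA ler_pM2l//.
  apply: le_trans aA; rewrite ler_piMr ?sqr_ge0//.
rewrite /mcsz !sym1E ?sym0E ?gt_eqF ?(ltW dt0)//; apply: (H (dt * A)).
- by rewrite mulr_ge0 ?(ltW dt0) ?(ltW A0)//= -ler_pdivlMr.
- rewrite normrN !normrM -mulrA ler_piMr// mulr_ile1// cos_max//.
- by apply: m2; rewrite /A; have := sqr_ge0 a2; lra.
- by apply: m2; rewrite /A; have := sqr_ge0 a1; lra.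
Qed.

(** Here both squares are at most 1, so the denominators of the dissipation
    are at most (1 + theta)^2, and each square is at least a ninth of its
    continuous counterpart by [root1_ge]. *)
Lemma dissip_low dt h1 h2 k e : 0 <= theta -> 0 < dt -> 0 < h1 -> 0 < h2 ->
  `|h1 * k| <= pi -> `|h2 * e| <= pi -> dt * (k ^+ 2 + e ^+ 2) <= 1 ->
  dt * (k ^+ 2 + e ^+ 2) / (9 * (1 + theta) ^+ 2) <=
  dissip theta (root1 dt h1 k) (root1 dt h2 e).
Proof.
move=> th0 dt0 h10 h20 hk he q1.
have T1 : 0 < 1 + theta by lra.
have T0 : 0 < (1 + theta) ^+ 2 by rewrite exprn_gt0.
have half (h x : R) : 0 < h -> `|h * x| <= pi -> dt * x ^+ 2 <= 1 ->
    dt * x ^+ 2 / (9 * (1 + theta) ^+ 2) <=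
    root1 dt h x ^+ 2 / (1 + theta * root1 dt h x ^+ 2) ^+ 2.
  move=> h0 hx x1.
  have lo := root1_ge (ltW dt0) h0 hx; have up := root1_le x (ltW dt0) h0.
  set r := root1 _ _ _ ^+ 2 in lo up *.
  have r0 : 0 <= r by exact: sqr_ge0.
  rewrite [X in X <= _](_ : _ = dt * x ^+ 2 / 9 / (1 + theta) ^+ 2); last first.
    by field; rewrite gt_eqF// ltr_pwDl.
  have tr : 0 <= theta * r by exact: mulr_ge0.
  apply: ler_pM => //.
  - by rewrite divr_ge0// mulr_ge0 ?sqr_ge0// ltW.
  - by rewrite invr_ge0 ltW.
  have X0 : 0 < 1 + theta * r by rewrite ltr_pwDl.
  rewrite lef_pV2 ?posrE ?exprn_gt0//.
  apply: lerX2; first by rewrite addr_ge0.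
  by rewrite lerD2l ler_piMr// (le_trans up).
have k0 : 0 <= dt * k ^+ 2 by rewrite mulr_ge0 ?sqr_ge0// ltW.
have e0 : 0 <= dt * e ^+ 2 by rewrite mulr_ge0 ?sqr_ge0// ltW.
rewrite mulrDr in q1.
by rewrite mulrDr mulrDl; apply: lerD; apply: half => //; lra.
Qed.

(** The larger square x satisfies x >= 1 / 18, hence
    1 + theta x <= (18 + theta) x. *)
Lemma dissip_high (a b : R) : 0 <= theta -> 1 / 9 <= a ^+ 2 + b ^+ 2 ->
  ((18 + theta) ^+ 2 * (a ^+ 2 + b ^+ 2))^-1 <= dissip theta a b.
Proof.
move=> th0 w9; rewrite /dissip; set x := a ^+ 2 in w9 *; set y := b ^+ 2 in w9 *.
have x0 : 0 <= x by exact: sqr_ge0.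
have y0 : 0 <= y by exact: sqr_ge0.
clearbody x y.
wlog xy : x y w9 x0 y0 / y <= x.
  move=> W; have [/W|/ltW xy] := lerP y x; first exact.
  by rewrite [x + y]addrC [leRHS]addrC; apply: W => //; rewrite addrC.
have x9 : 1 / 18 <= x by lra.
have xp : 0 < x by lra.
have tx : 0 <= theta * x by exact: mulr_ge0.
apply: (@le_trans _ _ (x / (1 + theta * x) ^+ 2)); last first.
  by rewrite lerDl divr_ge0 ?sqr_ge0.
have T0 : 0 < 18 + theta by lra.
have X0 : 0 < 1 + theta * x by lra.
rewrite ler_pdivlMr ?exprn_gt0// ler_pdivrMl; last by rewrite mulr_gt0 ?exprn_gt0//; lra.
apply: (@le_trans _ _ (((18 + theta) * x) ^+ 2)).
  by apply: lerX2; [exact: ltW|rewrite mulrDl; lra].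
have -> : ((18 + theta) * x) ^+ 2 = (18 + theta) ^+ 2 * (x * x) by ring.
have -> : (18 + theta) ^+ 2 * (x + y) * x = (18 + theta) ^+ 2 * ((x + y) * x) by ring.
by apply: ler_wpM2l; [exact: sqr_ge0|apply: ler_wpM2r => //; lra].
Qed.

Lemma normc_eulerz dt h1 h2 k e : `|rho| < 1 -> 0 < dt -> 0 < h1 -> 0 < h2 ->
  normc (eulerz dt h1 h2 k e) <=
  (1 + (1 - `|rho|) / 2 * (root1 dt h1 k ^+ 2 + root1 dt h2 e ^+ 2))^-1.
Proof.
move=> r1 dt0 h10 h20; rewrite /eulerz normcV.
have := Re_symz_le a1 a2 k e (ltW r1) (ltW dt0) (lt0r_neq0 h10) (lt0r_neq0 h20).
set w := _ ^+ 2 + _ ^+ 2; set z := symz _ _ _ _ _ _ _ _ => zw.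
have w0 : 0 <= (1 - `|rho|) / 2 * w.
  by rewrite mulr_ge0 ?addr_ge0 ?sqr_ge0// divr_ge0// subr_ge0 ltW.
have zE : Re (1 - z / 2) = 1 - Re z / 2.
  have -> : z / 2 = (2^-1)%:C * z by rewrite mulrC fmorphV rmorph_nat.
  by rewrite ReD ReN ReRM /= mulrC.
have zn := le_trans (ler_norm _) (Re_le_normc (1 - z / 2)).
rewrite zE in zn.
by rewrite lef_pV2 ?posrE; lra.
Qed.

End Decay.

(** * Error of the Fourier transform at a given frequency *)

Lemma half_le_subn (n m : nat) : (2 * m <= n)%N -> (n <= (n - m) * 2)%N.
Proof. lia. Qed.

Section Pointwise.
Context {R : realType}.

Lemma form_ge (rho k e : R) : `|rho| <= 1 ->
  (1 - `|rho|) * (k ^+ 2 + e ^+ 2) <= k ^+ 2 + 2 * rho * k * e + e ^+ 2.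
Proof.
move=> r1.
have : - (rho * k * e) <= `|rho| * `|k * e|.
  by rewrite -mulrA -normrM; apply: le_trans (ler_norm _) _; rewrite normrN.
have ke : 2 * `|k * e| <= k ^+ 2 + e ^+ 2.
  rewrite normrM; have := sqr_ge0 (`|k| - `|e|).
  have -> : (`|k| - `|e|) ^+ 2 = `|k| ^+ 2 + `|e| ^+ 2 - 2 * (`|k| * `|e|) by ring.
  by rewrite !real_normK ?num_real//; lra.
have : `|rho| * (2 * `|k * e|) <= `|rho| * (k ^+ 2 + e ^+ 2) by rewrite ler_wpM2l.
lra.
Qed.

(** Half of the exponent is kept in the Gaussian; the other half is at most
    exp (- c / dt) = O(dt^2). *)
Lemma gauss_high (rho : R) : `|rho| < 1 -> exists C c, [/\ 0 < C, 0 < c &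
  forall dt k e, 0 < dt -> 1 <= dt * (k ^+ 2 + e ^+ 2) ->
  expR (- (k ^+ 2 + 2 * rho * k * e + e ^+ 2)) <=
    C * (dt ^+ 2 * expR (- (c * (k ^+ 2 + e ^+ 2))))].
Proof.
move=> r1; pose c := (1 - `|rho|) / 2.
have c0 : 0 < c by rewrite divr_gt0// subr_gt0.
have [C C0 HC] := pow_expRN_bounded 2 c0.
exists C, c; split => // dt k e dt0 h.
have F := form_ge k e (ltW r1).
set q := k ^+ 2 + e ^+ 2 in h F *.
have q0 : 0 <= q by rewrite addr_ge0 ?sqr_ge0.
apply: (@le_trans _ _ (expR (- (c * q)) * expR (- (c * q)))).
  rewrite -expRD ler_expR /c; lra.
rewrite mulrA ler_wpM2r ?expR_ge0//.
have s0 : 0 <= dt^-1 by rewrite invr_ge0 ltW.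
apply: (@le_trans _ _ (expR (- (c * dt^-1)))).
  rewrite ler_expR lerN2 ler_wpM2l ?(ltW c0)//.
  by rewrite -div1r ler_pdivrMr// mulrC.
have := HC _ s0; rewrite exprVn mulrC ler_pdivrMr ?exprn_gt0//.
Qed.

(** The polynomial is absorbed by half of the exponent. *)
Lemma poly_gauss (c : R) : 0 < c -> exists2 C, 0 < C & forall s, 0 <= s ->
  (1 + s) ^+ 3 * expR (- (c * s)) <= C * expR (- (c / 2 * s)).
Proof.
move=> c0; have c20 : 0 < c / 2 by rewrite divr_gt0.
have [C C0 HC] := pow_expRN_bounded 3 c20.
exists (C * expR (c / 2)); first by rewrite mulr_gt0 ?expR_gt0.
move=> s s0; have s1 : 0 <= 1 + s by rewrite addr_ge0.
have := HC _ s1 => h.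
have -> : - (c * s) = - (c / 2 * (1 + s)) + c / 2 + - (c / 2 * s).
  by field.
rewrite !expRD !mulrA ler_wpM2r ?expR_ge0//.
by rewrite ler_wpM2r ?expR_ge0.
Qed.

Variables (rho a1 a2 theta c lambda : R) (N0 : nat).

(** Fourier transform of the exact solution at time 1. *)
Definition uhat k e : R[i] :=
  cexp (- (k ^+ 2 + 2 * rho * k * e + e ^+ 2)) (a1 * k + a2 * e).

(** Fourier transform of the numerical solution after n >= N0 steps. *)
Definition Uhat dt h1 h2 n k e : R[i] :=
  mcsz rho a1 a2 theta dt h1 h2 k e ^+ (n - N0) *
  (eulerz rho a1 a2 dt h1 h2 k e ^+ 2) ^+ N0.

Definition inbox (h1 h2 k e : R) := (`|h1 * k| <= pi) && (`|h2 * e| <= pi).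

(** Let u be the exact propagator over one time step.  Both M and u are
    bounded by r = exp (- g dt q), and one step errs by C (dt (1 + q))^3, so n
    steps err by n C (dt (1 + q))^3 r^(n - N0 - 1); since n dt = 1, this is
    dt^2 (1 + q)^3 times a Gaussian in q.  The N0 start-up steps err by
    C (dt (1 + q))^2 each. *)
Lemma pointwise_low : `|rho| < 1 -> 1 / 4 < theta -> 1 + `|rho| < 6 * theta ->
  0 < c -> 0 < lambda ->
  exists C k0 d0, [/\ 0 < C, 0 < k0, 0 < d0 & forall n k e, (N0 < n)%N ->
    let dt := n%:R^-1 in let h1 := dt / lambda in let h2 := c * (dt / lambda) in
    dt <= d0 -> inbox h1 h2 k e -> dt * (k ^+ 2 + e ^+ 2) <= 1 ->
    normc (Uhat dt h1 h2 n k e - uhat k e) <=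
      C * (dt ^+ 2 * expR (- (k0 * (k ^+ 2 + e ^+ 2))))].
Proof.
move=> r1 th4 th6 c0 l0.
have th0 : 0 <= theta by lra.
pose H := Num.max 1 c / lambda.
have [C C0 HC] := @low_consistency R rho a1 a2 theta H r1 th0.
have [c1 [d0 [c10 d00 Hs]]] := mcsz_stable a1 a2 r1 th4 th6.
have th1 : 1 + theta != 0 by rewrite gt_eqF//; lra.
pose c2 := c1 / (9 * (1 + theta) ^+ 2) / 2.
have T0 : 0 < (1 + theta) ^+ 2 by rewrite exprn_gt0//; lra.
have c20 : 0 < c2 by rewrite !divr_gt0// mulr_gt0.
pose g := Num.min c2 (1 - `|rho|).
have g0 : 0 < g by rewrite lt_min c20 subr_gt0.
have [P P0 HP] := poly_gauss g0.
pose K := (C + N0%:R * C) * expR (g * N0.+1%:R).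
exists (K * P + 1), (g / 2), (Num.min 1 d0); split.
- by rewrite ltr_wpDl// !mulr_ge0 ?addr_ge0 ?mulr_ge0 ?expR_ge0// ltW.
- by rewrite divr_gt0.
- by rewrite lt_min ltr01.
move=> n k e nN0 dt h1 h2; rewrite le_min => /andP[dt1 dtd0] /andP[hk he] q1.
have n0 : 0 < n%:R :> R by rewrite ltr0n; case: (n) nN0.
have dt0 : 0 < dt by rewrite invr_gt0.
have h10 : 0 < h1 by rewrite divr_gt0.
have h20 : 0 < h2 by rewrite mulr_gt0// divr_gt0.
pose t := Pt dt h1 h2 k e.
have lt : low H t.
  split; rewrite /= ?dt0// ?h10 ?h20/=.
    rewrite /h1 /H [leRHS]mulrAC ler_wpM2r ?invr_ge0 ?(ltW l0)//.
    by rewrite ler_peMl ?(ltW dt0)// le_max lexx.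
  rewrite /h2 /H mulrA [leRHS]mulrAC ler_wpM2r ?invr_ge0 ?(ltW l0)//.
  by rewrite ler_wpM2r ?(ltW dt0)// le_max lexx orbT.
have [HM HE] :
  normc (mcsz rho a1 a2 theta dt h1 h2 k e -
    cexp (- (dt * (k ^+ 2 + 2 * rho * k * e + e ^+ 2))) (dt * (a1 * k + a2 * e)))
    <= C * (dt * (1 + k ^+ 2 + e ^+ 2)) ^+ 3 /\
  normc (eulerz rho a1 a2 dt h1 h2 k e ^+ 2 -
    cexp (- (dt * (k ^+ 2 + 2 * rho * k * e + e ^+ 2))) (dt * (a1 * k + a2 * e)))
    <= C * (dt * (1 + k ^+ 2 + e ^+ 2)) ^+ 2 := HC _ lt.
move: HM HE; rewrite /Uhat /uhat.
set M := mcsz _ _ _ _ _ _ _ _ _; set E := eulerz _ _ _ _ _ _ _ _.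
set u := cexp (- (dt * _)) _ => HM HE.
set q := k ^+ 2 + e ^+ 2 in q1 *.
have q0 : 0 <= q by rewrite addr_ge0 ?sqr_ge0.
rewrite -[1 + _ + _]addrA -/q in HM HE.
pose r := expR (- (g * (dt * q))).
have dq0 : 0 <= dt * q by rewrite mulr_ge0// ltW.
have Mr : normc M <= r.
  apply: (@le_trans _ _ (expR (- (c2 * (dt * q))))); last first.
    by rewrite ler_expR lerN2 ler_wpM2r// ge_min lexx.
  rewrite -(@ler_pXn2r _ 2)// ?nnegrE ?normc_ge0 ?expR_ge0//.
  rewrite -expRM_natl.
  have dd : 0 < dt <= d0 by rewrite dt0.
  apply: (le_trans (Hs dt h1 h2 k e dd h10 h20)).
  apply: (@le_trans _ _ (1 - 2 * (c2 * (dt * q)))); last first.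
    by apply: le_trans (expR_ge1Dx _); rewrite mulrN.
  rewrite lerD2l lerN2.
  have -> : 2 * (c2 * (dt * q)) = c1 * (dt * q / (9 * (1 + theta) ^+ 2)).
    by rewrite /c2; field.
  by rewrite ler_wpM2l ?(ltW c10)// dissip_low.
(* the same bound for the exact propagator *)
have ur : normc u <= r.
  rewrite normc_cexp ler_expR lerN2.
  have := form_ge k e (ltW r1); rewrite -/q => F.
  apply: (@le_trans _ _ (dt * ((1 - `|rho|) * q))); last first.
    by rewrite ler_wpM2l// ltW.
  by rewrite mulrCA ler_wpM2l ?(ltW dt0)// ler_wpM2r// ge_min lexx orbT.
have r01 : r <= 1 by rewrite -expR0 ler_expR oppr_le0 mulr_ge0// ltW.
have r0 : 0 <= r by exact: expR_ge0.
have E1 : normc (E ^+ 2) <= 1.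
  rewrite normcX exprn_ile1// ?normc_ge0//.
  apply: (le_trans (normc_eulerz a1 a2 k e r1 dt0 h10 h20)).
  have : 0 <= (1 - `|rho|) / 2 * (root1 dt h1 k ^+ 2 + root1 dt h2 e ^+ 2).
    by rewrite mulr_ge0 ?addr_ge0 ?sqr_ge0// divr_ge0// subr_ge0 ltW.
  by move=> h; rewrite invf_le1 ?lerDl// ltr_pwDl.
have uE : cexp (- (k ^+ 2 + 2 * rho * k * e + e ^+ 2)) (a1 * k + a2 * e) =
   u ^+ (n - N0) * u ^+ N0.
  rewrite -exprD subnK ?(ltnW nN0)// /u cexpX.
  by congr cexp; rewrite /dt; field; rewrite gt_eqF.
rewrite uE.
set nn := (n - N0)%N.
have nn0 : (0 < nn)%N by rewrite subn_gt0.
have -> : M ^+ nn * (E ^+ 2) ^+ N0 - u ^+ nn * u ^+ N0 =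
  (M ^+ nn - u ^+ nn) * (E ^+ 2) ^+ N0 + u ^+ nn * ((E ^+ 2) ^+ N0 - u ^+ N0) by ring.
set m := dt * (1 + q) in HM HE.
have m0 : 0 <= m by apply: mulr_ge0; [exact: ltW|exact: addr_ge0].
(* r^n is the Gaussian exp (- g q) since n dt = 1; the N0 + 1 missing powers
   cost a constant because dt q <= 1 *)
have rn : r ^+ nn.-1 <= expR (g * N0.+1%:R) * expR (- (g * q)).
  rewrite -expRM_natl -expRD ler_expR.
  have nnE : nn.-1%:R = n%:R - N0.+1%:R :> R.
    by rewrite /nn -subnS natrB.
  rewrite nnE /dt.
  have -> : (n%:R - N0.+1%:R) * - (g * (n%:R^-1 * q)) =
    g * (N0.+1%:R * (n%:R^-1 * q)) - g * q by field; rewrite gt_eqF.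
  rewrite lerD2r ler_wpM2l ?(ltW g0)//.
  by rewrite -/dt ler_piMr.
have B1 : normc ((M ^+ nn - u ^+ nn) * (E ^+ 2) ^+ N0) <=
    C * (dt ^+ 2 * (1 + q) ^+ 3) * (expR (g * N0.+1%:R) * expR (- (g * q))).
  rewrite normcM; apply: (@le_trans _ _ (normc (M ^+ nn - u ^+ nn))).
    by rewrite ler_piMr ?normc_ge0// normcX exprn_ile1// ?normc_ge0.
  apply: (le_trans (normc_subX nn Mr ur)).
  apply: ler_pM => //; rewrite ?mulr_ge0 ?normc_ge0 ?exprn_ge0//.
  apply: (@le_trans _ _ (n%:R * (C * m ^+ 3))).
    by apply: ler_pM; rewrite ?normc_ge0// ler_nat leq_subr.
  have -> : n%:R * (C * m ^+ 3) = (n%:R * dt) * (C * (dt ^+ 2 * (1 + q) ^+ 3)).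
    by rewrite /m; ring.
  by rewrite mulfV ?mul1r// gt_eqF.
have B2 : normc (u ^+ nn * ((E ^+ 2) ^+ N0 - u ^+ N0)) <=
    N0%:R * C * (dt ^+ 2 * (1 + q) ^+ 3) * (expR (g * N0.+1%:R) * expR (- (g * q))).
  rewrite normcM mulrC; apply: ler_pM; rewrite ?normc_ge0//.
    have u1 : normc u <= 1 by exact: le_trans r01.
    apply: (le_trans (normc_subX N0 E1 u1)); rewrite expr1n mulr1 -mulrA.
    apply: ler_wpM2l => //; apply: (le_trans HE); rewrite ler_wpM2l//.
    rewrite /m exprMn ler_wpM2l ?sqr_ge0// [leRHS]exprS ler_peMl ?sqr_ge0//.
    by rewrite lerDl.
  apply: le_trans rn; rewrite normcX.
  apply: (@le_trans _ _ (r ^+ nn)); first by rewrite lerXn2r ?nnegrE ?normc_ge0.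
  by rewrite -{1}(prednK nn0) exprS ler_piMl ?exprn_ge0.
apply: (le_trans (le_normcD _ _)); apply: (le_trans (lerD B1 B2)).
have -> : C * (dt ^+ 2 * (1 + q) ^+ 3) * (expR (g * N0.+1%:R) * expR (- (g * q))) +
   N0%:R * C * (dt ^+ 2 * (1 + q) ^+ 3) * (expR (g * N0.+1%:R) * expR (- (g * q))) =
   K * dt ^+ 2 * ((1 + q) ^+ 3 * expR (- (g * q))) by rewrite /K; ring.
have K0 : 0 <= K by rewrite mulr_ge0 ?expR_ge0// addr_ge0// mulr_ge0.
apply: (@le_trans _ _ (K * dt ^+ 2 * (P * expR (- (g / 2 * q))))).
  by rewrite ler_wpM2l ?HP// mulr_ge0 ?sqr_ge0.
have : 0 <= dt ^+ 2 * expR (- (g / 2 * q)) by rewrite mulr_ge0 ?sqr_ge0 ?expR_ge0.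
lra.
Qed.

(** With w = a^2 + b^2 >= 1 / 9 the dissipation is at least of order 1 / w and
    the Euler factor is O(1 / w).  Hence the transform is bounded by
    w^(- 2 N0) exp (- c n / w), which is n^(- 2 N0) times a bounded function of
    n / w. *)
Lemma pointwise_high : `|rho| < 1 -> 1 / 4 < theta -> 1 + `|rho| < 6 * theta ->
  0 < c -> 0 < lambda ->
  exists C d0, [/\ 0 < C, 0 < d0 & forall n k e, (N0 < n)%N -> (2 * N0 <= n)%N ->
    let dt := n%:R^-1 in let h1 := dt / lambda in let h2 := c * (dt / lambda) in
    dt <= d0 -> inbox h1 h2 k e -> 1 <= dt * (k ^+ 2 + e ^+ 2) ->
    normc (Uhat dt h1 h2 n k e) <= C * dt ^+ (2 * N0)].
Proof.
move=> r1 th4 th6 c0 l0.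
have th0 : 0 <= theta by lra.
have [c1 [d0 [c10 d00 Hs]]] := mcsz_stable a1 a2 r1 th4 th6.
have S0 : 0 < (18 + theta) ^+ 2 by rewrite exprn_gt0//; lra.
pose c2 := c1 / (18 + theta) ^+ 2 / 4.
have c20 : 0 < c2 by rewrite !divr_gt0.
have [P P0 HP] := pow_expRN_bounded (2 * N0) c20.
pose Q := 2 / (1 - `|rho|).
have Q0 : 0 < Q by rewrite divr_gt0// subr_gt0.
exists (P * Q ^+ (2 * N0)), d0; split => //; first by rewrite mulr_gt0 ?exprn_gt0.
move=> n k e nN0 nN0' dt h1 h2 dtd0 /andP[hk he] q1.
have n0 : 0 < n%:R :> R by rewrite ltr0n; case: (n) nN0.
have dt0 : 0 < dt by rewrite invr_gt0.
have h10 : 0 < h1 by rewrite divr_gt0.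
have h20 : 0 < h2 by rewrite mulr_gt0// divr_gt0.
have ge1 := root1_ge (ltW dt0) h10 hk; have ge2 := root1_ge (ltW dt0) h20 he.
have dd : 0 < dt <= d0 by rewrite dt0.
have HM := Hs dt h1 h2 k e dd h10 h20.
have HE := normc_eulerz a1 a2 k e r1 dt0 h10 h20.
rewrite /Uhat; set M := mcsz _ _ _ _ _ _ _ _ _ in HM *.
set E := eulerz _ _ _ _ _ _ _ _ in HE *.
set a := root1 _ _ _ in ge1 HM HE; set b := root1 _ _ _ in ge2 HM HE.
have w9 : 1 / 9 <= a ^+ 2 + b ^+ 2 by lra.
have := dissip_high th0 w9; move: HM HE w9.
set w := a ^+ 2 + b ^+ 2 => HM HE w9 g1.
have w0 : 0 < w by lra.
have M1 : normc M <= expR (- (2 * c2 / w)).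
  rewrite -(@ler_pXn2r _ 2)// ?nnegrE ?normc_ge0 ?expR_ge0//.
  apply: (le_trans HM); rewrite -expRM_natl; apply: le_trans (expR_ge1Dx _).
  have -> : 2%:R * - (2 * c2 / w) = - (c1 * ((18 + theta) ^+ 2 * w)^-1).
    rewrite /c2; field; rewrite (gt_eqF w0) /=.
    by rewrite gt_eqF//; lra.
  by rewrite lerD2l lerN2 ler_wpM2l// ltW.
have E1 : normc (E ^+ 2) <= (Q / w) ^+ 2.
  rewrite normcX; apply: lerX2; rewrite ?normc_ge0//; apply: (le_trans HE).
  have -> : Q / w = ((1 - `|rho|) / 2 * w)^-1.
    have rn : 1 - `|rho| != 0 by rewrite subr_eq0 eq_sym lt_eqF.
    by rewrite /Q; field; rewrite rn gt_eqF.
  have p0 : 0 < (1 - `|rho|) / 2 * w by rewrite mulr_gt0// divr_gt0// subr_gt0.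
  by rewrite lef_pV2 ?posrE ?lerDr// ltr_wpDl.
rewrite normcM !normcX.
apply: (@le_trans _ _ (expR (- (c2 * (n%:R / w))) * (Q / w) ^+ (2 * N0))).
  apply: ler_pM; rewrite ?exprn_ge0 ?normc_ge0//.
    apply: (@le_trans _ _ (expR (- (2 * c2 / w)) ^+ (n - N0))).
      by rewrite lerXn2r ?nnegrE ?normc_ge0 ?expR_ge0.
    rewrite -expRM_natl ler_expR.
    have nn : n%:R / 2 <= (n - N0)%:R :> R.
      by rewrite ler_pdivrMr// -natrM ler_nat half_le_subn.
    have cw : 0 <= 2 * c2 / w by apply: divr_ge0; [apply: mulr_ge0|]; rewrite ?ler0n// ltW.
    have := ler_wpM2r cw nn.
    have -> : n%:R / 2 * (2 * c2 / w) = c2 * (n%:R / w) by field; rewrite gt_eqF.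
    lra.
  by rewrite exprM lerXn2r ?nnegrE ?sqr_ge0// -normcX.
have s0 : 0 <= n%:R / w by rewrite divr_ge0// ltW.
have h := HP _ s0.
have -> : (Q / w) ^+ (2 * N0) = (Q * dt) ^+ (2 * N0) * (n%:R / w) ^+ (2 * N0).
  rewrite -exprMn; congr (_ ^+ _); rewrite /dt; field.
  by rewrite (gt_eqF w0) (gt_eqF n0).
rewrite exprMn.
have qd : 0 <= Q ^+ (2 * N0) * dt ^+ (2 * N0) by rewrite mulr_ge0// exprn_ge0// ltW.
have := ler_wpM2l qd h; lra.
Qed.

End Pointwise.

(** * Integrals over a rectangle of frequencies *)

Section Bounded.
Context {R : realType}.
Notation mu := (@lebesgue_measure R).
Notation nu := (mu \x mu)%E.
Implicit Types f g : R * R -> R.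

(** Bounded measurable functions are integrable on every rectangle, and this
    class is visibly stable under sums and products. *)
Definition bmeas f := measurable_fun setT f /\ exists M, forall p, `|f p| <= M.

Lemma bmeas_cst (k : R) : bmeas (fun=> k).
Proof. by split; [exact: measurable_cst|exists `|k|]. Qed.

Lemma bmeasD f g : bmeas f -> bmeas g -> bmeas (fun p => f p + g p).
Proof.
move=> [mf [M fM]] [mg [L gL]]; split; first exact: measurable_funD.
by exists (M + L) => p; apply: (le_trans (ler_normD _ _)); exact: lerD.
Qed.

Lemma bmeasM f g : bmeas f -> bmeas g -> bmeas (fun p => f p * g p).
Proof.
move=> [mf [M fM]] [mg [L gL]]; split; first exact: measurable_funM.
by exists (M * L) => p; rewrite normrM ler_pM.
Qed.

Lemma bmeasN f : bmeas f -> bmeas (fun p => - f p).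
Proof.
move=> [mf [M fM]]; split; first exact: measurableT_comp.
by exists M => p; rewrite normrN.
Qed.

Lemma bmeasB f g : bmeas f -> bmeas g -> bmeas (fun p => f p - g p).
Proof. by move=> bf bg; apply: bmeasD => //; exact: bmeasN. Qed.

Lemma bmeas_sum (I : Type) (s : seq I) (F : I -> R * R -> R) :
  (forall i, bmeas (F i)) -> bmeas (fun p => \sum_(i <- s) F i p).
Proof.
move=> bF; elim: s => [|i s IH].
  rewrite (_ : (fun _ => _) = fun=> 0); first exact: bmeas_cst.
  by apply/funext => p; rewrite big_nil.
rewrite (_ : (fun _ => _) = fun p => F i p + \sum_(i <- s) F i p).
  exact: bmeasD.
by apply/funext => p; rewrite big_cons.
Qed.

(** The inverse is measurable because it is the power function of exponent
    -1 on positive numbers. *)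
Lemma bmeasV f : measurable_fun setT f -> (forall p, 1 <= f p) ->
  bmeas (fun p => (f p)^-1).
Proof.
move=> mf f1; split.
  rewrite (_ : (fun _ => _) = (fun p => f p `^ (-1))).
    by apply: (@measurableT_comp _ _ _ _ _ _ (fun x : R => x `^ (-1))).
  by apply/funext => p; rewrite powR_inv1// (le_trans ler01).
exists 1 => p; have p0 : 0 < f p by apply: lt_le_trans (f1 p).
by rewrite ger0_norm ?invr_ge0 ?(ltW p0)// invf_le1.
Qed.

(** The phases of the Fourier kernels. *)
Definition lin (a b : R) (p : R * R) := a * p.1 + b * p.2.

Lemma measurable_lin a b : measurable_fun setT (lin a b).
Proof.
by apply: measurable_funD; apply: measurable_funM.
Qed.

Lemma bmeas_cos a b : bmeas (fun p => cos (lin a b p)).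
Proof.
split; last by exists 1 => p; exact: cos_max.
have mcos : measurable_fun setT (@cos R).
  by apply: continuous_measurable_fun; exact: continuous_cos.
exact: measurableT_comp mcos (measurable_lin a b).
Qed.

Lemma bmeas_sin a b : bmeas (fun p => sin (lin a b p)).
Proof.
split; last by exists 1 => p; exact: sin_max.
have msin : measurable_fun setT (@sin R).
  by apply: continuous_measurable_fun; exact: continuous_sin.
exact: measurableT_comp msin (measurable_lin a b).
Qed.

Variables c d : R.
Hypotheses (c0 : 0 <= c) (d0 : 0 <= d).

Definition box : set (R * R) := `[-c, c] `*` `[-d, d].

Lemma measurable_box : measurable box.
Proof. exact: measurableX. Qed.

Lemma nu_box : nu box = (2 * c * (2 * d))%:E.
Proof.
have itv (x : R) : 0 <= x -> mu `[-x, x]%classic = (2 * x)%:E.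
  move=> x0; rewrite lebesgue_measure_itv/= lte_fin opprK; case: ifPn => [_|].
    by rewrite -EFinD; congr EFin; ring.
  rewrite -leNgt => h; have -> : x = 0 by lra.
  by rewrite mulr0.
rewrite /box product_measure1E//.
transitivity ((mu `[(-c)%R, c]%classic * mu `[(-d)%R, d]%classic)%E); first by [].
by rewrite !itv// -EFinM.
Qed.

Lemma bmeas_int f : bmeas f -> nu.-integrable box (EFin \o f).
Proof.
move=> [mf [M fM]]; apply: measurable_bounded_integrable.
- exact: measurable_box.
- by have := nu_box; rewrite /= => ->; rewrite ltry.
- exact: measurable_funTS.
- by exists M; split; rewrite ?num_real// => x Mx p _; apply: (le_trans (fM p)); exact: ltW.
Qed.

Definition ibox f := \int[nu]_(p in box) f p.

Lemma iboxD f g : bmeas f -> bmeas g ->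
  ibox (fun p => f p + g p) = ibox f + ibox g.
Proof. by move=> bf bg; apply: RintegralD; [exact: measurable_box|exact: bmeas_int|exact: bmeas_int]. Qed.

Lemma iboxB f g : bmeas f -> bmeas g ->
  ibox (fun p => f p - g p) = ibox f - ibox g.
Proof. by move=> bf bg; apply: RintegralB; [exact: measurable_box|exact: bmeas_int|exact: bmeas_int]. Qed.

Lemma iboxZ k f : bmeas f -> ibox (fun p => k * f p) = k * ibox f.
Proof. by move=> bf; apply: RintegralZl; [exact: measurable_box|exact: bmeas_int]. Qed.

Lemma ibox_le f g : bmeas f -> bmeas g -> (forall p, f p <= g p) -> ibox f <= ibox g.
Proof. by move=> bf bg fg; apply: le_Rintegral => [|||p _]; [exact: measurable_box|exact: bmeas_int|exact: bmeas_int|exact: fg]. Qed.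

Lemma ibox_sum (I : Type) (s : seq I) (F : I -> R * R -> R) :
  (forall i, bmeas (F i)) ->
  ibox (fun p => \sum_(i <- s) F i p) = \sum_(i <- s) ibox (F i).
Proof.
move=> bF; elim: s => [|i s IH].
  rewrite big_nil (_ : (fun _ => _) = fun=> 0 * 0); last first.
    by apply/funext => p; rewrite big_nil mulr0.
  by rewrite (iboxZ 0 (bmeas_cst 0)) mul0r.
rewrite big_cons -IH -iboxD//; last exact: bmeas_sum.
by congr ibox; apply/funext => p; rewrite big_cons.
Qed.

Lemma ibox_cst k : ibox (fun=> k) = k * (2 * c * (2 * d)).
Proof.
by rewrite /ibox Rintegral_cst; [have := nu_box => /= ->|exact: measurable_box].
Qed.

End Bounded.

Section ProductIntegral.
Context {R : realType}.
Notation mu := (@lebesgue_measure R).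
Notation nu := (mu \x mu)%E.

Lemma measurable_fst_comp (f : R -> R) : measurable_fun setT f ->
  measurable_fun setT (fun p : R * R => f p.1).
Proof. by move=> mf; apply: measurableT_comp => //; exact: measurable_fst. Qed.

Lemma measurable_snd_comp (f : R -> R) : measurable_fun setT f ->
  measurable_fun setT (fun p : R * R => f p.2).
Proof. by move=> mf; apply: measurableT_comp => //; exact: measurable_snd. Qed.

Lemma integrable_prod (a b : R -> R) :
  mu.-integrable setT (EFin \o a) -> mu.-integrable setT (EFin \o b) ->
  nu.-integrable setT (EFin \o (fun p : R * R => a p.1 * b p.2)).
Proof.
move=> ia ib.
have ma : measurable_fun setT a by apply/measurable_EFinP; exact: (measurable_int mu).
have mb : measurable_fun setT b by apply/measurable_EFinP; exact: (measurable_int mu).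
have mab : measurable_fun setT (EFin \o (fun p : R * R => a p.1 * b p.2)).
  apply/measurable_EFinP; apply: measurable_funM.
    exact: measurable_fst_comp.
  exact: measurable_snd_comp.
apply/(integrable12ltyP mu mu mab) => /=.
have /integrableP[_ fb] := ib; have /integrableP[_ fa] := ia.
have fb' : (\int[mu]_y `|(EFin \o b) y| \is a fin_num)%E.
  by rewrite ge0_fin_numE// integral_ge0.
have mnorm (f : R -> R) : measurable_fun setT f ->
    measurable_fun setT (fun y => `|(EFin \o f) y|)%E.
  by move=> mf; apply: measurableT_comp => //; exact/measurable_EFinP.
have -> : (\int[mu]_x \int[mu]_y `|(a x * b y)%:E| =
    \int[mu]_x (`|(EFin \o a) x| * \int[mu]_y `|(EFin \o b) y|))%E.
  apply: eq_integral => x _; rewrite -ge0_integralZl//; last exact: mnorm.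
  by apply: eq_integral => y _ /=; rewrite normrM EFinM.
rewrite ge0_integralZr//.
- by rewrite lte_mul_pinfty ?integral_ge0// ge0_fin_numE// integral_ge0.
- exact: mnorm.
- exact: integral_ge0.
Qed.

Lemma Rintegral_prod (a b : R -> R) :
  mu.-integrable setT (EFin \o a) -> mu.-integrable setT (EFin \o b) ->
  (\int[nu]_p (a p.1 * b p.2) = (\int[mu]_x a x) * (\int[mu]_y b y))%R.
Proof.
move=> ia ib; rewrite /Rintegral -integral12_prod_meas1; last exact: integrable_prod.
rewrite -fineM ?integrable_fin_num//; congr fine.
have Ib : (\int[mu]_y (b y)%:E)%E \is a fin_num by exact: integrable_fin_num.
rewrite -(fineK Ib) -integralZr//.
apply: eq_integral => x _; rewrite (fineK Ib) /fubini_F /=.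
by rewrite -integralZl.
Qed.

Lemma Rintegral_prod_itv (a b : R -> R) (A B : set R) : measurable A -> measurable B ->
  mu.-integrable A (EFin \o a) -> mu.-integrable B (EFin \o b) ->
  (\int[nu]_(p in A `*` B) (a p.1 * b p.2) =
    (\int[mu]_(x in A) a x) * (\int[mu]_(y in B) b y))%R.
Proof.
move=> mA mB ia ib; rewrite [RHS]/=.
rewrite Rintegral_mkcond [X in _ = X * _]Rintegral_mkcond [X in _ = _ * X]Rintegral_mkcond.
rewrite -Rintegral_prod.
- apply: eq_Rintegral => -[x y] _ /=; rewrite !patchE in_setX /=.
  by case: (x \in A); case: (y \in B); rewrite ?mulr0 ?mul0r.
- by have := (@integrable_mkcond _ _ _ mu A (EFin \o a) mA).1 ia; rewrite restrict_EFin.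
- by have := (@integrable_mkcond _ _ _ mu B (EFin \o b) mB).1 ib; rewrite restrict_EFin.
Qed.

End ProductIntegral.

(** * Orthogonality of the exponentials on the grid *)

Section TrigIntegrals.
Context {R : realType}.
Notation mu := (@lebesgue_measure R).

Lemma continuous_itv_int (f : R -> R) (c : R) : continuous f -> mu.-integrable `[-c, c] (EFin \o f).
Proof.
move=> cf; apply: continuous_compact_integrable; first exact: segment_compact.
exact: continuous_subspaceT.
Qed.

Lemma FTC_itv (f F : R -> R) (c : R) : 0 < c -> continuous f ->
  (forall x : R, is_derive x 1 F (f x)) -> \int[mu]_(x in `[-c, c]) f x = F c - F (- c).
Proof.
move=> c0 cf Ff; rewrite /Rintegral (@continuous_FTC2 _ f F)//=.
- by lra.
- exact: continuous_subspaceT.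
- have cF : continuous F.
    by move=> x; apply: differentiable_continuous; apply/derivable1_diffP; have [] := Ff x.
  split.
  + by move=> x _; have [] := Ff x.
  + by apply: cvg_at_right_filter; exact: cF.
  + by apply: cvg_at_left_filter; exact: cF.
- by move=> x _; rewrite derive1E; have [_ ->] := Ff x.
Qed.

Lemma continuous_cosM (m : R) : continuous (fun x => cos (m * x)).
Proof.
move=> x; apply: continuous_comp; last exact: continuous_cos.
by apply: continuousM; [exact: cst_continuous|exact: cvg_id].
Qed.

Lemma continuous_sinM (m : R) : continuous (fun x => sin (m * x)).
Proof.
move=> x; apply: continuous_comp; last exact: continuous_sin.
by apply: continuousM; [exact: cst_continuous|exact: cvg_id].
Qed.

Lemma sin_intpi (j : int) : sin (j%:~R * pi) = 0 :> R.
Proof.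
have nat_case (n : nat) : sin (n%:R * pi) = 0 :> R.
  elim: n => [|n IH]; first by rewrite mul0r sin0.
  by rewrite -natr1 mulrDl mul1r sinDpi IH oppr0.
case: j => n; first exact: nat_case.
by rewrite NegzE mulrNz mulNr sinN nat_case oppr0.
Qed.

Lemma int_cos (h : R) (j : int) : 0 < h ->
  \int[mu]_(x in `[-(pi / h), pi / h]) cos (j%:~R * h * x) =
  if j == 0 then 2 * (pi / h) else 0.
Proof.
move=> h0; have c0 : 0 < pi / h :> R by rewrite divr_gt0// pi_gt0.
case: eqVneq => [->|j0].
  have H (x : R) : is_derive x 1 (fun x : R => x) (cos (0%:~R * h * x)).
    by rewrite !mul0r cos0; exact: der_id.
  by rewrite (FTC_itv c0 (@continuous_cosM _) H); ring.
have m0 : j%:~R * h != 0 by rewrite mulf_neq0 ?intr_eq0// gt_eqF.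
have H (x : R) : is_derive x 1 (fun x : R => sin (j%:~R * h * x) / (j%:~R * h))
    (cos (j%:~R * h * x)).
  by derive_auto; field; move: m0; rewrite mulf_eq0 negb_or andbC.
rewrite (FTC_itv c0 (@continuous_cosM _) H).
rewrite mulrN sinN; have -> : j%:~R * h * (pi / h) = j%:~R * pi.
  by field; rewrite gt_eqF.
by rewrite sin_intpi oppr0 mul0r subrr.
Qed.

Lemma int_sin (h : R) (j : int) : 0 < h ->
  \int[mu]_(x in `[-(pi / h), pi / h]) sin (j%:~R * h * x) = 0.
Proof.
move=> h0; have c0 : 0 < pi / h :> R by rewrite divr_gt0// pi_gt0.
case: (eqVneq j 0) => [->|j0].
  have H (x : R) : is_derive x 1 (fun _ : R => 0) (sin (0%:~R * h * x)).
    by rewrite !mul0r sin0; exact: der_cst.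
  by rewrite (FTC_itv c0 (@continuous_sinM _) H) subrr.
have m0 : j%:~R * h != 0 by rewrite mulf_neq0 ?intr_eq0// gt_eqF.
have H (x : R) : is_derive x 1 (fun x : R => - cos (j%:~R * h * x) / (j%:~R * h))
    (sin (j%:~R * h * x)).
  by derive_auto; field; move: m0; rewrite mulf_eq0 negb_or andbC.
by rewrite (FTC_itv c0 (@continuous_sinM _) H) mulrN cosN subrr.
Qed.

Lemma ibox_cos (h1 h2 : R) (j k : int) : 0 < h1 -> 0 < h2 ->
  ibox (pi / h1) (pi / h2) (fun p => cos (lin (j%:~R * h1) (k%:~R * h2) p)) =
  if (j == 0) && (k == 0) then 4 * pi ^+ 2 / (h1 * h2) else 0.
Proof.
move=> h10 h20.
have c0 : 0 <= pi / h1 :> R by rewrite divr_ge0 ?pi_ge0// ltW.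
have d0 : 0 <= pi / h2 :> R by rewrite divr_ge0 ?pi_ge0// ltW.
rewrite (_ : (fun p => _) = (fun p => cos (j%:~R * h1 * p.1) * cos (k%:~R * h2 * p.2)
   - sin (j%:~R * h1 * p.1) * sin (k%:~R * h2 * p.2))); last first.
  by apply/funext => p; rewrite /lin cosD.
have fstE (a : R) : (fun p : R * R => a * p.1) = lin a 0.
  by apply/funext => p; rewrite /lin mul0r addr0.
have sndE (a : R) : (fun p : R * R => a * p.2) = lin 0 a.
  by apply/funext => p; rewrite /lin mul0r add0r.
have bc1 (a : R) : bmeas (fun p => cos (a * p.1)).
  by have := bmeas_cos a 0; congr bmeas; apply/funext => p; rewrite /lin mul0r addr0.
have bs1 (a : R) : bmeas (fun p => sin (a * p.1)).
  by have := bmeas_sin a 0; congr bmeas; apply/funext => p; rewrite /lin mul0r addr0.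
have bc2 (a : R) : bmeas (fun p => cos (a * p.2)).
  by have := bmeas_cos 0 a; congr bmeas; apply/funext => p; rewrite /lin mul0r add0r.
have bs2 (a : R) : bmeas (fun p => sin (a * p.2)).
  by have := bmeas_sin 0 a; congr bmeas; apply/funext => p; rewrite /lin mul0r add0r.
rewrite iboxB//; [|exact: bmeasM|exact: bmeasM].
rewrite /ibox /box.
rewrite (@Rintegral_prod_itv _ (fun x => cos (j%:~R * h1 * x)) (fun y => cos (k%:~R * h2 * y)))//;
  [|exact/continuous_itv_int/continuous_cosM|exact/continuous_itv_int/continuous_cosM].
rewrite (@Rintegral_prod_itv _ (fun x => sin (j%:~R * h1 * x)) (fun y => sin (k%:~R * h2 * y)))//;
  [|exact/continuous_itv_int/continuous_sinM|exact/continuous_itv_int/continuous_sinM].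
rewrite !int_cos// !int_sin// mul0r subr0.
case: eqVneq => _; case: eqVneq => _; rewrite /= ?mulr0 ?mul0r//.
by field; rewrite !gt_eqF.
Qed.

End TrigIntegrals.

(** * Grid functions as inverse Fourier integrals *)

Section SymbolClass.
Context {R : realType}.
Implicit Types F G : R * R -> R[i].

(** The symbols to which the inverse Fourier transform is applied. *)
Definition bsym F := bmeas (fun p => Re (F p)) /\ bmeas (fun p => Im (F p)).

Lemma eq_bmeas (f g : R * R -> R) : f =1 g -> bmeas f -> bmeas g.
Proof. by move=> /funext ->. Qed.

Lemma bsym_cst (z : R[i]) : bsym (fun=> z).
Proof. by split; exact: bmeas_cst. Qed.

Lemma bsymD F G : bsym F -> bsym G -> bsym (fun p => F p + G p).
Proof.
move=> [F1 F2] [G1 G2]; split.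
  by apply: eq_bmeas (bmeasD F1 G1) => p; rewrite ReD.
by apply: eq_bmeas (bmeasD F2 G2) => p; rewrite ImD.
Qed.

Lemma bsymN F : bsym F -> bsym (fun p => - F p).
Proof.
move=> [F1 F2]; split.
  by apply: eq_bmeas (bmeasN F1) => p; rewrite ReN.
by apply: eq_bmeas (bmeasN F2) => p; rewrite ImN.
Qed.

Lemma bsymB F G : bsym F -> bsym G -> bsym (fun p => F p - G p).
Proof. by move=> bF bG; apply: bsymD => //; exact: bsymN. Qed.

Lemma bsymM F G : bsym F -> bsym G -> bsym (fun p => F p * G p).
Proof.
move=> [F1 F2] [G1 G2]; split.
  by apply: eq_bmeas (bmeasB (bmeasM F1 G1) (bmeasM F2 G2)) => p; rewrite ReM.
by apply: eq_bmeas (bmeasD (bmeasM F1 G2) (bmeasM F2 G1)) => p; rewrite ImM.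
Qed.

(** Re F >= 1 keeps |F|^2, by which the conjugate is divided, above 1. *)
Lemma bsymV F : bsym F -> (forall p, 1 <= Re (F p)) -> bsym (fun p => (F p)^-1).
Proof.
move=> [F1 F2] re1.
have d := bmeasD (bmeasM F1 F1) (bmeasM F2 F2).
have n1 p : 1 <= Re (F p) * Re (F p) + Im (F p) * Im (F p).
  have h := re1 p; apply: (@le_trans _ _ (Re (F p) * Re (F p))).
    by rewrite -[1]mulr1 ler_pM.
  by rewrite lerDl -expr2 sqr_ge0.
have iv := bmeasV d.1 n1.
split.
  by apply: eq_bmeas (bmeasM F1 iv) => p; rewrite ReV !expr2.
by apply: eq_bmeas (bmeasN (bmeasM F2 iv)) => p; rewrite ImV !expr2.
Qed.

End SymbolClass.

Section GridFourier.
Context {R : realType}.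
Variables (h1 h2 : R).
Implicit Types F G : R * R -> R[i].

Definition phase (j k : int) := lin (j%:~R * h1) (k%:~R * h2) : R * R -> R.

(** The real part of F times exp (i phase).  For a symbol with
    F (- p) = conj (F p) its integral is that of the complex product, so the
    real part loses nothing. *)
Definition ker F j k p : R :=
  Re (F p) * cos (phase j k p) - Im (F p) * sin (phase j k p).

Definition ifou F : grid R := fun j k =>
  (4 * pi ^+ 2)^-1 * ibox (pi / h1) (pi / h2) (ker F j k).

Lemma bmeas_ker F j k : bsym F -> bmeas (ker F j k).
Proof.
move=> [F1 F2]; apply: bmeasB; apply: bmeasM => //; [exact: bmeas_cos|exact: bmeas_sin].
Qed.

Hypotheses (h10 : 0 < h1) (h20 : 0 < h2).

Let c0 : 0 <= pi / h1. Proof. by rewrite divr_ge0 ?pi_ge0// ltW. Qed.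
Let d0 : 0 <= pi / h2. Proof. by rewrite divr_ge0 ?pi_ge0// ltW. Qed.

(** Translating a grid function shifts the phase of the kernel, hence a finite
    difference operator multiplies the symbol; the coefficients are listed with
    their offsets. *)
Lemma ifou_comb (s : seq (R * (int * int))) F G j k : bsym F ->
  (forall p, \sum_(c <- s) c.1 * ker F (j + c.2.1) (k + c.2.2) p = ker G j k p) ->
  \sum_(c <- s) c.1 * ifou F (j + c.2.1) (k + c.2.2) = ifou G j k.
Proof.
move=> bF H; rewrite /ifou.
rewrite (_ : ker G j k = fun p => \sum_(c <- s) c.1 * ker F (j + c.2.1) (k + c.2.2) p); last first.
  by apply/funext => p; rewrite H.
rewrite ibox_sum//; last by move=> c; apply: bmeasM; [exact: bmeas_cst|exact: bmeas_ker].
rewrite mulr_sumr; apply: eq_bigr => c _.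
by rewrite iboxZ//; [ring|exact: bmeas_ker].
Qed.

Lemma ifouD F G : bsym F -> bsym G -> ifou (fun p => F p + G p) = ifou F + ifou G.
Proof.
move=> bF bG; apply/funext => j; apply/funext => k.
rewrite -[RHS]/(ifou F j k + ifou G j k) /ifou -mulrDr -iboxD//; [|exact: bmeas_ker|exact: bmeas_ker].
by congr (_ * ibox _ _ _); apply/funext => p; rewrite /ker ReD ImD; ring.
Qed.

Lemma ifouZ (a : R) F : bsym F -> ifou (fun p => a%:C * F p) = a *: ifou F.
Proof.
move=> bF; apply/funext => j; apply/funext => k.
rewrite -[RHS]/(a * ifou F j k) /ifou [RHS]mulrCA.
rewrite -[a * ibox _ _ _]iboxZ//; last exact: bmeas_ker.
by congr (_ * ibox _ _ _); apply/funext => p; rewrite /ker ReRM ImRM; ring.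
Qed.

Lemma ifouB F G : bsym F -> bsym G -> ifou (fun p => F p - G p) = ifou F - ifou G.
Proof.
move=> bF bG.
rewrite -scaleN1r -ifouZ// -ifouD//; last by apply: bsymM => //; exact: bsym_cst.
by congr ifou; apply/funext => p; rewrite rmorphN1 mulN1r.
Qed.

(** Orthogonality: the discrete Dirac mass has the constant symbol 1. *)
Lemma ifou_initial : ifou (fun=> 1) = initial_data h1 h2.
Proof.
apply/funext => j; apply/funext => k; rewrite /ifou /initial_data.
rewrite (_ : ker _ _ _ = fun p => cos (lin (j%:~R * h1) (k%:~R * h2) p)); last first.
  by apply/funext => p; rewrite /ker /= mul1r mul0r subr0.
rewrite ibox_cos//; case: ifP => _; last by rewrite mulr0.
move: (pi_gt0 R); move: (pi : R) => P P0.
by field; rewrite !gt_eqF.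
Qed.

Let area : R := 4 * pi ^+ 2 / (h1 * h2).
Let kap : R := (4 * pi ^+ 2)^-1.

(** Bessel's inequality.  Write Q for the sum of squares and t for the
    trigonometric polynomial T + i S with coefficients V x.  Pairing F with t gives
    Q = kap * integral of Re (F t), and orthogonality gives integral |t|^2 = area * Q.
    Young's inequality with parameter tau = kap * area bounds Q by
    tau^2 M / 2 + Q / 2. *)
Lemma bessel_seq F (s : seq (int * int)) M : bsym F -> uniq s ->
  (forall p, Re (F p) ^+ 2 + Im (F p) ^+ 2 <= M) ->
  \sum_(x <- s) ifou F x.1 x.2 ^+ 2 <= (kap * area) ^+ 2 * M.
Proof.
move=> bF us FM; have [F1 F2] := bF.
pose V x := ifou F x.1 x.2.
(* real and imaginary part of the trigonometric polynomial with coefficients V *)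
pose T p := \sum_(x <- s) V x * cos (phase x.1 x.2 p).
pose S p := \sum_(x <- s) V x * sin (phase x.1 x.2 p).
pose Q := \sum_(x <- s) V x ^+ 2.
have pi0 : 0 < pi ^+ 2 :> R by rewrite exprn_gt0// pi_gt0.
have area0 : 0 < area by apply: divr_gt0; [rewrite pmulr_rgt0|exact: mulr_gt0].
have kap0 : 0 < kap by rewrite invr_gt0 pmulr_rgt0.
have bT : bmeas T by apply: bmeas_sum => x; apply: bmeasM; [exact: bmeas_cst|exact: bmeas_cos].
have bS : bmeas S by apply: bmeas_sum => x; apply: bmeasM; [exact: bmeas_cst|exact: bmeas_sin].
have bRT := bmeasB (bmeasM F1 bT) (bmeasM F2 bS).
have QE : Q = kap * ibox (pi / h1) (pi / h2) (fun p => Re (F p) * T p - Im (F p) * S p).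
  rewrite (_ : (fun p => _) = fun p => \sum_(x <- s) V x * ker F x.1 x.2 p); last first.
    apply/funext => p; rewrite /T /S !mulr_sumr -sumrB; apply: eq_bigr => x _.
    by rewrite /ker; ring.
  rewrite ibox_sum//; last by move=> x; apply: bmeasM; [exact: bmeas_cst|exact: bmeas_ker].
  rewrite mulr_sumr; apply: eq_bigr => x _; rewrite iboxZ//; last exact: bmeas_ker.
  by rewrite expr2 {2}/V /ifou -/kap; ring.
have TS : ibox (pi / h1) (pi / h2) (fun p => T p * T p + S p * S p) = area * Q.
  rewrite (_ : (fun p => _) = fun p => \sum_(x <- s) \sum_(y <- s)
      (V x * V y) * cos (lin ((x.1 - y.1)%:~R * h1) ((x.2 - y.2)%:~R * h2) p)); last first.
    apply/funext => p; rewrite /T /S !mulr_suml -big_split; apply: eq_bigr => x _ /=.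
    rewrite !mulr_sumr -big_split; apply: eq_bigr => y _ /=.
    rewrite (_ : lin _ _ p = phase x.1 x.2 p - phase y.1 y.2 p); last first.
      by rewrite /phase /lin !intrD !intrN; ring.
    by rewrite cosB; ring.
  have bc x y : bmeas (fun p => (V x * V y) * cos (lin ((x.1 - y.1)%:~R * h1) ((x.2 - y.2)%:~R * h2) p)).
    by apply: bmeasM; [exact: bmeas_cst|exact: bmeas_cos].
  rewrite ibox_sum//; last by move=> x; apply: bmeas_sum => y; exact: bc.
  rewrite mulr_sumr; rewrite big_seq [RHS]big_seq; apply: eq_bigr => x xs.
  rewrite ibox_sum//.
  rewrite (bigD1_seq x)//= iboxZ//; last exact: bmeas_cos.
  rewrite ibox_cos// !subrr eqxx /= big1 ?addr0; first by rewrite -/area; ring.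
  move=> y yx; rewrite iboxZ//; last exact: bmeas_cos.
  rewrite ibox_cos//; case: ifP => [|_]; last by rewrite mulr0.
  rewrite !subr_eq0 => /andP[/eqP e1 /eqP e2].
  by move: yx; rewrite [y]surjective_pairing [x]surjective_pairing e1 e2 eqxx.
pose tau := kap * area.
have tau0 : 0 < tau by rewrite mulr_gt0.
have bFF := bmeasD (bmeasM F1 F1) (bmeasM F2 F2).
have bTT := bmeasD (bmeasM bT bT) (bmeasM bS bS).
have young : ibox (pi / h1) (pi / h2) (fun p => Re (F p) * T p - Im (F p) * S p) <=
   tau / 2 * (M * area) + (2 * tau)^-1 * (area * Q).
  have IM : ibox (pi / h1) (pi / h2) (fun p => Re (F p) * Re (F p) + Im (F p) * Im (F p)) <= M * area.
    have -> : M * area = ibox (pi / h1) (pi / h2) (fun=> M).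
      rewrite ibox_cst// /area; congr (_ * _); move: (pi : R) => P.
      by field; rewrite !gt_eqF.
    by apply: (ibox_le c0 d0 bFF (bmeas_cst M)) => p; rewrite -!expr2.
  apply: (@le_trans _ _ (ibox (pi / h1) (pi / h2) (fun p =>
     tau / 2 * (Re (F p) * Re (F p) + Im (F p) * Im (F p)) +
     (2 * tau)^-1 * (T p * T p + S p * S p)))).
    have bY : bmeas (fun p => tau / 2 * (Re (F p) * Re (F p) + Im (F p) * Im (F p)) +
        (2 * tau)^-1 * (T p * T p + S p * S p)).
      by apply: bmeasD; apply: bmeasM => //; exact: bmeas_cst.
    apply: (ibox_le c0 d0 bRT bY) => p; rewrite -subr_ge0.
    have -> : tau / 2 * (Re (F p) * Re (F p) + Im (F p) * Im (F p)) +
      (2 * tau)^-1 * (T p * T p + S p * S p) - (Re (F p) * T p - Im (F p) * S p) =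
      (2 * tau)^-1 * ((tau * Re (F p) - T p) ^+ 2 + (tau * Im (F p) + S p) ^+ 2).
      by field; rewrite gt_eqF.
    by rewrite mulr_ge0 ?addr_ge0 ?sqr_ge0// invr_ge0 mulr_ge0// ltW.
  have b1 := bmeasM (bmeas_cst (tau / 2)) bFF.
  have b2 := bmeasM (bmeas_cst (2 * tau)^-1) bTT.
  rewrite (iboxD c0 d0 b1 b2) (iboxZ c0 d0 _ bFF) (iboxZ c0 d0 _ bTT) TS lerD2r.
  by apply: ler_wpM2l => //; rewrite divr_ge0// ltW.
rewrite -/Q -/tau.
have : Q <= kap * (tau / 2 * (M * area) + (2 * tau)^-1 * (area * Q)).
  by rewrite {1}QE; apply: ler_wpM2l; [exact: ltW|exact: young].
have -> : kap * (tau / 2 * (M * area) + (2 * tau)^-1 * (area * Q)) =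
   tau ^+ 2 * M / 2 + Q / 2.
  by rewrite /tau; field; rewrite !gt_eqF.
lra.
Qed.

Lemma bsym_bounded F : bsym F -> exists M, forall p, Re (F p) ^+ 2 + Im (F p) ^+ 2 <= M.
Proof.
move=> [[_ [M HM]] [_ [L HL]]]; exists (M ^+ 2 + L ^+ 2) => p.
by apply: lerD; rewrite -real_normK ?num_real//; apply: lerX2.
Qed.

Lemma ifou_l2 F : bsym F -> in_l2 (ifou F).
Proof.
move=> bF; have [M HM] := bsym_bounded bF.
rewrite /in_l2 /summable.
apply: (@le_lt_trans _ _ ((kap * area) ^+ 2 * M)%:E); last exact: ltry.
apply: ge_ereal_sup => _ [A [finA _] <-].
rewrite fsbig_finite//=.
under eq_bigr do rewrite ger0_norm ?sqr_ge0//.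
by rewrite sumEFin lee_fin; exact: (bessel_seq bF (finmap.fset_uniq _) HM).
Qed.

End GridFourier.

(** * Uniqueness of square summable solutions of implicit equations *)

Section Telescope.
Context {R : realType}.
Implicit Types f g : int -> int -> R.

(** Summability over the grid, for curried functions of two indices. *)
Definition l1 f := summable [set: int * int] (fun p => (f p.1 p.2)%:E).
Definition shift f (a b : int) : int -> int -> R := fun j k => f (j + a) (k + b).
Definition tsum f := \esum_(p in [set: int * int]) (f p.1 p.2)%:E.

Lemma tsum_shift f a b : (forall j k, 0 <= f j k) -> tsum (shift f a b) = tsum f.
Proof.
move=> f0; rewrite /tsum /shift.
pose e (p : int * int) := (p.1 + a, p.2 + b).
have be : set_bij setT setT e.
  split=> //.
  - by move=> [x y] [x' y'] _ _ [/addIr -> /addIr ->].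
  - by move=> [x y] _; exists (x - a, y - b) => //; rewrite /e /= !subrK.
by rewrite (reindex_esum setT setT e (fun p => (f p.1 p.2)%:E) be)// => p; rewrite lee_fin.
Qed.

Lemma tsumD f g : (forall j k, 0 <= f j k) -> (forall j k, 0 <= g j k) ->
  (tsum (fun j k => f j k + g j k)%R = tsum f + tsum g)%E.
Proof.
move=> f0 g0; rewrite /tsum -esumD//.
- by move=> p _; rewrite lee_fin.
- by move=> p _; rewrite lee_fin.
Qed.

Lemma le_tsum f g : (forall j k, f j k <= g j k) -> (tsum f <= tsum g)%E.
Proof. by move=> fg; apply: le_esum => p _; rewrite lee_fin. Qed.

Lemma l1_tsum f : l1 f -> (tsum (fun j k => `|f j k|%R) < +oo)%E.
Proof. by []. Qed.

Lemma l1_le f g : (forall j k, `|f j k| <= g j k) -> l1 g -> l1 f.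
Proof.
move=> fg; apply: le_lt_trans; apply: le_esum => p _ /=; rewrite lee_fin.
exact: le_trans (fg _ _) (ler_norm _).
Qed.

Lemma l1D f g : l1 f -> l1 g -> l1 (fun j k => f j k + g j k).
Proof. by move=> lf lg; have := summableD lf lg. Qed.

Lemma l1Z c f : l1 f -> l1 (fun j k => c * f j k).
Proof.
move=> lf.
have H (n : nat) : l1 (fun j k => n%:R * `|f j k|).
  elim: n => [|n IH].
    rewrite /l1 /summable (eq_esum (b := fun=> 0%E)); last first.
      by move=> p _; rewrite mul0r abse0.
    by rewrite esum1.
  have -> : (fun j k => n.+1%:R * `|f j k|) = (fun j k => n%:R * `|f j k| + `|f j k|).
    by apply/funext => j; apply/funext => k; rewrite -natr1 mulrDl mul1r.
  apply: l1D => //.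
  by apply: le_lt_trans lf; apply: le_esum => p _; rewrite /= normr_id.
apply: l1_le (H (Num.bound `|c|)) => j k; rewrite normrM ler_wpM2r//.
by apply: ltW; rewrite archi_boundP.
Qed.

Lemma l1N f : l1 f -> l1 (fun j k => - f j k).
Proof.
move=> lf; have := l1Z (-1) lf.
by congr l1; apply/funext => j; apply/funext => k; rewrite mulN1r.
Qed.

Lemma l1_shift f a b : l1 f -> l1 (shift f a b).
Proof.
move=> lf; have := @tsum_shift (fun j k => `|f j k|) a b (fun _ _ => normr_ge0 _).
by rewrite /l1 /summable => E; move: (lf); rewrite /l1 /summable -/(tsum (fun j k => `|f j k|)) -E.
Qed.

(** The sum of a discrete divergence of summable functions is zero.  To stay
    with sums of nonnegative terms, F and G are split into positive and negative
    parts and the terms are moved to the side where their sign is positive. *)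
Lemma divergence_eq0 (a F G : int -> int -> R) : l1 F -> l1 G ->
  (forall j k, 0 <= a j k) ->
  (forall j k, a j k <= F (j + 1) k - F j k + (G j (k + 1) - G j k)) ->
  forall j k, a j k = 0.
Proof.
move=> lF lG a0 aFG.
pose P f : int -> int -> R := fun j k => Num.max (f j k) 0.
pose N f : int -> int -> R := fun j k => Num.max (- f j k) 0.
have P0 f j k : 0 <= P f j k by rewrite le_max lexx orbT.
have N0 f j k : 0 <= N f j k by rewrite le_max lexx orbT.
have PN f j k : f j k = P f j k - N f j k.
  by rewrite /P /N; case: (lerP (f j k) 0) => h; case: (lerP (- f j k) 0) => h'; lra.
have fin f : l1 f -> tsum (P f) \is a fin_num /\ tsum (N f) \is a fin_num.
  move=> lf; split; rewrite ge0_fin_numE ?esum_ge0//; try by move=> p _; rewrite lee_fin.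
  - apply: le_lt_trans (l1_tsum lf); apply: le_tsum => j k.
    by rewrite ge_max normr_ge0 ler_norm.
  - apply: le_lt_trans (l1_tsum lf); apply: le_tsum => j k.
    by rewrite ge_max normr_ge0 -normrN ler_norm.
have [fP fN] := fin _ lF; have [gP gN] := fin _ lG.
(* a + S1 <= S2 pointwise, while S1 and S2 have the same finite sum by
   translation invariance *)
pose S1 j k := P F j k + (shift (N F) 1 0 j k + (P G j k + shift (N G) 0 1 j k)).
pose S2 j k := shift (P F) 1 0 j k + (N F j k + (shift (P G) 0 1 j k + N G j k)).
have S10 j k : 0 <= S1 j k by rewrite !addr_ge0// /shift.
have sE : tsum S1 = tsum S2.
  rewrite !tsumD//; try by move=> j k; rewrite ?addr_ge0// /shift.
  by rewrite !tsum_shift.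
have S1fin : tsum S1 \is a fin_num.
  rewrite !tsumD//; try by move=> j k; rewrite ?addr_ge0// /shift.
  by rewrite !tsum_shift// !fin_numD fP fN gP gN.
have le12 : (tsum a + tsum S1 <= tsum S1)%E.
  rewrite {2}sE -tsumD//; apply: le_tsum => j k.
  have := aFG j k; rewrite (PN F) (PN F j) (PN G) (PN G j k) /S1 /S2 /shift !addr0.
  lra.
have ta : (tsum a <= 0)%E by move: le12; rewrite -leeBrDr// subee.
move=> j k; apply/eqP; rewrite eq_le a0 andbT -lee_fin; apply: le_trans ta.
rewrite /tsum -(@esum_set1 _ _ (j, k) (fun p => (a p.1 p.2)%:E)) ?lee_fin//=.
rewrite [leRHS](esumID [set (j, k)])//; last by move=> p _; rewrite lee_fin.
rewrite setTI leeDl// esum_ge0// => p _; rewrite lee_fin//.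
Qed.

End Telescope.

Section Stencil.
Context {R : realType}.
Implicit Types W : grid R.

(** The common form of s Z, s Z1 and s Z2. *)
Definition stencil (c0 c1 d1 c2 d2 : R) W : grid R := fun j k =>
  c0 * delta2x (delta2y W) j k + (c1 * deltaxx W j k + d1 * delta2x W j k)
  + (c2 * deltayy W j k + d2 * delta2y W j k).

Lemma quad_form_ge0 (c0 c1 c2 a b : R) : 0 <= c1 -> 0 <= c2 ->
  4 * c0 ^+ 2 <= c1 * c2 -> 0 <= c1 / 4 * a ^+ 2 + c2 / 4 * b ^+ 2 + c0 * (a * b).
Proof.
move=> c10 c20 h; move: c10; rewrite le_eqVlt => /predU1P[c1E|c10].
  have c00 : c0 = 0.
    apply/eqP; rewrite -sqrf_eq0 eq_le sqr_ge0 andbT.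
    by move: h; rewrite -c1E mul0r; lra.
  by rewrite -c1E c00 !mul0r add0r addr0 mulr_ge0 ?sqr_ge0// divr_ge0.
rewrite -(pmulr_rge0 _ c10).
have -> : c1 * (c1 / 4 * a ^+ 2 + c2 / 4 * b ^+ 2 + c0 * (a * b)) =
  (c1 * a / 2 + c0 * b) ^+ 2 + (c1 * c2 - 4 * c0 ^+ 2) / 4 * b ^+ 2 by field.
by rewrite addr_ge0 ?sqr_ge0// mulr_ge0 ?sqr_ge0// divr_ge0// subr_ge0.
Qed.

(** Multiplying w = (stencil at w) by w, the first-order differences give
    exact divergences, the diffusion gives a divergence minus the squares of the
    one-sided differences, and the mixed term gives a divergence minus
    c0 (e - wm) (n - s).  Averaged over opposite sides, the squares dominate this
    product by [quad_form_ge0].  The letters are compass points around w, except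
    that wm is the western neighbour. *)
Lemma stencil_energy (c0 c1 d1 c2 d2 w e wm n s ne se nw sw : R) :
  0 <= c1 -> 0 <= c2 -> 4 * c0 ^+ 2 <= c1 * c2 ->
  w = c0 * ((ne - se) - (nw - sw)) + (c1 * (wm - 2 * w + e) + d1 * (e - wm))
     + (c2 * (s - 2 * w + n) + d2 * (n - s)) ->
  w ^+ 2 <= (c1 * (e * (e - w)) + d1 * (e * w) + c0 * (w * (ne - se) + e * (n - s))
       - c1 / 2 * (e - w) ^+ 2)
    - (c1 * (w * (w - wm)) + d1 * (w * wm) + c0 * (wm * (n - s) + w * (nw - sw))
       - c1 / 2 * (w - wm) ^+ 2)
    + ((c2 * (n * (n - w)) + d2 * (n * w) - c2 / 2 * (n - w) ^+ 2)
    - (c2 * (w * (w - s)) + d2 * (w * s) - c2 / 2 * (w - s) ^+ 2)).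
Proof.
move=> c10 c20 h wE.
have Q := @quad_form_ge0 c0 c1 c2 (e - wm) (n - s) c10 c20 h.
have q1 : 0 <= c1 / 4 * ((e - w) - (w - wm)) ^+ 2.
  by rewrite mulr_ge0// ?sqr_ge0// divr_ge0.
have q2 : 0 <= c2 / 4 * ((n - w) - (w - s)) ^+ 2.
  by rewrite mulr_ge0// ?sqr_ge0// divr_ge0.
rewrite expr2 {2}wE; move: Q q1 q2; clear wE h; lra.
Qed.

Lemma l1_mul_shift W (a b a' b' : int) : in_l2 W ->
  l1 (fun j k => W (j + a) (k + b) * W (j + a') (k + b')).
Proof.
move=> lW.
have H (x y : int) : l1 (fun j k => W (j + x) (k + y) ^+ 2) by exact: (@l1_shift _ (fun j k => W j k ^+ 2) x y lW).
apply: l1_le (l1D (H a b) (H a' b')) => j k; rewrite normrM.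
set u := W _ _; set v := W (j + a') _.
rewrite -[u ^+ 2]real_normK ?num_real// -[v ^+ 2]real_normK ?num_real//.
have := sqr_ge0 (`|u| - `|v|); have := sqr_ge0 (`|u| + `|v|); lra.
Qed.

Lemma stencil_unique (c0 c1 d1 c2 d2 : R) W :
  0 <= c1 -> 0 <= c2 -> 4 * c0 ^+ 2 <= c1 * c2 ->
  in_l2 W -> W = stencil c0 c1 d1 c2 d2 W -> W = 0.
Proof.
move=> c10 c20 h lW WE.
(* the fluxes of the energy inequality through the west and south faces *)
pose F j k := c1 * (W j k * (W j k - W (j - 1) k)) + d1 * (W j k * W (j - 1) k)
  + c0 * (W (j - 1) k * (W j (k + 1) - W j (k - 1))
          + W j k * (W (j - 1) (k + 1) - W (j - 1) (k - 1)))
  - c1 / 2 * (W j k - W (j - 1) k) ^+ 2.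
pose G j k := c2 * (W j k * (W j k - W j (k - 1))) + d2 * (W j k * W j (k - 1))
  - c2 / 2 * (W j k - W j (k - 1)) ^+ 2.
have P a b a' b' := l1_mul_shift a b a' b' lW.
have lF : l1 F.
  have := l1D (l1D (l1Z (c1 / 2) (l1D (P 0 0 0 0) (l1N (P (-1) 0 (-1) 0)))) (l1Z d1 (P 0 0 (-1) 0)))
    (l1Z c0 (l1D (l1D (P (-1) 0 0 1) (l1N (P (-1) 0 0 (-1))))
                 (l1D (P 0 0 (-1) 1) (l1N (P 0 0 (-1) (-1)))))).
  by congr l1; apply/funext => j; apply/funext => k; rewrite /F !addr0; field.
have lG : l1 G.
  have := l1D (l1Z (c2 / 2) (l1D (P 0 0 0 0) (l1N (P 0 (-1) 0 (-1))))) (l1Z d2 (P 0 0 0 (-1))).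
  by congr l1; apply/funext => j; apply/funext => k; rewrite /G !addr0; field.
have W2 : forall j k, W j k ^+ 2 = 0.
  apply: (divergence_eq0 lF lG) => [j k|j k]; first exact: sqr_ge0.
  have := @stencil_energy c0 c1 d1 c2 d2 (W j k) (W (j + 1) k) (W (j - 1) k)
    (W j (k + 1)) (W j (k - 1)) (W (j + 1) (k + 1)) (W (j + 1) (k - 1))
    (W (j - 1) (k + 1)) (W (j - 1) (k - 1)) c10 c20 h.
  rewrite /F /G !addrK; apply.
  by rewrite {1}WE /stencil /delta2x /delta2y /deltaxx /deltayy.
apply/funext => j; apply/funext => k.
by have /eqP := W2 j k; rewrite sqrf_eq0 => /eqP.
Qed.

End Stencil.

(** * The scheme in Fourier space *)

Section Operators.
Context {R : realType}.
Variables (h1 h2 : R).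
Hypotheses (h10 : 0 < h1) (h20 : 0 < h2).
Implicit Types F : R * R -> R[i].

Lemma bsym_sym1_fst (dt a h : R) : bsym (fun p : R * R => sym1 dt a h p.1).
Proof.
have bc := bmeas_cos h 0; have bs := bmeas_sin h 0.
split.
  apply: eq_bmeas (bmeasM (bmeas_cst dt) (bmeasM (bmeas_cst (h ^+ 2)^-1)
    (bmeasB (bmeasM (bmeas_cst 2) bc) (bmeas_cst 2)))) => p.
  by rewrite /sym1 /lin mul0r addr0.
apply: eq_bmeas (bmeasM (bmeas_cst dt) (bmeasM (bmeas_cst (a / h)) bs)) => p.
by rewrite /sym1 /lin mul0r addr0.
Qed.

Lemma bsym_sym1_snd (dt a h : R) : bsym (fun p : R * R => sym1 dt a h p.2).
Proof.
have bc := bmeas_cos 0 h; have bs := bmeas_sin 0 h.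
split.
  apply: eq_bmeas (bmeasM (bmeas_cst dt) (bmeasM (bmeas_cst (h ^+ 2)^-1)
    (bmeasB (bmeasM (bmeas_cst 2) bc) (bmeas_cst 2)))) => p.
  by rewrite /sym1 /lin mul0r add0r.
apply: eq_bmeas (bmeasM (bmeas_cst dt) (bmeasM (bmeas_cst (a / h)) bs)) => p.
by rewrite /sym1 /lin mul0r add0r.
Qed.

Lemma bsym_sym0 (rho dt : R) : bsym (fun p : R * R => sym0 rho dt h1 h2 p.1 p.2).
Proof.
have b1 := bmeas_sin h1 0; have b2 := bmeas_sin 0 h2.
split; last exact: bmeas_cst.
apply: eq_bmeas (bmeasN (bmeasM (bmeas_cst (2 * rho * dt / (h1 * h2))) (bmeasM b1 b2))) => p.
by rewrite /sym0 /lin !mul0r addr0 add0r.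
Qed.

(** Rewriting rules for the phase at the four neighbours. *)
Lemma phase1E (j k : int) p :
  (phase h1 h2 (j + 1) k p = phase h1 h2 j k p + h1 * p.1) *
  (phase h1 h2 (j - 1) k p = phase h1 h2 j k p - h1 * p.1) *
  (phase h1 h2 j (k + 1) p = phase h1 h2 j k p + h2 * p.2) *
  (phase h1 h2 j (k - 1) p = phase h1 h2 j k p - h2 * p.2).
Proof. by rewrite /phase /lin !intrD !mulrN1z; do !split; ring. Qed.

Lemma scale_A1 (dt a : R) F : bsym F ->
  dt *: A1 a h1 (ifou h1 h2 F) = ifou h1 h2 (fun p => sym1 dt a h1 p.1 * F p).
Proof.
move=> bF; apply/funext => j; apply/funext => k.
pose s : seq (R * (int * int)) := [:: (dt / h1 ^+ 2, (-1, 0)); (- (2 * dt / h1 ^+ 2), (0, 0));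
   (dt / h1 ^+ 2, (1, 0)); (dt * a / (2 * h1), (1, 0)); (- (dt * a / (2 * h1)), (-1, 0))].
rewrite -(@ifou_comb _ _ _ h10 h20 s F)//.
  rewrite /s !big_cons big_nil /= !addr0.
  rewrite -[LHS]/(dt * A1 a h1 (ifou h1 h2 F) j k) /A1 /deltaxx /delta2x.
  by field; rewrite gt_eqF.
move=> p; rewrite /s !big_cons big_nil /= !addr0 /ker !phase1E; move: (phase h1 h2 j k p) => f; rewrite ReM ImM /sym1 /=.
rewrite !cosD !sinD cosN sinN.
set x := cos _; set y := sin _; set co := cos _; set si := sin _.
by field; rewrite gt_eqF.
Qed.

Lemma scale_A2 (dt a : R) F : bsym F ->
  dt *: A2 a h2 (ifou h1 h2 F) = ifou h1 h2 (fun p => sym1 dt a h2 p.2 * F p).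
Proof.
move=> bF; apply/funext => j; apply/funext => k.
pose s : seq (R * (int * int)) := [:: (dt / h2 ^+ 2, (0, -1)); (- (2 * dt / h2 ^+ 2), (0, 0));
   (dt / h2 ^+ 2, (0, 1)); (dt * a / (2 * h2), (0, 1)); (- (dt * a / (2 * h2)), (0, -1))].
rewrite -(@ifou_comb _ _ _ h10 h20 s F)//.
  rewrite /s !big_cons big_nil /= !addr0.
  rewrite -[LHS]/(dt * A2 a h2 (ifou h1 h2 F) j k) /A2 /deltayy /delta2y.
  by field; rewrite gt_eqF.
move=> p; rewrite /s !big_cons big_nil /= !addr0 /ker !phase1E; move: (phase h1 h2 j k p) => f; rewrite ReM ImM /sym1 /=.
rewrite !cosD !sinD cosN sinN.
set x := cos _; set y := sin _; set co := cos _; set si := sin _.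
by field; rewrite gt_eqF.
Qed.

Lemma scale_A0 (dt rho : R) F : bsym F ->
  dt *: A0 rho h1 h2 (ifou h1 h2 F) = ifou h1 h2 (fun p => sym0 rho dt h1 h2 p.1 p.2 * F p).
Proof.
move=> bF; apply/funext => j; apply/funext => k.
pose q := rho * dt / (2 * h1 * h2).
pose s : seq (R * (int * int)) := [:: (q, (1, 1)); (q, (-1, -1)); (- q, (1, -1)); (- q, (-1, 1))].
rewrite -(@ifou_comb _ _ _ h10 h20 s F)//.
  rewrite /s !big_cons big_nil /= !addr0.
  rewrite -[LHS]/(dt * A0 rho h1 h2 (ifou h1 h2 F) j k) /A0 /delta2x /delta2y /q.
  by field; rewrite !gt_eqF.
move=> p; rewrite /s !big_cons big_nil /= !addr0 /ker !phase1E; move: (phase h1 h2 j k p) => f; rewrite ReM ImM /sym0 /=.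
rewrite !(cosD, sinD, cosN, sinN) /q.
set x := cos _; set y := sin _; set co := cos _; set si := sin _.
set x' := cos _; set y' := sin _.
by field; rewrite !gt_eqF.
Qed.

Lemma scale_A (dt rho a1 a2 : R) F : bsym F ->
  dt *: (A0 rho h1 h2 (ifou h1 h2 F) + A1 a1 h1 (ifou h1 h2 F) + A2 a2 h2 (ifou h1 h2 F)) =
  ifou h1 h2 (fun p => symz rho a1 a2 dt h1 h2 p.1 p.2 * F p).
Proof.
move=> bF; rewrite 2!scalerDr scale_A0// scale_A1// scale_A2//.
have b0 := bsymM (bsym_sym0 rho dt) bF.
have b1 := bsymM (bsym_sym1_fst dt a1 h1) bF.
have b2 := bsymM (bsym_sym1_snd dt a2 h2) bF.
rewrite -ifouD// -ifouD//; last exact: bsymD.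
by congr ifou; apply/funext => p; rewrite /symz; ring.
Qed.

Lemma in_l2B (V W : grid R) : in_l2 V -> in_l2 W -> in_l2 (V - W).
Proof.
move=> lV lW.
have lg : l1 (fun j k => 2 * (V j k ^+ 2 + W j k ^+ 2)).
  exact: (l1Z 2 (@l1D _ (fun j k => V j k ^+ 2) (fun j k => W j k ^+ 2) lV lW)).
apply: (@l1_le _ (fun j k => (V - W) j k ^+ 2) _ _ lg).
move=> j k; rewrite -[(V - W) j k]/(V j k - W j k) ger0_norm ?sqr_ge0//.
have := sqr_ge0 (V j k + W j k); lra.
Qed.

(** The quotient F / (1 - s S) is the symbol of a solution in l^2, and there
    is only one solution. *)
Lemma implicit_solveE (s : R) (B : grid R -> grid R) (S F : R * R -> R[i]) :
  (forall V W, B (V - W) = B V - B W) ->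
  (forall G, bsym G -> B (ifou h1 h2 G) = ifou h1 h2 (fun p => S p * G p)) ->
  (forall W, in_l2 W -> W = s *: B W -> W = 0) ->
  bsym S -> (forall p, 1 <= Re (1 - s%:C * S p)) -> bsym F ->
  implicit_solve s B (ifou h1 h2 F) = ifou h1 h2 (fun p => F p / (1 - s%:C * S p)) /\
  bsym (fun p => F p / (1 - s%:C * S p)).
Proof.
move=> Bsub BS uni bS re1 bF.
have bs : bsym (fun p => s%:C * S p) by apply: bsymM => //; exact: bsym_cst.
have bG : bsym (fun p => F p / (1 - s%:C * S p)).
  apply: bsymM => //; apply: bsymV => //; apply: bsymB => //; exact: bsym_cst.
split => //.
apply: xget_unique.
  split; first exact: ifou_l2.
  rewrite BS// -ifouZ//; last exact: bsymM.
  rewrite -ifouB//; last by apply: bsymM; [exact: bsym_cst|exact: bsymM].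
  congr ifou; apply/funext => p.
  have n0 := Re_ge1_neq0 (re1 p).
  by field.
move=> W [lW WE].
set U := ifou _ _ _.
have UE : U - s *: B U = ifou h1 h2 F.
  rewrite /U BS// -ifouZ//; last exact: bsymM.
  rewrite -ifouB//; last by apply: bsymM; [exact: bsym_cst|exact: bsymM].
  congr ifou; apply/funext => p.
  have n0 := Re_ge1_neq0 (re1 p).
  by field.
apply/eqP; rewrite -subr_eq0; apply/eqP; apply: uni.
  by apply: in_l2B => //; exact: ifou_l2.
rewrite Bsub scalerBr; apply/eqP; rewrite -subr_eq0; apply/eqP.
have -> : W - U - (s *: B W - s *: B U) = (W - s *: B W) - (U - s *: B U).
  by rewrite !opprB !addrA addrAC [LHS]addrAC -!addrA; congr (_ + _); rewrite addrCA [RHS]addrC -!addrA; congr (_ + _); rewrite addrC.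
by rewrite WE UE subrr.
Qed.

End Operators.

Section Scheme.
Context {R : realType}.
Implicit Types V W : grid R.

Lemma A1_unique (s dt a h : R) W : 0 <= s -> 0 <= dt -> in_l2 W ->
  W = s *: (dt *: A1 a h W) -> W = 0.
Proof.
move=> s0 dt0 lW WE.
apply: (@stencil_unique _ 0 (s * dt / h ^+ 2) (s * dt * a / (2 * h)) 0 0) => //.
- by rewrite divr_ge0 ?sqr_ge0// mulr_ge0.
- by rewrite expr0n/= !mulr0.
rewrite {1}WE; apply/funext => j; apply/funext => k.
rewrite -[LHS]/(s * (dt * A1 a h W j k)) /A1 /stencil.
by rewrite invfM !mul0r; ring.
Qed.

Lemma A2_unique (s dt a h : R) W : 0 <= s -> 0 <= dt -> in_l2 W ->
  W = s *: (dt *: A2 a h W) -> W = 0.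
Proof.
move=> s0 dt0 lW WE.
apply: (@stencil_unique _ 0 0 0 (s * dt / h ^+ 2) (s * dt * a / (2 * h))) => //.
- by rewrite divr_ge0 ?sqr_ge0// mulr_ge0.
- by rewrite expr0n/= mulr0 mul0r.
rewrite {1}WE; apply/funext => j; apply/funext => k.
rewrite -[LHS]/(s * (dt * A2 a h W j k)) /A2 /stencil.
by rewrite invfM !mul0r; ring.
Qed.

(** For the stencil of s Z the condition 4 c0^2 <= c1 c2 reads rho^2 <= 1. *)
Lemma A_unique (s dt rho a1 a2 h1 h2 : R) W : 0 <= s -> 0 <= dt -> `|rho| <= 1 ->
  h1 != 0 -> h2 != 0 -> in_l2 W ->
  W = s *: (dt *: (A0 rho h1 h2 W + A1 a1 h1 W + A2 a2 h2 W)) -> W = 0.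
Proof.
move=> s0 dt0 r1 h10 h20 lW WE.
apply: (@stencil_unique _ (s * dt * (rho / (2 * h1 * h2)))
   (s * dt / h1 ^+ 2) (s * dt * a1 / (2 * h1)) (s * dt / h2 ^+ 2) (s * dt * a2 / (2 * h2))) => //.
- by rewrite divr_ge0 ?sqr_ge0// mulr_ge0.
- by rewrite divr_ge0 ?sqr_ge0// mulr_ge0.
- have -> : 4 * (s * dt * (rho / (2 * h1 * h2))) ^+ 2 =
    (s * dt / h1 ^+ 2) * (s * dt / h2 ^+ 2) * rho ^+ 2 by field; rewrite h10 h20.
  have r2 : rho ^+ 2 <= 1.
    by rewrite -real_normK ?num_real//; apply: exprn_ile1.
  by rewrite ler_piMr// mulr_ge0// divr_ge0 ?sqr_ge0// mulr_ge0.
rewrite {1}WE; apply/funext => j; apply/funext => k.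
rewrite -[LHS]/(s * (dt * (A0 rho h1 h2 W j k + A1 a1 h1 W j k + A2 a2 h2 W j k))).
by rewrite /A0 /A1 /A2 /stencil !invfM; ring.
Qed.

Variables (rho a1 a2 theta dt h1 h2 : R).
Hypotheses (r1 : `|rho| <= 1) (th0 : 0 <= theta) (dt0 : 0 <= dt)
  (h10 : 0 < h1) (h20 : 0 < h2).

Let Z0 V := dt *: A0 rho h1 h2 V.
Let Z1 V := dt *: A1 a1 h1 V.
Let Z2 V := dt *: A2 a2 h2 V.
Let Z V := dt *: (A0 rho h1 h2 V + A1 a1 h1 V + A2 a2 h2 V).

Let z0 (p : R * R) := sym0 rho dt h1 h2 p.1 p.2.
Let z1 (p : R * R) := sym1 dt a1 h1 p.1.
Let z2 (p : R * R) := sym1 dt a2 h2 p.2.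
Let z (p : R * R) := symz rho a1 a2 dt h1 h2 p.1 p.2.

Let bz0 : bsym z0. Proof. exact: bsym_sym0. Qed.
Let bz1 : bsym z1. Proof. exact: bsym_sym1_fst. Qed.
Let bz2 : bsym z2. Proof. exact: bsym_sym1_snd. Qed.
Let bz : bsym z. Proof. by apply: bsymD => //; exact: bsymD. Qed.

Let re1 p : 1 <= Re (1 - theta%:C * z1 p).
Proof.
rewrite ReD ReN ReRM lerDl oppr_ge0 mulr_ge0_le0//.
by rewrite Re_sym1_le0// gt_eqF.
Qed.

Let re2 p : 1 <= Re (1 - theta%:C * z2 p).
Proof.
rewrite ReD ReN ReRM lerDl oppr_ge0 mulr_ge0_le0//.
by rewrite Re_sym1_le0// gt_eqF.
Qed.

Let rez p : 1 <= Re (1 - (2^-1)%:C * z p).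
Proof.
rewrite ReD ReN ReRM lerDl oppr_ge0 mulr_ge0_le0//.
apply: le_trans (Re_symz_le a1 a2 _ _ r1 dt0 _ _) _; rewrite ?gt_eqF//.
rewrite mulNr oppr_le0; apply: mulr_ge0; first by rewrite subr_ge0.
by rewrite addr_ge0 ?sqr_ge0.
Qed.

Let solve1 F : bsym F ->
  implicit_solve theta Z1 (ifou h1 h2 F) = ifou h1 h2 (fun p => F p / (1 - theta%:C * z1 p)) /\
  bsym (fun p => F p / (1 - theta%:C * z1 p)).
Proof.
move=> bF; apply: implicit_solveE => //.
- move=> V W; apply/funext => j; apply/funext => k.
  rewrite -[LHS]/(dt * A1 a1 h1 (V - W) j k) -[RHS]/(dt * A1 a1 h1 V j k - dt * A1 a1 h1 W j k).
  rewrite /A1 /deltaxx /delta2x.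
  rewrite -[(V - W) (j - 1) k]/(V (j - 1) k - W (j - 1) k) -[(V - W) (j + 1) k]/(V (j + 1) k - W (j + 1) k).
  by rewrite -[(V - W) j k]/(V j k - W j k); ring.
- by move=> G bG; exact: scale_A1.
- by move=> W; exact: A1_unique.
Qed.

Let solve2 F : bsym F ->
  implicit_solve theta Z2 (ifou h1 h2 F) = ifou h1 h2 (fun p => F p / (1 - theta%:C * z2 p)) /\
  bsym (fun p => F p / (1 - theta%:C * z2 p)).
Proof.
move=> bF; apply: implicit_solveE => //.
- move=> V W; apply/funext => j; apply/funext => k.
  rewrite -[LHS]/(dt * A2 a2 h2 (V - W) j k) -[RHS]/(dt * A2 a2 h2 V j k - dt * A2 a2 h2 W j k).
  rewrite /A2 /deltayy /delta2y.
  rewrite -[(V - W) j (k - 1)]/(V j (k - 1) - W j (k - 1)) -[(V - W) j (k + 1)]/(V j (k + 1) - W j (k + 1)).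
  by rewrite -[(V - W) j k]/(V j k - W j k); ring.
- by move=> G bG; exact: scale_A2.
- by move=> W; exact: A2_unique.
Qed.

Let solvez F : bsym F ->
  implicit_solve 2^-1 Z (ifou h1 h2 F) = ifou h1 h2 (fun p => F p / (1 - (2^-1)%:C * z p)) /\
  bsym (fun p => F p / (1 - (2^-1)%:C * z p)).
Proof.
move=> bF; apply: implicit_solveE => //.
- move=> V W; apply/funext => j; apply/funext => k.
  rewrite -[LHS]/(dt * (A0 rho h1 h2 (V - W) j k + A1 a1 h1 (V - W) j k + A2 a2 h2 (V - W) j k)).
  rewrite -[RHS]/(dt * (A0 rho h1 h2 V j k + A1 a1 h1 V j k + A2 a2 h2 V j k) -
     dt * (A0 rho h1 h2 W j k + A1 a1 h1 W j k + A2 a2 h2 W j k)).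
  have sub (x y : int) : (V - W) x y = V x y - W x y by [].
  by rewrite /A0 /A1 /A2 /delta2x /delta2y /deltaxx /deltayy !sub; ring.
- by move=> G bG; exact: scale_A.
- by move=> W; apply: A_unique; rewrite ?gt_eqF.
Qed.

Lemma rannacher_stepE F : bsym F ->
  rannacher_step Z (ifou h1 h2 F) =
    ifou h1 h2 (fun p => eulerz rho a1 a2 dt h1 h2 p.1 p.2 ^+ 2 * F p) /\
  bsym (fun p => eulerz rho a1 a2 dt h1 h2 p.1 p.2 ^+ 2 * F p).
Proof.
move=> bF; have [E1 b1] := solvez bF; have [E2 b2] := solvez b1.
have FE : (fun p => F p / (1 - (2^-1)%:C * z p) / (1 - (2^-1)%:C * z p)) =
   (fun p => eulerz rho a1 a2 dt h1 h2 p.1 p.2 ^+ 2 * F p).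
  apply/funext => p; rewrite /eulerz -/(z p) fmorphV rmorph_nat [2^-1 * _]mulrC; ring.
by rewrite /rannacher_step E1 E2; split; rewrite -FE.
Qed.

(** All intermediate stages are carried along as symbols; the final symbol is
    simplified to the amplification factor by field arithmetic. *)
Lemma mcs_stepE F : bsym F ->
  mcs_step theta Z0 Z1 Z2 Z (ifou h1 h2 F) =
    ifou h1 h2 (fun p => mcsz rho a1 a2 theta dt h1 h2 p.1 p.2 * F p) /\
  bsym (fun p => mcsz rho a1 a2 theta dt h1 h2 p.1 p.2 * F p).
Proof.
move=> bF.
have sZ0 G : bsym G -> Z0 (ifou h1 h2 G) = ifou h1 h2 (fun p => z0 p * G p) by exact: scale_A0.
have sZ1 G : bsym G -> Z1 (ifou h1 h2 G) = ifou h1 h2 (fun p => z1 p * G p) by exact: scale_A1.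
have sZ2 G : bsym G -> Z2 (ifou h1 h2 G) = ifou h1 h2 (fun p => z2 p * G p) by exact: scale_A2.
have sZ G : bsym G -> Z (ifou h1 h2 G) = ifou h1 h2 (fun p => z p * G p) by exact: scale_A.
have bc := @bsym_cst R.
have bzF := bsymM bz bF; have bz1F := bsymM bz1 bF; have bz2F := bsymM bz2 bF.
have bz0F := bsymM bz0 bF.
have tz1 := bsymM (bc theta%:C) bz1F; have tz2 := bsymM (bc theta%:C) bz2F.
have Z1F : theta *: Z1 (ifou h1 h2 F) = ifou h1 h2 (fun p => theta%:C * (z1 p * F p)).
  by rewrite sZ1// -ifouZ.
have Z2F : theta *: Z2 (ifou h1 h2 F) = ifou h1 h2 (fun p => theta%:C * (z2 p * F p)).
  by rewrite sZ2// -ifouZ.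
have Y0 : ifou h1 h2 F + Z (ifou h1 h2 F) = ifou h1 h2 (fun p => F p + z p * F p).
  by rewrite sZ// ifouD.
have b0 := bsymD bF bzF.
have [Y1 b1] := solve1 (bsymB b0 tz1).
have [Y2 b2] := solve2 (bsymB b1 tz2).
have W0 := bsymM (bc theta%:C) (bsymM bz0 b2); have W0' := bsymM (bc theta%:C) bz0F.
have W := bsymM (bc (2^-1 - theta)%:C) (bsymM bz b2); have W' := bsymM (bc (2^-1 - theta)%:C) bzF.
have bh := bsymB (bsymD b0 W0) W0'.
have bt0 := bsymB (bsymD bh W) W'.
have [Y3 b3] := solve1 (bsymB bt0 tz1).
have [Y4 b4] := solve2 (bsymB b3 tz2).
have FE : (fun p => ((F p + z p * F p + theta%:C * (z0 p *
      (((F p + z p * F p - theta%:C * (z1 p * F p)) / (1 - theta%:C * z1 p) -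
        theta%:C * (z2 p * F p)) / (1 - theta%:C * z2 p))) - theta%:C * (z0 p * F p) +
      (2^-1 - theta)%:C * (z p *
      (((F p + z p * F p - theta%:C * (z1 p * F p)) / (1 - theta%:C * z1 p) -
        theta%:C * (z2 p * F p)) / (1 - theta%:C * z2 p))) - (2^-1 - theta)%:C * (z p * F p)
      - theta%:C * (z1 p * F p)) / (1 - theta%:C * z1 p) - theta%:C * (z2 p * F p)) /
      (1 - theta%:C * z2 p)) =
    (fun p => mcsz rho a1 a2 theta dt h1 h2 p.1 p.2 * F p).
  apply/funext => p; have n1 := Re_ge1_neq0 (re1 p); have n2 := Re_ge1_neq0 (re2 p).
  have -> : z p = z0 p + z1 p + z2 p by [].
  rewrite /mcsz /mcs_factor -/(z0 p) -/(z1 p) -/(z2 p).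
  have -> : (2^-1 - theta)%:C = 2^-1 - theta%:C :> R[i].
    by rewrite rmorphB fmorphV rmorph_nat.
  move: n1 n2; move: (z0 p) (z1 p) (z2 p) (F p) (theta%:C) => x0 x1 x2 f t n1 n2.
  by field; rewrite n1 n2.
split; last by rewrite -FE.
rewrite -FE /mcs_step Y0 Z1F -(ifouB h10 h20 b0 tz1) Y1 Z2F -(ifouB h10 h20 b1 tz2) Y2.
rewrite !sZ0// !sZ//.
rewrite -(ifouZ h10 h20 theta (bsymM bz0 b2)) -(ifouZ h10 h20 theta bz0F).
rewrite -(ifouZ h10 h20 (2^-1 - theta) (bsymM bz b2)) -(ifouZ h10 h20 (2^-1 - theta) bzF).
rewrite -(ifouD h10 h20 b0 W0) -(ifouB h10 h20 (bsymD b0 W0) W0').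
rewrite -(ifouD h10 h20 bh W) -(ifouB h10 h20 (bsymD bh W) W').
by rewrite -(ifouB h10 h20 bt0 tz1) Y3 -(ifouB h10 h20 b3 tz2) Y4.
Qed.

Lemma numerical_solutionE (N0 n : nat) :
  let G (p : R * R) := mcsz rho a1 a2 theta dt h1 h2 p.1 p.2 ^+ (n - N0) *
    (eulerz rho a1 a2 dt h1 h2 p.1 p.2 ^+ 2) ^+ minn n N0 in
  numerical_solution rho a1 a2 theta dt h1 h2 N0 n = ifou h1 h2 G /\ bsym G.
Proof.
elim: n => [|n [IH bG]] /=.
  rewrite (_ : (fun p => _) = fun=> 1).
    by split; [rewrite ifou_initial|exact: bsym_cst].
  by apply/funext => p; rewrite min0n sub0n !expr0 mulr1.
rewrite IH; case: ifP => nN0.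
  have [E b] := rannacher_stepE bG.
  rewrite [X in _ = ifou _ _ X /\ bsym X](_ : _ = (fun p =>
    eulerz rho a1 a2 dt h1 h2 p.1 p.2 ^+ 2 *
    (mcsz rho a1 a2 theta dt h1 h2 p.1 p.2 ^+ (n - N0) *
    (eulerz rho a1 a2 dt h1 h2 p.1 p.2 ^+ 2) ^+ minn n N0))); first by split; [exact: E|].
  apply/funext => p.
  have -> : (n.+1 - N0 = 0)%N by lia.
  have -> : (n - N0 = 0)%N by lia.
  have -> : minn n.+1 N0 = (minn n N0).+1 by lia.
  by rewrite expr0 !mul1r -exprS.
have [E b] := mcs_stepE bG.
rewrite [X in _ = ifou _ _ X /\ bsym X](_ : _ = (fun p =>
  mcsz rho a1 a2 theta dt h1 h2 p.1 p.2 *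
  (mcsz rho a1 a2 theta dt h1 h2 p.1 p.2 ^+ (n - N0) *
  (eulerz rho a1 a2 dt h1 h2 p.1 p.2 ^+ 2) ^+ minn n N0))); first by split; [exact: E|].
apply/funext => p.
have -> : (n.+1 - N0 = (n - N0).+1)%N by lia.
have -> : minn n.+1 N0 = minn n N0 by lia.
by rewrite exprS mulrA.
Qed.

End Scheme.

(** * Fourier transform of a Gaussian *)

Section GaussianFourier.
Context {R : realType}.
Notation mu := (@lebesgue_measure R).

(** The integral over [- n, n] is F n - F (- n), which is O(1 / n). *)
Lemma Rintegral_derive0 (F f : R -> R) (C : R) :
  (forall x : R, is_derive x 1 F (f x)) -> continuous f ->
  mu.-integrable setT (EFin \o f) -> (forall x, `|x| * `|F x| <= C) ->
  \int[mu]_x f x = 0.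
Proof.
move=> Ff cf intf FC.
pose I (n : nat) : set R := `[- (n.+1%:R : R), n.+1%:R]%classic.
have mI n : measurable (I n) by exact: measurable_itv.
have mf : measurable_fun setT f by exact: continuous_measurable_fun.
have uE n : \int[mu]_x (f \_ (I n)) x = F n.+1%:R - F (- n.+1%:R).
  by rewrite -Rintegral_mkcond; apply: FTC_itv.
have cv : (\int[mu]_x ((f \_ (I n)) x)%:E)%E @[n --> \oo] --> (\int[mu]_x (f x)%:E)%E.
  apply: (@dominated_cvg _ _ _ mu setT _ (fun n x => ((f \_ (I n)) x)%:E) _ (fun x => `|(f x)%:E|%E)) => //.
  - move=> n; apply/measurable_EFinP; apply/(measurable_restrictT f (mI n)).
    exact: measurable_funTS.
  - move=> x _; apply: cvg_near_cst; near=> n.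
    rewrite patchE mem_set// /I /= in_itv /= -ler_norml.
    have h : (Num.bound `|x| <= n)%N by near: n; exact: nbhs_infty_ge.
    have := archi_boundP (normr_ge0 x) => /ltW /le_trans; apply.
    by rewrite ler_nat (leq_trans h).
  - exact: integrable_norm.
  - move=> n x _; rewrite patchE; case: ifP => // _.
    by rewrite abse0 abse_ge0.
have fi : (\int[mu]_x (f x)%:E)%E \is a fin_num by exact: integrable_fin_num.
have cv' : (fun n => F n.+1%:R - F (- n.+1%:R)) @ \oo --> \int[mu]_x f x.
  rewrite (_ : (fun n => _) = (fun n => \int[mu]_x (f \_ (I n)) x)).
    by apply: fine_cvg; rewrite /Rintegral fineK.
  by apply/funext => n; rewrite uE.
have cv0 : (fun n => F n.+1%:R - F (- n.+1%:R)) @ \oo --> (0 : R).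
  apply: norm_cvg0.
  have h : (fun n => 2 * C * n.+1%:R^-1) @ \oo --> (2 * C * 0 : R).
    by apply: cvgM; [exact: cvg_cst|exact: cvg_harmonic].
  rewrite mulr0 in h.
  apply: (squeeze_cvgr _ _ h); last exact: cvg_cst.
  apply: nearW => n; rewrite normr_ge0/=.
  have b (s : R) : `|s| = n.+1%:R -> `|F s| <= C * n.+1%:R^-1.
    by move=> sE; rewrite ler_pdivlMr// mulrC -sE; exact: FC.
  have b1 := b n.+1%:R (ger0_norm (ler0n _ _)).
  have b2 : `|F (- n.+1%:R)| <= C * n.+1%:R^-1 by apply: b; rewrite normrN ger0_norm.
  apply: (le_trans (ler_normB _ _)); apply: (le_trans (lerD b1 b2)).
  by rewrite -mulrA mulr_natl mulr2n.
exact: (cvg_unique _ cv' cv0).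
Unshelve. all: by end_near. Qed.

Definition gauss (al m x : R) := expR (- (al * (x - m) ^+ 2)).

(** The total mass of the Gaussian is read off from the normal density. *)
Lemma gauss_normal (al m : R) : 0 < al ->
  gauss al m = normal_fun m (Num.sqrt (2 * al)^-1).
Proof.
move=> a0; apply/funext => x; rewrite /gauss /normal_fun sqr_sqrtr; last first.
  by rewrite invr_ge0 mulr_ge0// ltW.
congr expR; rewrite mulNr; congr (- _); field.
by rewrite gt_eqF.
Qed.

Lemma integrable_gauss (al m : R) : 0 < al ->
  mu.-integrable setT (EFin \o gauss al m) /\
  \int[mu]_x gauss al m x = Num.sqrt (pi / al).
Proof.
move=> a0; set s := Num.sqrt (2 * al)^-1.
have s0 : s != 0 by rewrite gt_eqF// sqrtr_gt0 invr_gt0 mulr_gt0.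
have p0 := normal_peak_gt0 s0.
have gE x : gauss al m x = (normal_peak s)^-1 * normal_pdf m s x.
  by rewrite gauss_normal// normal_pdfE// mulrA mulVf ?mul1r// gt_eqF.
have ip := integrable_normal_pdf m s.
have ig : mu.-integrable setT (EFin \o gauss al m).
  rewrite (_ : EFin \o _ = (fun x => ((normal_peak s)^-1)%:E * (normal_pdf m s x)%:E)%E).
    exact: integrableZl.
  by apply/funext => x; rewrite /= gE EFinM.
split=> //.
rewrite (_ : Rintegral _ _ _ = \int[mu]_x ((normal_peak s)^-1 * normal_pdf m s x)); last first.
  by apply: eq_Rintegral => x _; rewrite gE.
rewrite RintegralZl//.
rewrite /Rintegral integral_normal_pdf /= mulr1 /normal_peak invrK.
congr Num.sqrt; rewrite /s sqr_sqrtr ?invr_ge0 ?mulr_ge0 ?(ltW a0)//.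
move: (pi : R) => P; by field; rewrite gt_eqF.
Qed.

Lemma continuous_of_derive (f df : R -> R) :
  (forall x : R, is_derive x 1 f (df x)) -> continuous f.
Proof.
move=> H x; apply: differentiable_continuous; apply/derivable1_diffP.
by have [] := H x.
Qed.

Lemma abs_gauss_le (al m x : R) : 0 < al ->
  `|x - m| * gauss al m x <= (1 + 2 / al) * gauss (al / 2) m x.
Proof.
move=> a0; set y := x - m.
have -> : gauss al m x = gauss (al / 2) m x * gauss (al / 2) m x.
  by rewrite /gauss -expRD; congr expR; rewrite -/y; field.
rewrite mulrA ler_wpM2r ?expR_ge0// /gauss expRN -/y.
rewrite ler_pdivrMr ?expR_gt0//.
have h := expR_ge1Dx (al / 2 * y ^+ 2).
have y2 : 0 <= y ^+ 2 by exact: sqr_ge0.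
have yy : `|y| <= 1 + y ^+ 2.
  rewrite -[y ^+ 2]real_normK ?num_real//.
  by have := sqr_ge0 (`|y| - 1); have := sqr_ge0 `|y|; nra.
apply: (le_trans yy); apply: (@le_trans _ _ ((1 + 2 / al) * (1 + al / 2 * y ^+ 2))); last first.
  by apply: ler_wpM2l => //; rewrite addr_ge0// divr_ge0// ltW.
have -> : (1 + 2 / al) * (1 + al / 2 * y ^+ 2) = 1 + y ^+ 2 + (al / 2 * y ^+ 2 + 2 / al).
  by field; rewrite gt_eqF.
by rewrite lerDl; exact: (addr_ge0 (mulr_ge0 (divr_ge0 (ltW a0) (ler0n R 2)) y2) (divr_ge0 (ler0n R 2) (ltW a0))).
Qed.

Lemma integrable_dom (f g : R -> R) : measurable_fun setT f ->
  mu.-integrable setT (EFin \o g) -> (forall x, `|f x| <= g x) ->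
  mu.-integrable setT (EFin \o f).
Proof.
move=> mf ig fg; apply: (le_integrable _ _ _ ig) => //; first exact/measurable_EFinP.
by move=> x _ /=; rewrite lee_fin (le_trans (fg x))// ler_norm.
Qed.

Lemma is_derive_gauss_cos (al m a b x : R) :
  is_derive x 1 (fun x => gauss al m x * cos (b * (x - m) + a))
   (- (2 * al * (x - m)) * (gauss al m x * cos (b * (x - m) + a)) -
     b * (gauss al m x * sin (b * (x - m) + a))).
Proof. by rewrite /gauss; derive_auto; ring. Qed.

Lemma continuous_gauss_cos (al m a b : R) :
  continuous (fun x => gauss al m x * cos (b * (x - m) + a)).
Proof. exact: (@continuous_of_derive _ _ (is_derive_gauss_cos al m a b)). Qed.

Lemma integrable_gauss_cos (al m a b : R) : 0 < al ->
  mu.-integrable setT (EFin \o (fun x => gauss al m x * cos (b * (x - m) + a))).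
Proof.
move=> al0; have [ig _] := integrable_gauss m al0.
apply: (integrable_dom _ ig).
  by apply: continuous_measurable_fun; exact: continuous_gauss_cos.
move=> x; rewrite normrM (ger0_norm (expR_ge0 _)) ler_piMr ?expR_ge0//.
exact: cos_max.
Qed.

(** As a function of b, the integral P has derivative - b / (2 al) P:
    differentiate under the integral sign, then integrate by parts.  Hence
    P b * exp (b^2 / (4 al)) is constant.  The centre m and the additional phase a
    are kept because completing the square in two variables produces both. *)
Lemma gauss_fourier (al m a b : R) : 0 < al ->
  \int[mu]_x (gauss al m x * cos (b * (x - m) + a)) =
  cos a * Num.sqrt (pi / al) * expR (- (b ^+ 2 / (4 * al))).
Proof.
move=> al0.
have [ig Ig] := integrable_gauss m al0.
have al20 : 0 < al / 2 by rewrite divr_gt0.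
have [ig2 _] := integrable_gauss m al20.
pose f (b x : R) := gauss al m x * cos (b * (x - m) + a).
pose df (b x : R) := - (x - m) * gauss al m x * sin (b * (x - m) + a).
have ddfx (b0 x : R) : is_derive x 1 (df b0) (- gauss al m x * sin (b0 * (x - m) + a)
   + 2 * al * (x - m) ^+ 2 * gauss al m x * sin (b0 * (x - m) + a)
   - b0 * (x - m) * gauss al m x * cos (b0 * (x - m) + a)).
  rewrite /df /gauss; derive_auto; ring.
have cf b0 : continuous (f b0) by exact: continuous_gauss_cos.
have cdf b0 : continuous (df b0) by exact: (@continuous_of_derive _ _ (ddfx b0)).
have fb (b0 x : R) : is_derive b0 1 (f ^~ x) (df b0 x).
  by rewrite /f /df; derive_auto; ring.
have intf b0 : mu.-integrable setT (EFin \o f b0) by exact: integrable_gauss_cos.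
pose G x := (1 + 2 / al) * gauss (al / 2) m x.
have iG : mu.-integrable setT (EFin \o G).
  rewrite (_ : EFin \o _ = (fun x => (1 + 2 / al)%:E * (gauss (al / 2) m x)%:E)%E).
    exact: integrableZl.
  by apply/funext => x; rewrite /= EFinM.
have G0 x : 0 <= G x.
  by rewrite mulr_ge0 ?expR_ge0// addr_ge0// divr_ge0// ltW.
have dfG b0 x : `|df b0 x| <= G x.
  apply: le_trans (abs_gauss_le m x al0).
  rewrite /df normrM normrM normrN (ger0_norm (expR_ge0 _)) ler_piMr ?mulr_ge0 ?expR_ge0//.
  exact: sin_max.
have intdf b0 : mu.-integrable setT (EFin \o df b0).
  by apply: (integrable_dom _ iG (dfG b0)); exact: continuous_measurable_fun.
pose P b0 := \int[mu]_x f b0 x.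
(* differentiation under the integral sign, dominated by a wider Gaussian *)
have dP (b0 : R) : is_derive b0 1 P (\int[mu]_x df b0 x).
  have I0 : `]b0 - 1, b0 + 1[%classic b0 by rewrite /= in_itv/=; apply/andP; split; lra.
  have d1 (b1 x : R) : `]b0 - 1, b0 + 1[%classic b1 -> setT x -> derivable (f ^~ x) b1 1.
    by move=> _ _; have [] := fb b1 x.
  have d1E (b1 x : R) : partial1of2 f b1 x = df b1 x.
    by rewrite partial1of2E; have [_ ->] := fb b1 x.
  have Gub (b1 x : R) : `]b0 - 1, b0 + 1[%classic b1 -> setT x -> `|partial1of2 f b1 x| <= G x.
    by move=> _ _; rewrite d1E.
  have D := @derivable_under_integral R _ _ mu f setT measurableT b0 (b0 - 1) (b0 + 1) I0
    (fun b1 _ => intf b1) d1 G G0 iG Gub.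
  have E := @differentiation_under_integral R _ _ mu f setT measurableT b0 (b0 - 1) (b0 + 1) I0
    (fun b1 _ => intf b1) d1 G G0 iG Gub.
  apply: DeriveDef; first exact: D.
  rewrite -derive1E E; apply: eq_Rintegral => x _; exact: d1E.
(* integration by parts against the derivative of the Gaussian *)
have parts b0 : \int[mu]_x df b0 x = - (b0 / (2 * al)) * P b0.
  pose F x := gauss al m x * sin (b0 * (x - m) + a) / (2 * al).
  have dF (x : R) : is_derive x 1 F (df b0 x + b0 / (2 * al) * f b0 x).
    by rewrite /F /df /f /gauss; derive_auto; field; rewrite gt_eqF.
  have ib : mu.-integrable setT (EFin \o (fun x => b0 / (2 * al) * f b0 x)).
    rewrite (_ : EFin \o _ = (fun x => (b0 / (2 * al))%:E * (f b0 x)%:E)%E); last first.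
      by apply/funext => x; rewrite /= EFinM.
    exact: (integrableZl measurableT (b0 / (2 * al)) (intf b0)).
  have : \int[mu]_x (df b0 x + b0 / (2 * al) * f b0 x) = 0.
    apply: (@Rintegral_derive0 F _ ((1 + 2 / al + `|m|) / (2 * al)) dF).
    - move=> x; apply: cvgD; first exact: cdf.
      by apply: cvgM; [exact: cvg_cst|exact: cf].
    - rewrite (_ : EFin \o _ = ((EFin \o df b0) \+ (EFin \o (fun x => b0 / (2 * al) * f b0 x)%R))%E); last first.
        by apply/funext => x; rewrite /= EFinD.
      exact: (integrableD measurableT (intdf b0) ib).
    - move=> x; rewrite /F normrM (ger0_norm (_ : 0 <= (2 * al)^-1)); last first.
        by rewrite invr_ge0 mulr_ge0// ltW.
      rewrite mulrA ler_wpM2r ?invr_ge0 ?mulr_ge0 ?(ltW al0)//.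
      rewrite normrM (ger0_norm (expR_ge0 _)).
      apply: (@le_trans _ _ (`|x| * gauss al m x)).
        by rewrite ler_wpM2l// ler_piMr ?expR_ge0// sin_max.
      have g1 (be : R) : 0 <= be -> gauss be m x <= 1.
        by move=> be0; rewrite /gauss -expR0 ler_expR oppr_le0 mulr_ge0 ?sqr_ge0.
      have g0 : 0 <= gauss al m x by exact: expR_ge0.
      apply: (@le_trans _ _ (`|x - m| * gauss al m x + `|m| * gauss al m x)).
        by rewrite -mulrDl ler_wpM2r// -{1}[x](subrK m) ler_normD.
      apply: lerD.
        apply: (le_trans (abs_gauss_le m x al0)).
        by rewrite ler_piMr ?g1 ?(ltW al20)// addr_ge0// divr_ge0// ltW.
      by rewrite ler_piMr ?g1// ltW.
  rewrite RintegralD// RintegralZl// -/(P b0) => h; lra.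
pose h b0 := P b0 * expR (b0 ^+ 2 / (4 * al)).
have dh (b0 : R) : is_derive b0 1 h 0.
  have e : is_derive b0 (1 : R) (fun b1 => expR (b1 ^+ 2 / (4 * al)))
      (b0 / (2 * al) * expR (b0 ^+ 2 / (4 * al))).
    by derive_auto; field; rewrite gt_eqF.
  apply: der_eq (der_mul (dP b0) e) _.
  by rewrite parts; ring.
have hE := @is_derive_0_is_cst R h b 0 dh.
have P0 : P 0 = cos a * Num.sqrt (pi / al).
  rewrite -Ig -RintegralZl//; apply: eq_Rintegral => x _.
  by rewrite /f mul0r add0r mulrC.
rewrite -/(P b) expRN.
move: hE; rewrite /h P0 expr0n/= mul0r expR0 mulr1 => <-.
by rewrite mulfK// gt_eqF// expR_gt0.
Qed.

End GaussianFourier.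

Section GaussianFourier2.
Context {R : realType}.
Notation mu := (@lebesgue_measure R).
Notation nu := (mu \x mu)%E.

Definition gauss2 (c : R) (p : R * R) := expR (- (c * (p.1 ^+ 2 + p.2 ^+ 2))).

Lemma integrable_gauss2 (c : R) : 0 < c -> nu.-integrable setT (EFin \o gauss2 c).
Proof.
move=> c0; have [ig _] := integrable_gauss 0 c0.
have := integrable_prod ig ig; congr integrable; apply/funext => p.
by rewrite /= /gauss2 /gauss -expRD !subr0; congr (expR _)%:E; ring.
Qed.

(** The quadratic form in the exponent of the transform of the exact solution. *)
Definition form (rho : R) (p : R * R) := p.1 ^+ 2 + 2 * rho * p.1 * p.2 + p.2 ^+ 2.

Lemma measurable_form_cos (rho X Y : R) :
  measurable_fun setT (fun p : R * R => expR (- form rho p) * cos (lin X Y p)).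
Proof.
apply: measurable_funM; last exact: (bmeas_cos X Y).1.
apply: measurableT_comp => //; apply: measurableT_comp => //.
have mf : measurable_fun setT (fun p : R * R => p.1) by exact: measurable_fst.
have ms : measurable_fun setT (fun p : R * R => p.2) by exact: measurable_snd.
apply: measurable_funD; last exact: measurable_funX.
apply: measurable_funD; first exact: measurable_funX.
by apply: measurable_funM => //; exact: measurable_funM.
Qed.

(** form = (y + rho x)^2 + (1 - rho^2) x^2: integrate first in y, around the
    centre - rho x, then in x. *)
Lemma gauss2_fourier (rho X Y : R) : `|rho| < 1 ->
  nu.-integrable setT (EFin \o (fun p => expR (- form rho p) * cos (lin X Y p))) /\
  \int[nu]_p (expR (- form rho p) * cos (lin X Y p)) =
  pi / Num.sqrt (1 - rho ^+ 2) *
    expR (- ((4 * (1 - rho ^+ 2))^-1 * (X ^+ 2 - 2 * rho * X * Y + Y ^+ 2))).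
Proof.
move=> r1.
have c0 : 0 < 1 - `|rho| by rewrite subr_gt0.
have r2 : 0 < 1 - rho ^+ 2.
  rewrite -[rho ^+ 2]real_normK ?num_real// -[1](expr1n _ 2) subr_sqr.
  by rewrite mulr_gt0// ltr_pwDl.
have intg : nu.-integrable setT (EFin \o (fun p => expR (- form rho p) * cos (lin X Y p))).
  apply: (le_integrable _ _ _ (integrable_gauss2 c0)) => //.
    by apply/measurable_EFinP; exact: measurable_form_cos.
  move=> p _ /=; rewrite lee_fin normrM [leRHS]ger0_norm ?expR_ge0// ger0_norm ?expR_ge0//.
  apply: (@le_trans _ _ (expR (- form rho p))).
    by rewrite ler_piMr ?expR_ge0// cos_max.
  by rewrite ler_expR lerN2; exact: form_ge (ltW r1).
split=> //.
rewrite /Rintegral -integral12_prod_meas1; last exact: intg.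
have inner k : (\int[mu]_y (expR (- form rho (k, y)) * cos (lin X Y (k, y)))%:E =
   (Num.sqrt pi * expR (- (Y ^+ 2 / 4)) *
     (gauss (1 - rho ^+ 2) 0 k * cos ((X - rho * Y) * (k - 0) + 0)))%:E)%E.
  have ifc := integrable_gauss_cos (- (rho * k)) ((X - rho * Y) * k) Y (ltr01 : 0 < (1 : R)).
  have E y : expR (- form rho (k, y)) * cos (lin X Y (k, y)) =
      gauss (1 - rho ^+ 2) 0 k * (gauss 1 (- (rho * k)) y *
        cos (Y * (y - - (rho * k)) + (X - rho * Y) * k)).
    rewrite mulrA /gauss -expRD; congr (expR _ * cos _); rewrite /form /lin /=; ring.
  under eq_integral do rewrite E EFinM.
  rewrite integralZl//.
  have GI := gauss_fourier (- (rho * k)) ((X - rho * Y) * k) Y (ltr01 : 0 < (1 : R)).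
  rewrite -[X in (_ * X)%E = _]fineK; last exact: integrable_fin_num.
  rewrite [fine _]GI -EFinM; congr EFin.
  by rewrite subr0 addr0 divr1 mulr1; ring.
have -> : (\int[mu]_x fubini_F mu (EFin \o (fun p => expR (- form rho p) * cos (lin X Y p))%R) x =
  \int[mu]_x (Num.sqrt pi * expR (- (Y ^+ 2 / 4)) *
     (gauss (1 - rho ^+ 2) 0 x * cos ((X - rho * Y) * (x - 0) + 0)))%:E)%E.
  by apply: eq_integral => k _; rewrite /fubini_F /= inner.
rewrite -/(Rintegral mu setT _).
have ifc := integrable_gauss_cos 0 0 (X - rho * Y) r2.
rewrite RintegralZl// gauss_fourier// cos0 mul1r.
rewrite sqrtrM ?pi_ge0// sqrtrV ?(ltW r2)//.
have sp : Num.sqrt pi * Num.sqrt pi = pi :> R by rewrite -expr2 sqr_sqrtr// pi_ge0.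
rewrite -[in RHS]sp.
move: (Num.sqrt pi) (Num.sqrt (1 - rho ^+ 2)) => P S.
have -> : - ((4 * (1 - rho ^+ 2))^-1 * (X ^+ 2 - 2 * rho * X * Y + Y ^+ 2)) =
   - (Y ^+ 2 / 4) + - ((X - rho * Y) ^+ 2 / (4 * (1 - rho ^+ 2))).
  by field; rewrite gt_eqF.
by rewrite expRD; ring.
Qed.

End GaussianFourier2.

(** * The error as an integral over frequencies *)

Section FourierError.
Context {R : realType}.
Notation mu := (@lebesgue_measure R).
Notation nu := (mu \x mu)%E.

(** Fourier inversion for the exact solution, read backwards: the Fourier
    integral of [uhat] is computed and recognized. *)
Lemma exact_solutionE (rho a1 a2 x y : R) : `|rho| < 1 ->
  exact_solution rho a1 a2 x y 1 = (4 * pi ^+ 2)^-1 *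
    \int[nu]_p (expR (- form rho p) * cos (lin (x + a1) (y + a2) p)).
Proof.
move=> r1; have [_ ->] := gauss2_fourier (x + a1) (y + a2) r1.
have r2 : 0 < 1 - rho ^+ 2.
  rewrite -[rho ^+ 2]real_normK ?num_real// -[1](expr1n _ 2) subr_sqr.
  by rewrite mulr_gt0 ?subr_gt0// ltr_pwDl.
rewrite /exact_solution !mulr1 mulrA; congr (_ * expR _).
  have S0 : 0 < Num.sqrt (1 - rho ^+ 2) by rewrite sqrtr_gt0.
  move: S0 (pi_gt0 R); move: (Num.sqrt _) (pi : R) => S P S0 P0.
  by field; rewrite !gt_eqF.
by field; rewrite gt_eqF.
Qed.

Lemma ker_le (h1 h2 : R) (F : R * R -> R[i]) j k p :
  `|ker h1 h2 F j k p| <= normc (F p).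
Proof.
have -> : ker h1 h2 F j k p = Re (F p * cexp 0 (phase h1 h2 j k p)).
  rewrite /cexp expR0 rmorph1 mul1r ReM.
  have -> : Re ((cos (phase h1 h2 j k p))%:C + ci * (sin (phase h1 h2 j k p))%:C) =
      cos (phase h1 h2 j k p).
    by rewrite ReD ReM /= mul0r mulr0 subrr addr0.
  have -> : Im ((cos (phase h1 h2 j k p))%:C + ci * (sin (phase h1 h2 j k p))%:C) =
      sin (phase h1 h2 j k p).
    by rewrite ImD ImM /= mulr0 mul1r !add0r.
  by [].
apply: (le_trans (Re_le_normc _)).
by rewrite normcM normc_cexp expR0 mulr1.
Qed.

Lemma kerB (h1 h2 : R) (F G : R * R -> R[i]) j k p :
  ker h1 h2 (fun p => F p - G p) j k p = ker h1 h2 F j k p - ker h1 h2 G j k p.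
Proof. by rewrite /ker ReD ImD ReN ImN; ring. Qed.

Lemma ker_uhat (rho a1 a2 h1 h2 : R) j k (p : R * R) :
  ker h1 h2 (fun p => uhat rho a1 a2 p.1 p.2) j k p =
  expR (- form rho p) * cos (lin (j%:~R * h1 + a1) (k%:~R * h2 + a2) p).
Proof.
have Ecis t : Re ((cos t)%:C + ci * (sin t)%:C) = cos t :> R.
  by rewrite ReD ReM /= mul0r mulr0 subrr addr0.
have Fcis t : Im ((cos t)%:C + ci * (sin t)%:C) = sin t :> R.
  by rewrite ImD ImM /= mulr0 mul1r !add0r.
have -> : lin (j%:~R * h1 + a1) (k%:~R * h2 + a2) p =
   (a1 * p.1 + a2 * p.2) + phase h1 h2 j k p by rewrite /phase /lin; ring.
rewrite /ker /uhat /cexp ReRM ImRM Ecis Fcis.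
rewrite -/(form rho p); move: (phase h1 h2 j k p) => f; move: (expR (- form rho p)) => e.
by rewrite [cos (_ + f)]cosD mulrBr !mulrA.
Qed.

Lemma mem_box (h1 h2 : R) (p : R * R) : 0 < h1 -> 0 < h2 ->
  (p \in box (pi / h1) (pi / h2)) = inbox h1 h2 p.1 p.2.
Proof.
move=> h10 h20; rewrite /box in_setX /= !mem_setE !in_itv /= /inbox.
have side (h x : R) : 0 < h -> (- (pi / h) <= x <= pi / h) = (`|h * x| <= pi).
  by move=> h0; rewrite -ler_norml normrM (gtr0_norm h0) ler_pdivlMr// mulrC.
by rewrite !side.
Qed.

(** Inside the box the error is a difference of transforms; outside it, only
    the exact transform remains.  A Gaussian bound is integrated over the plane,
    a constant bound over the box, whose area is 4 pi^2 / (h1 h2). *)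
Lemma fourier_error (rho a1 a2 h1 h2 A B c : R) (G : R * R -> R[i]) :
  `|rho| < 1 -> 0 < h1 -> 0 < h2 -> 0 < c -> bsym G ->
  (forall p, inbox h1 h2 p.1 p.2 ->
    normc (G p - uhat rho a1 a2 p.1 p.2) <= A * gauss2 c p + B) ->
  (forall p, ~~ inbox h1 h2 p.1 p.2 ->
    normc (uhat rho a1 a2 p.1 p.2) <= A * gauss2 c p) ->
  forall j k : int,
  `|ifou h1 h2 G j k - exact_solution rho a1 a2 (j%:~R * h1) (k%:~R * h2) 1| <=
  (4 * pi ^+ 2)^-1 * (A * \int[nu]_p gauss2 c p) + B / (h1 * h2).
Proof.
move=> r1 h10 h20 c0 bG inb outb j k.
have e0 : 0 <= pi / h1 :> R by rewrite divr_ge0 ?pi_ge0// ltW.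
have d0 : 0 <= pi / h2 :> R by rewrite divr_ge0 ?pi_ge0// ltW.
set Q := box (pi / h1) (pi / h2).
have mQ : measurable Q by exact: measurable_box.
have k0 : 0 < (4 * pi ^+ 2)^-1 :> R.
  by rewrite invr_gt0 mulr_gt0// exprn_gt0// pi_gt0.
rewrite exact_solutionE// /ifou -mulrBr normrM (gtr0_norm k0).
have [iu _] := gauss2_fourier (j%:~R * h1 + a1) (k%:~R * h2 + a2) r1.
have ig := integrable_gauss2 c0.
have restr f : bmeas f -> nu.-integrable setT (EFin \o (f \_ Q)).
  move=> bf; have := (@integrable_mkcond _ _ _ nu Q (EFin \o f) mQ).1 (bmeas_int e0 d0 bf).
  by rewrite restrict_EFin.
have iK := restr _ (bmeas_ker h1 h2 j k bG).
have iB := restr _ (bmeas_cst B).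
have iA : nu.-integrable setT (EFin \o (fun p => A * gauss2 c p)).
  rewrite (_ : EFin \o _ = (fun p => A%:E * (gauss2 c p)%:E)%E); last first.
    by apply/funext => p; rewrite /= EFinM.
  exact: (integrableZl measurableT A ig).
have iAB : nu.-integrable setT (EFin \o (fun p => A * gauss2 c p + ((fun=> B) \_ Q) p)).
  rewrite (_ : EFin \o _ = ((EFin \o (fun p => (A * gauss2 c p)%R)) \+ (EFin \o ((fun=> B) \_ Q)))%E); last first.
    by apply/funext => p; rewrite /= EFinD.
  exact: (integrableD measurableT iA iB).
rewrite /ibox Rintegral_mkcond -/Q -RintegralB//.
pose d p := (ker h1 h2 G j k \_ Q) p -
  expR (- form rho p) * cos (lin (j%:~R * h1 + a1) (k%:~R * h2 + a2) p).
have id : nu.-integrable setT (EFin \o d).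
  rewrite (_ : EFin \o _ = ((EFin \o (ker h1 h2 G j k \_ Q)) \- (EFin \o (fun p => (expR (- form rho p) * cos (lin (j%:~R * h1 + a1) (k%:~R * h2 + a2) p))%R)))%E); last first.
    by apply/funext => p; rewrite /= EFinB.
  exact: (integrableB measurableT iK iu).
have dle p : `|d p| <= A * gauss2 c p + ((fun=> B) \_ Q) p.
  rewrite /d -(ker_uhat rho a1 a2 h1 h2) !patchE mem_box//.
  case: ifPn => pQ.
    by rewrite -kerB; apply: (le_trans (ker_le _ _ _ _ _ _)); exact: inb.
  by rewrite sub0r normrN addr0; apply: (le_trans (ker_le _ _ _ _ _ _)); exact: outb.
have step : `|\int[nu]_p d p| <= A * \int[nu]_p gauss2 c p + B * (2 * (pi / h1) * (2 * (pi / h2))).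
  apply: (le_trans (le_normr_Rintegral measurableT id)).
  apply: (@le_trans _ _ (\int[nu]_p (A * gauss2 c p + ((fun=> B) \_ Q) p))).
    by apply: le_Rintegral => //; exact: (integrable_norm id).
  rewrite RintegralD// RintegralZl// -Rintegral_mkcond.
  by rewrite -/(ibox (pi / h1) (pi / h2) (fun=> B)) ibox_cst.
apply: (@le_trans _ _ ((4 * pi ^+ 2)^-1 * (A * \int[nu]_p gauss2 c p + B * (2 * (pi / h1) * (2 * (pi / h2)))))).
  by rewrite ler_wpM2l// ltW.
rewrite mulrDr lerD2l le_eqVlt; apply/orP; left; apply/eqP.
move: (pi_gt0 R); move: (pi : R) => P P0.
by field; rewrite !gt_eqF.
Qed.

End FourierError.

(** * Convergence *)

Section Assembly.
Context {R : realType}.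

Lemma ler_exprz_le1 (h : R) (m n : int) : 0 < h -> h <= 1 -> m <= n -> h ^ n <= h ^ m.
Proof.
move=> h0 h1 mn; have -> : n = m + `|n - m|%N%:Z by rewrite gez0_abs ?subr_ge0// subrKC.
rewrite expfzDr ?gt_eqF// ler_piMr ?exprz_ge0 ?(ltW h0)// -exprnP.
by rewrite exprn_ile1 ?(ltW h0).
Qed.

Lemma normc_uhat (rho a1 a2 k e : R) :
  normc (uhat rho a1 a2 k e) = expR (- (k ^+ 2 + 2 * rho * k * e + e ^+ 2)).
Proof. by rewrite /uhat normc_cexp. Qed.

Lemma gauss2_le (c d k e : R) : c <= d ->
  expR (- (d * (k ^+ 2 + e ^+ 2))) <= gauss2 c (k, e).
Proof.
by move=> cd; rewrite /gauss2 ler_expR lerN2 ler_wpM2r// addr_ge0 ?sqr_ge0.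
Qed.

(** Outside the box one of the frequencies exceeds pi / h1 or pi / h2, hence
    1 / sqrt dt when the steps are small. *)
Lemma notin_box (c lambda dt k e : R) : 0 < c -> 0 < lambda -> 0 < dt ->
  dt <= lambda ^+ 2 -> c ^+ 2 * dt <= lambda ^+ 2 ->
  ~~ inbox (dt / lambda) (c * (dt / lambda)) k e ->
  1 <= dt * (k ^+ 2 + e ^+ 2).
Proof.
move=> c0 l0 dt0 dl cdl.
have big (a x : R) : 0 < a -> a ^+ 2 * dt <= lambda ^+ 2 ->
    pi < `|a * (dt / lambda) * x| -> 1 <= dt * x ^+ 2.
  move=> a0 al px.
  have p1 : 1 <= pi :> R by apply: le_trans (pi_ge2 R); rewrite ler1n.
  have h : 1 <= (a * (dt / lambda) * x) ^+ 2.
    rewrite -[_ ^+ 2]real_normK ?num_real// -[1](expr1n _ 2) lerXn2r ?nnegrE//.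
    exact: ltW (le_lt_trans p1 px).
  apply: (le_trans h); rewrite !exprMn exprVn.
  have -> : a ^+ 2 * (dt ^+ 2 * (lambda ^+ 2)^-1) * x ^+ 2 =
      (a ^+ 2 * dt / lambda ^+ 2) * (dt * x ^+ 2) by ring.
  apply: ler_piMl; first by rewrite mulr_ge0 ?sqr_ge0// ltW.
  by rewrite ler_pdivrMr ?exprn_gt0// mul1r.
rewrite /inbox negb_and -!ltNge => /orP[h|h].
  apply: (@le_trans _ _ (dt * k ^+ 2)).
    by apply: (big 1) => //; rewrite ?expr1n mul1r.
  by rewrite ler_wpM2l ?(ltW dt0)// lerDl sqr_ge0.
apply: (@le_trans _ _ (dt * e ^+ 2)); first exact: (big c).
by rewrite ler_wpM2l ?(ltW dt0)// lerDr sqr_ge0.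
Qed.

Lemma eventually_inv_le (d : R) : 0 < d ->
  exists n0 : nat, forall n : nat, (n0 <= n)%N -> (0 < n)%N -> n%:R^-1 <= d.
Proof.
move=> d0; exists (Num.bound d^-1) => n hn n0.
rewrite -[d]invrK lef_pV2 ?posrE ?invr_gt0 ?ltr0n//.
apply: ltW; apply: (lt_le_trans (archi_boundP _)); first by rewrite invr_ge0 ltW.
by rewrite ler_nat.
Qed.

End Assembly.

Theorem mainTheorem1 (R : realType) (rho a1 a2 theta c lambda : R) (N0 : nat)
    (hrho : `|rho| < 1)
    (htheta : Num.max (1 / 4) ((1 + `|rho|) / 6) < theta)
    (hc : 0 < c) (hlambda : 0 < lambda) :
  exists (K : R) (Nstar : nat),
    0 < K /\ (maxn 1 N0 <= Nstar)%N /\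
    forall N : nat, (Nstar <= N)%N ->
      let dt : R := N%:R^-1 in
      let h : R := dt / lambda in
      let h1 : R := h in
      let h2 : R := c * h in
      forall j k : int,
        `| numerical_solution rho a1 a2 theta dt h1 h2 N0 N j k
           - exact_solution rho a1 a2 (j%:~R * h1) (k%:~R * h2) 1 |
        <= K * h ^ (Num.min 2 (2 * N0%:Z - 2)).
Proof.
have th4 : 1 / 4 < theta by move: htheta; rewrite gt_max => /andP[].
have th6 : 1 + `|rho| < 6 * theta.
  by move: htheta; rewrite gt_max => /andP[_]; rewrite ltr_pdivrMr// mulrC.
have th0 : 0 <= theta by apply: le_trans (ltW th4); rewrite divr_ge0.
have [C1 [k1 [d1 [C10 k10 d10 low]]]] :=
  pointwise_low a1 a2 N0 hrho th4 th6 hc hlambda.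
have [C2 [d2 [C20 d20 high]]] :=
  pointwise_high a1 a2 N0 hrho th4 th6 hc hlambda.
have [C3 [k3 [C30 k30 gh]]] := gauss_high hrho.
pose g := Num.min k1 k3.
have g0 : 0 < g by rewrite lt_min k10.
pose J := \int[((@lebesgue_measure R) \x (@lebesgue_measure R))%E]_p gauss2 g p.
have J0 : 0 <= J by apply: Rintegral_ge0 => p _; exact: expR_ge0.
(* dt <= d makes the frequency bounds available, gives h <= 1, and puts the
   complement of the box into the region dt (k^2 + e^2) >= 1 *)
pose d := Num.min (Num.min d1 d2)
  (Num.min lambda (Num.min (lambda ^+ 2) (lambda ^+ 2 / c ^+ 2))).
have d0 : 0 < d by rewrite !lt_min d10 d20 hlambda exprn_gt0 ?divr_gt0 ?exprn_gt0.
have [n0 Hn0] := eventually_inv_le d0.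
(* K1 multiplies h^2, and K2 multiplies h^(2 N0 - 2) *)
pose K1 := (4 * pi ^+ 2)^-1 * (C1 + C3) * lambda ^+ 2 * J.
pose K2 := C2 * lambda ^+ (2 * N0) / c.
have p20 : 0 < (4 * pi ^+ 2)^-1 :> R.
  by rewrite invr_gt0 mulr_gt0// exprn_gt0// pi_gt0.
have K10 : 0 <= K1.
  rewrite /K1; apply: mulr_ge0 => //; apply: mulr_ge0; last exact: sqr_ge0.
  by apply: mulr_ge0; [exact: ltW|exact: addr_ge0 (ltW C10) (ltW C30)].
have K20 : 0 < K2 by rewrite /K2 !(mulr_gt0, invr_gt0, exprn_gt0).
exists (K1 + K2), (maxn n0 (maxn N0.+1 (2 * N0))).
split; first exact: ltr_wpDl.
split.
  apply: (@leq_trans N0.+1); first by rewrite geq_max ltnS leq0n leqnSn.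
  exact: leq_trans (leq_maxl _ _) (leq_maxr _ _).
move=> N; rewrite !geq_max => /and3P[nN N0N NN0] dt h h1 h2 j k.
have N1 : (0 < N)%N by exact: leq_trans N0N.
have dt0 : 0 < dt by rewrite invr_gt0 ltr0n.
have dtd : dt <= d by exact: Hn0.
have {dtd} [[dt1 dt2] [dtl dtl2 dtlc]] :
    (dt <= d1 /\ dt <= d2) /\
    [/\ dt <= lambda, dt <= lambda ^+ 2 & c ^+ 2 * dt <= lambda ^+ 2].
  move: dtd; rewrite !le_min => /andP[/andP[-> ->] /and3P[-> -> dtc]].
  by split=> //; split=> //; rewrite mulrC -ler_pdivlMr// exprn_gt0.
have h0 : 0 < h by rewrite divr_gt0.
have hle1 : h <= 1 by rewrite ler_pdivrMr// mul1r.
have h20 : 0 < h2 by rewrite mulr_gt0.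
have [-> bG] := numerical_solutionE a1 a2 (ltW hrho) th0 (ltW dt0) h0 h20 N0 N.
move: bG; rewrite (minn_idPr (ltnW N0N)) => bG.
have A0 : 0 <= (C1 + C3) * dt ^+ 2 by rewrite mulr_ge0 ?sqr_ge0// addr_ge0 ?ltW.
have B0 : 0 <= C2 * dt ^+ (2 * N0) by rewrite mulr_ge0 ?exprn_ge0 ?ltW.
have gle1 : g <= k1 by rewrite ge_min lexx.
have gle3 : g <= k3 by rewrite ge_min lexx orbT.
have tail (p : R * R) : 1 <= dt * (p.1 ^+ 2 + p.2 ^+ 2) ->
    normc (uhat rho a1 a2 p.1 p.2) <= C3 * (dt ^+ 2 * gauss2 g p).
  move=> hp; rewrite normc_uhat; apply: (le_trans (gh _ _ _ dt0 hp)).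
  rewrite ler_wpM2l ?(ltW C30)// ler_wpM2l ?sqr_ge0//.
  by case: p hp => x y _; exact: gauss2_le.
have T0 (p : R * R) : 0 <= dt ^+ 2 * gauss2 g p.
  by rewrite mulr_ge0 ?sqr_ge0 ?expR_ge0.
have tailA (p : R * R) : 1 <= dt * (p.1 ^+ 2 + p.2 ^+ 2) ->
    normc (uhat rho a1 a2 p.1 p.2) <= (C1 + C3) * dt ^+ 2 * gauss2 g p.
  move=> hp; apply: (le_trans (tail p hp)); rewrite -mulrA mulrDl lerDr.
  by rewrite mulr_ge0 ?(ltW C10).
apply: (le_trans (@fourier_error R rho a1 a2 h1 h2 ((C1 + C3) * dt ^+ 2)
  (C2 * dt ^+ (2 * N0)) g _ hrho h0 h20 g0 bG _ _ j k)).
- move=> p pin; have [q1|q1] := lerP (dt * (p.1 ^+ 2 + p.2 ^+ 2)) 1.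
    apply: (le_trans (low N p.1 p.2 N0N dt1 pin q1)).
    apply: (@le_trans _ _ (C1 * (dt ^+ 2 * gauss2 g p))).
      rewrite ler_wpM2l ?(ltW C10)// ler_wpM2l ?sqr_ge0//.
      by case: p pin q1 => x y _ _; exact: gauss2_le.
    have -> : (C1 + C3) * dt ^+ 2 * gauss2 g p =
        C1 * (dt ^+ 2 * gauss2 g p) + C3 * (dt ^+ 2 * gauss2 g p) by ring.
    by rewrite -addrA lerDl addr_ge0// mulr_ge0// ltW.
  apply: (le_trans (le_normcD _ _)); rewrite normcN.
  rewrite addrC lerD//; first exact: tailA (ltW q1).
  exact: (high N p.1 p.2 N0N NN0 dt2 pin (ltW q1)).
- move=> p pout; apply: tailA.
  exact: (notin_box hc hlambda dt0 dtl2 dtlc pout).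
rewrite [leRHS]mulrDl; apply: lerD.
  rewrite -/J (_ : _ * _ = K1 * h ^ 2%:Z); last first.
    rewrite -exprnP /K1 /h expr_div_n; clear -hlambda.
    move: (lambda) hlambda J (pi_gt0 R); move: (pi : R) => P l l0 I P0.
    by field; rewrite !gt_eqF.
  by rewrite ler_wpM2l// ler_exprz_le1// ge_min lexx.
rewrite (_ : _ / _ = K2 * h ^ (2 * N0%:Z - 2)); last first.
  have -> : dt = lambda * h by rewrite /h mulrC divfK ?gt_eqF.
  rewrite expfzDr ?gt_eqF// -[2 * N0%:Z]/(Posz (2 * N0)) -exprnP -exprnN /K2 /h1 /h2.
  rewrite exprMn; move: (lambda ^+ _) (h ^+ (2 * N0)) => u v.
  by field; rewrite !gt_eqF.
by rewrite ler_wpM2l ?(ltW K20)// ler_exprz_le1// ge_min lexx orbT.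
Qed.
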